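(* Let $\{\varepsilon_k\}_{k\in\mathbb{Z}}$ be a sequence of real numbers and let $L=\sup_k|\varepsilon_k|$. Suppose that $L<0.111$. Then any function $f\in PW_{2\pi}$ is completely determined by its values $\{f(n+\varepsilon_n)\}_{n\in\mathbb{Z}}$ and those of its derivative $\{f'(n+\varepsilon_n)\}_{n\in\mathbb{Z}}$, and there is $C=C(L)>0$ such that $$\frac1C\sum_{n\in\mathbb{Z}}\left(|f(n+\varepsilon_n)|^2+|f'(n+\varepsilon_n)|^2\right)\le\|f\|_2^2\le C\sum_{n\in\mathbb{Z}}\left(|f(n+\varepsilon_n)|^2+|f'(n+\varepsilon_n)|^2\right)$$ for all $f\in PW_{2\pi}$. Moreover, there are functions $g_n,h_n\in PW_{2\pi}$ $(n\in\mathbb{Z})$ so that, for all $f\in PW_{2\pi}$ and all $x\in\mathbb{R}$, $$f(x)=\sum_{n\in\mathbb{Z}}\left\{f(n+\varepsilon_n)g_n(x)+f'(n+\varepsilon_n)h_n(x)\right\},$$ where convergence holds absolutely.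
   Context: The Fourier transform is $\widehat f(\xi)=\int_{\mathbb{R}}f(x)e^{-2\pi i x\xi}\,dx$. $PW_{2\pi}$ denotes the Paley--Wiener space of functions $f\in L^2(\mathbb{R})$ of exponential type at most $2\pi$, i.e. those with $\widehat f$ supported in $[-1,1]$; each such $f$ is identified with its entire extension, so pointwise values of $f$ and $f'$ make sense. $\|\cdot\|_2$ is the $L^2(\mathbb{R})$ norm. *)

(* Defs.v *)
From HB Require Import structures.
From mathcomp Require Import all_boot all_order all_algebra.
From mathcomp Require Import all_classical all_reals all_analysis.
From mathcomp Require summability.
From mathcomp Require Export complex.

Set Implicit Arguments.
Unset Strict Implicit.
Unset Printing Implicit Defensive.

Import Order.TTheory GRing.Theory Num.Theory.
Import numFieldNormedType.Exports.

Local Open Scope classical_set_scope.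
Local Open Scope ring_scope.
Local Open Scope complex_scope.

Section PaleyWiener.
Context {R : realType}.
Local Notation mu := (@lebesgue_measure R).

(* R[i], seen as a numFieldType so that it receives its norm topology and its
   structure of normed space over itself. *)
Definition Cplx : numFieldType := R[i].

(* The modulus as an element of R: in MathComp `|z| lies in R[i]. *)
Definition cabs (z : R[i]) : R := complex.Re `|z|.

(* e^(i t) *)
Definition cis (t : R) : R[i] := cos t +i* sin t.

Definition cintegral (D : set R) (f : R -> R[i]) : R[i] :=
  (\int[mu]_(x in D) complex.Re (f x)) +i* (\int[mu]_(x in D) complex.Im (f x)).

Definition cderive (f : R -> R[i]) (x : R) : R[i] :=
  derive1 (fun t => complex.Re (f t)) x +i* derive1 (fun t => complex.Im (f t)) x.

Definition L2norm (f : R -> R[i]) : \bar R :=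
  Lnorm mu 2%:E (fun x => (cabs (f x))%:E).

Definition L2 (f : R -> R[i]) : Prop :=
  [/\ measurable_fun setT (fun x => complex.Re (f x)),
      measurable_fun setT (fun x => complex.Im (f x)) & (L2norm f < +oo)%E].

(* For D = setT and integrable f this is the Fourier transform of f. *)
Definition fourier_on (D : set R) (f : R -> R[i]) (xi : R) : R[i] :=
  cintegral D (fun x => f x * cis (- (2 * pi * x * xi))).

(* An L2 function need not be integrable, so its Fourier transform is the
   Plancherel one: the L2 limit of the transforms of its truncations to
   [-T, T]. It is unique up to a null set. *)
Definition is_fourier_L2 (f phi : R -> R[i]) : Prop :=
  [/\ L2 f, L2 phi &
      L2norm (fun xi => phi xi - fourier_on `[- T, T] f xi) @[T --> +oo] --> 0%E].

Definition entire (F : Cplx -> Cplx) : Prop :=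
  forall z : Cplx, derivable (F : Cplx -> Cplx^o) z 1.

(* The space PW_(2 pi), as functions on R: the entire extension selects the
   representative of the L2 class, so that values and derivatives at points are
   meaningful. The Fourier transform, an L2 function, is supported in [-1, 1]
   when it vanishes almost everywhere outside that interval. *)
Definition PW2pi (f : R -> R[i]) : Prop :=
  [/\ L2 f,
      exists2 phi : R -> R[i], is_fourier_L2 f phi &
        {ae mu, forall xi, 1 < `|xi| -> phi xi = 0}
    & exists2 F : Cplx -> Cplx, entire F & forall x : R, F x%:C = f x].

(* Unconditional convergence: along the net of finite sets of integers. *)
Definition sums_to (u : int -> R[i]) (l : R[i]) : Prop :=
  summability.partial_sum (u : int -> Cplx) @ summability.totally --> (l : Cplx).

Definition abs_summable (u : int -> R[i]) : Prop :=
  (\esum_(n in [set: int]) (cabs (u n))%:E < +oo)%E.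

Definition node (eps : int -> R) (n : int) : R := n%:~R + eps n.

Definition sample_energy (eps : int -> R) (f : R -> R[i]) : \bar R :=
  \esum_(n in [set: int])
    (cabs (f (node eps n)) ^+ 2 + cabs (cderive f (node eps n)) ^+ 2)%:E.

End PaleyWiener.

(* Main.v *)
Require Import Defs.
From mathcomp Require Import all_boot all_order all_algebra.
From mathcomp Require Import all_classical all_reals all_analysis.
From mathcomp Require Import finmap measurable_realfun.
From mathcomp Require Import ring lra.

(** Cut the spectrum [-1, 1] of f into its two halves and translate both to
    I = [-1/2, 1/2]: this gives P and M in L^2(I) such that
      f(x) = int_I P(s) e^(2 pi i x (s + 1/2)) + M(s) e^(2 pi i x (s - 1/2)) ds
    (PW_glue). With sigma = 2 s, the numbers (-1)^n f(n) and
    (-1)^n f'(n) / (pi i) are the n-th Fourier coefficients on I of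
      A = P + M   and   B = (sigma + 1) P + (sigma - 1) M,
    and (P, M) is recovered from (A, B) with bounded norms. When all eps_n
    vanish, the theorem therefore is Parseval's identity together with the
    Riesz-Fischer theorem.

    At the nodes n + eps_n put t_n = pi eps_n, so that |t_n| <= 0.349 (th0).
    Rotating the pair of samples f, f' / (pi i) by the angle t_n, which is a
    unitary operation, one obtains the n-th coefficients of m11 A + m12 B and
    m21 A + m22 B, where the functions m_ij of s depend on n through t_n only
    and form the identity matrix when t_n = 0 (dataX_glue, dataY_glue). Since
    m_ij - delta_ij is a combination of remainders of the exponential series
    in i t_n sigma, and since each power of t_n sigma is the product of a
    bounded sequence and a bounded function, Bessel's inequality bounds the
    corresponding operators from L^2(I) to l^2(Z) by remainders of the series
    of e^th0 (expi_rem_bound, as in the theorems of Duffin-Eachus and Kadec).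
    The four norms are at most 0.1748, 0.1659, 0.6223 and 0.874 (symbol11,
    symbol12, symbol21, symbol22), and for the norm |A| + (53/40) |B| the whole
    perturbation is a contraction of ratio 0.9995 (weighted_contraction); this
    is where 0.111 is used, with pi <= 22/7.

    So the data map differs by a contraction from the isometry of L^2(I)^2 onto
    l^2(Z)^2 given by Fourier coefficients. Hence it is bounded above and below (energy_upper, energy_lower),
    which are the two inequalities and the uniqueness, and it is onto, by
    iteration (interpolation). The functions g_n and h_n are the interpolants of
    the unit data; a finite partial sum of the expansion differs from f by the
    function whose data are those of f outside the finite set, which the lower
    bound makes small (expansion). Pointwise values are controlled by the norm
    because the spectrum is bounded.

    This rests on the L^2 theory of Fourier series, where completeness of the
    exponentials is reduced to indicators of intervals and these are treated by
    Chernoff's telescoping argument (trig_cvg_locally_cst, chi_dense, coef_eq0);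
    on Plancherel's theorem for compactly supported functions, obtained from
    Parseval's identity by cutting the line into periods (plancherel_compact);
    and on the identification of the Paley-Wiener space with the inverse
    transforms of L^2([-1, 1]) (PW_ift, PW_rep). *)

Set Implicit Arguments.
Unset Strict Implicit.
Unset Printing Implicit Defensive.

Import Order.TTheory GRing.Theory Num.Theory.
Import numFieldNormedType.Exports.

Local Open Scope classical_set_scope.
Local Open Scope ring_scope.
Local Open Scope complex_scope.

Local Notation "z ^J" := (conjc z) (at level 2, format "z ^J").

(** * Complex modulus *)

Section ComplexModulus.
Context {R : realType}.
Implicit Types z w : R[i].
Local Notation Re := (@complex.Re R).
Local Notation Im := (@complex.Im R).

Lemma cReD z w : Re (z + w) = Re z + Re w. Proof. by case: z; case: w. Qed.
Lemma cImD z w : Im (z + w) = Im z + Im w. Proof. by case: z; case: w. Qed.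
Lemma cReN z : Re (- z) = - Re z. Proof. by case: z. Qed.
Lemma cImN z : Im (- z) = - Im z. Proof. by case: z. Qed.
Lemma cReM z w : Re (z * w) = Re z * Re w - Im z * Im w.
Proof. by case: z; case: w. Qed.
Lemma cImM z w : Im (z * w) = Re z * Im w + Im z * Re w.
Proof. by case: z; case: w. Qed.
Lemma cReJ z : Re (z^J) = Re z. Proof. by case: z. Qed.
Lemma cImJ z : Im (z^J) = - Im z. Proof. by case: z. Qed.
Lemma cRe0 : Re 0 = 0. Proof. by []. Qed.
Lemma cIm0 : Im 0 = 0. Proof. by []. Qed.

Definition cReImE := (cReD, cImD, cReN, cImN, cReM, cImM, cReJ, cImJ, cRe0, cIm0).

Lemma complexE z w : Re z = Re w -> Im z = Im w -> z = w.
Proof. by case: z; case: w => a b c d /= -> ->. Qed.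

Lemma cRe_sum (I : Type) (r : seq I) (P : pred I) (F : I -> R[i]) :
  Re (\sum_(i <- r | P i) F i) = \sum_(i <- r | P i) Re (F i).
Proof. by apply: (big_morph Re cReD). Qed.

Lemma cIm_sum (I : Type) (r : seq I) (P : pred I) (F : I -> R[i]) :
  Im (\sum_(i <- r | P i) F i) = \sum_(i <- r | P i) Im (F i).
Proof. by apply: (big_morph Im cImD). Qed.

Lemma cabsE z : cabs z = Num.sqrt (Re z ^+ 2 + Im z ^+ 2).
Proof. by case: z. Qed.

Lemma normc_cabs z : `|z| = (cabs z)%:C.
Proof. by case: z. Qed.

Lemma cabs_ge0 z : 0 <= cabs z.
Proof. by rewrite cabsE sqrtr_ge0. Qed.

Lemma cabs2E z : cabs z ^+ 2 = Re z ^+ 2 + Im z ^+ 2.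
Proof. by rewrite cabsE sqr_sqrtr// addr_ge0// sqr_ge0. Qed.

Lemma cabsM z w : cabs (z * w) = cabs z * cabs w.
Proof.
by have := normrM z w; rewrite !normc_cabs -rmorphM/= => -[].
Qed.

Lemma cabs_triangle z w : cabs (z + w) <= cabs z + cabs w.
Proof.
by have := ler_normD z w; rewrite !normc_cabs -rmorphD/= lecR.
Qed.

Lemma cabsN z : cabs (- z) = cabs z.
Proof. by rewrite !cabsE !cReImE !sqrrN. Qed.

Lemma cabsJ z : cabs (z^J) = cabs z.
Proof. by rewrite !cabsE !cReImE !sqrrN. Qed.

Lemma cabsR (x : R) : cabs x%:C = `|x|.
Proof. by rewrite cabsE/= expr0n addr0 sqrtr_sqr. Qed.

Lemma cabs0 : cabs (0 : R[i]) = 0.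
Proof. by rewrite (cabsR 0) normr0. Qed.

Lemma cabs1 : cabs (1 : R[i]) = 1.
Proof. by rewrite (cabsR 1) normr1. Qed.

Lemma cabsi : cabs ('i%C : R[i]) = 1.
Proof. by rewrite cabsE/= expr0n add0r expr1n sqrtr1. Qed.

Lemma cabs_eq0 z : cabs z = 0 -> z = 0.
Proof.
by move=> z0; apply/eqP; rewrite -normr_eq0 normc_cabs z0.
Qed.

Lemma cabs_cis (t : R) : cabs (cis t) = 1.
Proof. by rewrite cabsE/= cos2Dsin2 sqrtr1. Qed.

Lemma cabsV z : cabs (z^-1) = (cabs z)^-1.
Proof.
have [->|z0] := eqVneq z 0; first by rewrite invr0 cabs0 invr0.
have cz : cabs z != 0 by apply/eqP => /cabs_eq0; apply/eqP.
by apply: (mulfI cz); rewrite -cabsM !divff// cabs1.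
Qed.

Lemma ler_Re_cabs z : `|Re z| <= cabs z.
Proof.
rewrite -(@ler_pXn2r _ 2)// ?nnegrE ?cabs_ge0// cabs2E real_normK ?num_real//.
by rewrite lerDl sqr_ge0.
Qed.

Lemma ler_Im_cabs z : `|Im z| <= cabs z.
Proof.
rewrite -(@ler_pXn2r _ 2)// ?nnegrE ?cabs_ge0// cabs2E real_normK ?num_real//.
by rewrite lerDr sqr_ge0.
Qed.

Lemma cabs_le_ReIm z : cabs z <= `|Re z| + `|Im z|.
Proof.
rewrite -(@ler_pXn2r _ 2)// ?nnegrE ?cabs_ge0 ?addr_ge0// cabs2E sqrrD.
rewrite !real_normK ?num_real// -addrA lerD2l lerDr.
by rewrite mulrn_wge0// mulr_ge0.
Qed.

Lemma mulcJ z : z * z^J = (cabs z ^+ 2)%:C.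
Proof. by apply: complexE; rewrite !cReImE/= ?cabs2E; ring. Qed.

Lemma cJM z w : (z * w)^J = z^J * w^J.
Proof. by apply: complexE; rewrite !cReImE; ring. Qed.

Lemma cJD z w : (z + w)^J = z^J + w^J.
Proof. by apply: complexE; rewrite !cReImE; ring. Qed.

Lemma cJK z : (z^J)^J = z.
Proof. by apply: complexE; rewrite !cReImE; ring. Qed.

Lemma cJR (x : R) : (x%:C)^J = x%:C.
Proof. by apply: complexE; rewrite ?cReImE//= oppr0. Qed.

Lemma cJ_sum (I : Type) (r : seq I) (P : pred I) (F : I -> R[i]) :
  (\sum_(i <- r | P i) F i)^J = \sum_(i <- r | P i) (F i)^J.
Proof. by apply: (big_morph (fun z : R[i] => z^J) cJD); exact: cJR. Qed.

Lemma cisD (s t : R) : cis (s + t) = cis s * cis t.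
Proof.
by apply: complexE; rewrite !cReImE/= ?cosD ?sinD//; ring.
Qed.

Lemma cisN (t : R) : cis (- t) = (cis t)^J.
Proof. by apply: complexE; rewrite !cReImE/= ?cosN ?sinN. Qed.

Lemma cis0 : cis 0 = 1 :> R[i].
Proof. by apply: complexE; rewrite /= ?cos0 ?sin0. Qed.

(** The quadratic form of the triangle inequality: summed over an index or
    integrated, it yields Minkowski's inequality by taking for p and q the
    two norms. *)
Lemma cabs_sqrD (p q : R) z w : 0 < p -> 0 < q ->
  cabs (z + w) ^+ 2 <= (p + q) * (cabs z ^+ 2 / p + cabs w ^+ 2 / q).
Proof.
move=> p0 q0.
have h : cabs (z + w) ^+ 2 <= (cabs z + cabs w) ^+ 2.
  by rewrite ler_pXn2r ?nnegrE ?addr_ge0 ?cabs_ge0// cabs_triangle.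
apply: (le_trans h); rewrite -subr_ge0.
set a := cabs z; set b := cabs w.
have -> : (p + q) * (a ^+ 2 / p + b ^+ 2 / q) - (a + b) ^+ 2
  = (q * a - p * b) ^+ 2 / (p * q) by field; rewrite !gt_eqF.
by rewrite divr_ge0 ?sqr_ge0// mulr_ge0// ltW.
Qed.

End ComplexModulus.

(** * Integration of complex functions *)

Section ComplexIntegral.
Context {R : realType}.
Local Notation mu := (@lebesgue_measure R).
Local Notation Re := (@complex.Re R).
Local Notation Im := (@complex.Im R).
Implicit Types (D : set R) (f g : R -> R[i]).

Definition cmeas D f :=
  measurable_fun D (fun x => Re (f x)) /\ measurable_fun D (fun x => Im (f x)).

Definition cintble D f :=
  mu.-integrable D (EFin \o (fun x => Re (f x))) /\
  mu.-integrable D (EFin \o (fun x => Im (f x))).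

Lemma cmeasD D f g : cmeas D f -> cmeas D g -> cmeas D (fun x => f x + g x).
Proof.
move=> [f1 f2] [g1 g2]; split.
  by under eq_fun do rewrite cReD; exact: measurable_funD.
by under eq_fun do rewrite cImD; exact: measurable_funD.
Qed.

Lemma cmeasN D f : cmeas D f -> cmeas D (fun x => - f x).
Proof.
move=> [f1 f2]; split.
  by under eq_fun do rewrite cReN; exact: measurableT_comp.
by under eq_fun do rewrite cImN; exact: measurableT_comp.
Qed.

Lemma cmeasB D f g : cmeas D f -> cmeas D g -> cmeas D (fun x => f x - g x).
Proof. by move=> mf mg; apply: cmeasD => //; exact: cmeasN. Qed.

Lemma cmeasM D f g : cmeas D f -> cmeas D g -> cmeas D (fun x => f x * g x).
Proof.
move=> [f1 f2] [g1 g2]; split.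
  by under eq_fun do rewrite cReM; apply: measurable_funB; exact: measurable_funM.
by under eq_fun do rewrite cImM; apply: measurable_funD; exact: measurable_funM.
Qed.

Lemma cmeasJ D f : cmeas D f -> cmeas D (fun x => (f x)^J).
Proof.
move=> [f1 f2]; split.
  by under eq_fun do rewrite cReJ.
by under eq_fun do rewrite cImJ; exact: measurableT_comp.
Qed.

Lemma cmeas_cst D (c : R[i]) : cmeas D (fun=> c).
Proof. by split; exact: measurable_cst. Qed.

Lemma cmeasR D (h : R -> R) : measurable_fun D h -> cmeas D (fun x => (h x)%:C).
Proof. by move=> mh; split => //=; exact: measurable_cst. Qed.

Lemma cmeas_cis D (h : R -> R) : measurable_fun D h -> cmeas D (fun x => cis (h x)).
Proof.
by move=> mh; split => /=; apply: measurableT_comp => //;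
  apply: continuous_measurable_fun; [exact: continuous_cos|exact: continuous_sin].
Qed.

Lemma cmeasS D E f : measurable E -> D `<=` E -> cmeas E f -> cmeas D f.
Proof. by move=> mE DE [f1 f2]; split; exact: measurable_funS f1 || exact: measurable_funS f2. Qed.

Lemma measurable_cabs D f : cmeas D f -> measurable_fun D (fun x => cabs (f x)).
Proof.
move=> [f1 f2]; under eq_fun do rewrite cabsE.
apply: (@measurableT_comp _ _ _ _ _ _ (@Num.sqrt R)) => //.
  by apply: continuous_measurable_fun; exact: sqrt_continuous.
by apply: measurable_funD; exact: measurable_funX.
Qed.

Lemma measurable_cabs2 D f : cmeas D f ->
  measurable_fun D (fun x => ((cabs (f x)) ^+ 2)%:E).
Proof.
by move=> mf; apply/measurable_EFinP; apply: measurable_funX; exact: measurable_cabs.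
Qed.

Lemma cintble_meas D f : cintble D f -> cmeas D f.
Proof.
by move=> [/measurable_int/measurable_EFinP f1 /measurable_int/measurable_EFinP f2].
Qed.

Lemma cintble_le D f (h : R -> R) : measurable D -> cmeas D f ->
  (forall x, D x -> cabs (f x) <= h x) -> mu.-integrable D (EFin \o h) ->
  cintble D f.
Proof.
move=> mD [m1 m2] fh ih; split; apply: le_integrable (ih) => //=;
  try exact/measurable_EFinP.
  move=> x Dx; rewrite lee_fin.
  by rewrite (le_trans (ler_Re_cabs _))// (le_trans (fh x Dx))// ler_norm.
move=> x Dx; rewrite lee_fin.
by rewrite (le_trans (ler_Im_cabs _))// (le_trans (fh x Dx))// ler_norm.
Qed.

Lemma cintble_cabs D f : measurable D -> cintble D f ->
  mu.-integrable D (EFin \o (fun x => cabs (f x))).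
Proof.
move=> mD fi; have [i1 i2] := fi.
have m := measurable_cabs (cintble_meas fi).
have := @integrableD _ _ _ mu _ mD _ _ (integrable_abse i1) (integrable_abse i2).
apply: le_integrable => //=; first exact/measurable_EFinP.
move=> x Dx; rewrite !lee_fin ger0_norm ?cabs_ge0//.
by rewrite (le_trans (cabs_le_ReIm _))// ler_norm.
Qed.

Lemma cintbleD D f g : measurable D ->
  cintble D f -> cintble D g -> cintble D (fun x => f x + g x).
Proof.
move=> mD [f1 f2] [g1 g2]; split.
  rewrite (_ : _ \o _ = (EFin \o (fun x => Re (f x))) \+ (EFin \o (fun x => Re (g x))))%E.
    exact: integrableD.
  by apply/funext => x /=; rewrite cReD.
rewrite (_ : _ \o _ = (EFin \o (fun x => Im (f x))) \+ (EFin \o (fun x => Im (g x))))%E.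
  exact: integrableD.
by apply/funext => x /=; rewrite cImD.
Qed.

Lemma cintbleZ D (c : R[i]) f : measurable D -> cintble D f ->
  cintble D (fun x => c * f x).
Proof.
move=> mD fi; apply: (cintble_le (h := fun x => cabs c * cabs (f x))) => //.
- by apply: cmeasM; [exact: cmeas_cst|exact: cintble_meas].
- by move=> x _; rewrite cabsM.
rewrite (_ : _ \o _ = (fun x => (cabs c)%:E * (EFin \o (fun x => cabs (f x))) x)%E)//.
by apply: integrableZl => //; exact: cintble_cabs.
Qed.

Lemma cintbleN D f : measurable D -> cintble D f -> cintble D (fun x => - f x).
Proof.
move=> mD /(cintbleZ (-1) mD); congr cintble; apply/funext => x.
by rewrite mulN1r.
Qed.

Lemma cintbleB D f g : measurable D ->
  cintble D f -> cintble D g -> cintble D (fun x => f x - g x).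
Proof. by move=> mD fi gi; apply: cintbleD => //; exact: cintbleN. Qed.

Lemma cintble_sum D (I : Type) (r : seq I) (F : I -> R -> R[i]) : measurable D ->
  (forall i, cintble D (F i)) -> cintble D (fun x => \sum_(i <- r) F i x).
Proof.
move=> mD iF; elim: r => [|i r ih].
  under eq_fun do rewrite big_nil; split; apply: eq_integrable (integrable0 _ _) => //.
by under eq_fun do rewrite big_cons; exact: cintbleD.
Qed.

Lemma eq_cint D f g : (forall x, D x -> f x = g x) ->
  cintegral D f = cintegral D g.
Proof.
move=> fg; rewrite /cintegral; congr (_ +i* _);
  by apply: eq_Rintegral => x /set_mem /fg ->.
Qed.

Lemma eq_cintble D f g : measurable D -> (forall x, D x -> f x = g x) ->
  cintble D f -> cintble D g.
Proof.
move=> mD fg [i1 i2]; split; [apply: eq_integrable i1|apply: eq_integrable i2] => //;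
 by move=> x /set_mem Dx; rewrite /= fg.
Qed.

Lemma cintD D f g : measurable D -> cintble D f -> cintble D g ->
  cintegral D (fun x => f x + g x) = cintegral D f + cintegral D g.
Proof.
move=> mD [f1 f2] [g1 g2]; apply: complexE; rewrite cReImE /=.
  by rewrite -RintegralD//; apply: eq_Rintegral => x _; rewrite cReD.
by rewrite -RintegralD//; apply: eq_Rintegral => x _; rewrite cImD.
Qed.

Lemma integrableRZ D (c : R) (h : R -> R) : measurable D ->
  mu.-integrable D (EFin \o h) -> mu.-integrable D (EFin \o (fun x => c * h x)).
Proof.
move=> mD ih.
rewrite (_ : _ \o _ = (fun x => c%:E * (EFin \o h) x)%E)//.
exact: integrableZl.
Qed.

Lemma cintZ D (c : R[i]) f : measurable D -> cintble D f ->
  cintegral D (fun x => c * f x) = c * cintegral D f.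
Proof.
move=> mD [f1 f2]; apply: complexE; rewrite cReImE /=.
  rewrite -!RintegralZl// -RintegralB//; try exact: integrableRZ.
  by apply: eq_Rintegral => x _; rewrite cReM.
rewrite -!RintegralZl// -RintegralD//; try exact: integrableRZ.
by apply: eq_Rintegral => x _; rewrite cImM.
Qed.

Lemma cintN D f : measurable D -> cintble D f ->
  cintegral D (fun x => - f x) = - cintegral D f.
Proof.
by move=> mD fi; rewrite -mulN1r -cintZ//; apply: eq_cint => x _; rewrite mulN1r.
Qed.

Lemma cintB D f g : measurable D -> cintble D f -> cintble D g ->
  cintegral D (fun x => f x - g x) = cintegral D f - cintegral D g.
Proof. by move=> mD fi gi; rewrite cintD ?cintN//; exact: cintbleN. Qed.

Lemma cint_sum D (I : Type) (r : seq I) (F : I -> R -> R[i]) : measurable D ->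
  (forall i, cintble D (F i)) ->
  cintegral D (fun x => \sum_(i <- r) F i x) = \sum_(i <- r) cintegral D (F i).
Proof.
move=> mD iF; elim: r => [|i r ih].
  rewrite big_nil; apply: complexE; rewrite /= /Rintegral integral0_eq// => x _;
  by rewrite big_nil.
rewrite big_cons -ih -cintD//; last exact: cintble_sum.
by apply: eq_cint => x _; rewrite big_cons.
Qed.

Lemma cintJ D f : measurable D -> cintble D f ->
  cintegral D (fun x => (f x)^J) = (cintegral D f)^J.
Proof.
move=> mD [f1 f2]; apply: complexE; rewrite ?cReImE /=.
  by apply: eq_Rintegral => x _; rewrite cReJ.
rewrite -mulN1r -RintegralZl//; apply: eq_Rintegral => x _.
by rewrite cImJ mulN1r.
Qed.

Lemma cintR D (h : R -> R) :
  cintegral D (fun x => (h x)%:C) = (\int[mu]_(x in D) h x)%:C.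
Proof.
by apply: complexE => //=; rewrite /Rintegral integral0_eq.
Qed.

(** Rotating the integral onto the positive real axis reduces the bound to the
    real case. *)
Lemma cabs_cint D f : measurable D -> cintble D f ->
  cabs (cintegral D f) <= \int[mu]_(x in D) cabs (f x).
Proof.
move=> mD fi.
have [I0|I0] := eqVneq (cabs (cintegral D f)) 0.
  by rewrite I0; apply: Rintegral_ge0 => x _; exact: cabs_ge0.
set z := cintegral D f in I0 *.
set w := z^J * (cabs z)^-1%:C.
have cw : cabs w = 1.
  by rewrite cabsM cabsJ cabsR ger0_norm ?invr_ge0 ?cabs_ge0// divff.
have -> : cabs z = Re (w * z).
  rewrite /w mulrAC [X in X * _]mulrC mulcJ -rmorphM/= expr2 mulfK//.
rewrite /z -cintZ// /=.
apply: le_Rintegral => //.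
- by have [] := cintbleZ w mD fi.
- exact: cintble_cabs.
- move=> x Dx; rewrite (le_trans (ler_norm _))//.
  by rewrite (le_trans (ler_Re_cabs _))// cabsM cw mul1r.
Qed.

End ComplexIntegral.

(** * The L2 norm *)

Section L2Norm.
Context {R : realType}.
Local Notation mu := (@lebesgue_measure R).
Implicit Types (D E : set R) (f g : R -> R[i]).

Definition sqi D f : \bar R := \int[mu]_(x in D) ((cabs (f x)) ^+ 2)%:E.

Definition inL2 D f := cmeas D f /\ (sqi D f < +oo)%E.

(** The square integral sqi takes values in the extended reals; nrm is its root,
    meaningful on the functions satisfying inL2. *)
Definition nrm D f : R := Num.sqrt (fine (sqi D f)).

Lemma sqi_ge0 D f : (0 <= sqi D f)%E.
Proof. by apply: integral_ge0 => x _; rewrite lee_fin sqr_ge0. Qed.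

Lemma nrm_ge0 D f : 0 <= nrm D f.
Proof. exact: sqrtr_ge0. Qed.

Lemma sqiE D f : inL2 D f -> sqi D f = (nrm D f ^+ 2)%:E.
Proof.
move=> [_ fy]; rewrite sqr_sqrtr ?fineK ?ge0_fin_numE ?fine_ge0 ?sqi_ge0//.
Qed.

Lemma le_sqi_nrm D f (M : R) : 0 <= M -> cmeas D f ->
  (sqi D f <= (M ^+ 2)%:E)%E -> inL2 D f /\ nrm D f <= M.
Proof.
move=> M0 mf fM; have fi : inL2 D f by split => //; exact: le_lt_trans fM (ltry _).
split => //; move: fM; rewrite sqiE// lee_fin.
by rewrite ler_pXn2r ?nnegrE ?nrm_ge0.
Qed.

Lemma eq_sqi D f g : (forall x, D x -> cabs (f x) = cabs (g x)) ->
  sqi D f = sqi D g.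
Proof. by move=> fg; apply: eq_integral => x /set_mem Dx; rewrite fg. Qed.

Lemma eq_nrm D f g : (forall x, D x -> cabs (f x) = cabs (g x)) ->
  nrm D f = nrm D g.
Proof. by move=> fg; rewrite /nrm (eq_sqi fg). Qed.

Lemma eq_inL2 D f g : (forall x, D x -> f x = g x) -> inL2 D f -> inL2 D g.
Proof.
move=> fg [[m1 m2] fy]; split; last by rewrite -(@eq_sqi D f)// => x /fg ->.
by split; [apply: eq_measurable_fun m1|apply: eq_measurable_fun m2];
  move=> x /set_mem /fg ->.
Qed.

Lemma sqiS D E f : measurable D -> measurable E -> D `<=` E -> cmeas E f ->
  (sqi D f <= sqi E f)%E.
Proof.
move=> mD mE DE mf; apply: ge0_subset_integral => //.
- exact: measurable_cabs2.
- by move=> x _; rewrite lee_fin sqr_ge0.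
Qed.

Lemma inL2S D E f : measurable D -> measurable E -> D `<=` E -> inL2 E f ->
  inL2 D f.
Proof.
move=> mD mE DE [mf fy]; split; first exact: cmeasS mf.
by apply: le_lt_trans fy; exact: sqiS.
Qed.

Lemma nrmS D E f : measurable D -> measurable E -> D `<=` E -> inL2 E f ->
  nrm D f <= nrm E f.
Proof.
move=> mD mE DE fi.
suff : inL2 D f /\ nrm D f <= nrm E f by case.
apply: le_sqi_nrm; first exact: nrm_ge0.
  exact: cmeasS fi.1.
by rewrite -sqiE//; apply: sqiS => //; case: fi.
Qed.

Lemma le_sqiM D f g (M : R) : measurable D -> 0 <= M -> cmeas D f -> cmeas D g ->
  (forall x, D x -> cabs (f x) <= M * cabs (g x)) ->
  (sqi D f <= (M ^+ 2)%:E * sqi D g)%E.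
Proof.
move=> mD M0 mf mg fg.
rewrite /sqi -ge0_integralZl//; last 3 first.
- exact: measurable_cabs2.
- by move=> x _; rewrite lee_fin sqr_ge0.
- by rewrite lee_fin sqr_ge0.
apply: ge0_le_integral => //.
- by move=> x _; rewrite lee_fin sqr_ge0.
- exact: measurable_cabs2.
- by apply: measurable_funeM; exact: measurable_cabs2.
- move=> x Dx; rewrite -EFinM lee_fin -exprMn ler_pXn2r ?nnegrE ?mulr_ge0 ?cabs_ge0//.
  exact: fg.
Qed.

Lemma inL2_le D f g (M : R) : measurable D -> 0 <= M -> cmeas D f -> inL2 D g ->
  (forall x, D x -> cabs (f x) <= M * cabs (g x)) ->
  inL2 D f /\ nrm D f <= M * nrm D g.
Proof.
move=> mD M0 mf gi fg; apply: le_sqi_nrm => //; first by rewrite mulr_ge0 ?nrm_ge0.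
rewrite (le_trans (le_sqiM mD M0 mf gi.1 fg))// sqiE// -EFinM lee_fin.
by rewrite exprMn.
Qed.

Lemma inL2_nrmZ D (c : R[i]) f : measurable D -> inL2 D f ->
  inL2 D (fun x => c * f x) /\ nrm D (fun x => c * f x) <= cabs c * nrm D f.
Proof.
move=> mD fi; apply: inL2_le => //.
- exact: cabs_ge0.
- by apply: cmeasM; [exact: cmeas_cst|case: fi].
- by move=> x _; rewrite cabsM.
Qed.

Lemma inL2Z D (c : R[i]) f : measurable D -> inL2 D f -> inL2 D (fun x => c * f x).
Proof. by move=> mD fi; have [] := inL2_nrmZ c mD fi. Qed.

Lemma inL2N D f : inL2 D f -> inL2 D (fun x => - f x).
Proof.
by move=> [mf fy]; split; [exact: cmeasN|rewrite (@eq_sqi _ _ f)// => x _; rewrite cabsN].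
Qed.

Lemma nrmN D f : nrm D (fun x => - f x) = nrm D f.
Proof. by apply: eq_nrm => x _; rewrite cabsN. Qed.

(** Minkowski's inequality: integrate the weighted inequality cabs_sqrD, with the
    two norms, made positive by adding an arbitrary e, as weights. *)
Lemma inL2_nrmD D f g : measurable D -> inL2 D f -> inL2 D g ->
  inL2 D (fun x => f x + g x) /\ nrm D (fun x => f x + g x) <= nrm D f + nrm D g.
Proof.
move=> mD fi gi.
have key (e : R) : 0 < e -> (sqi D (fun x => f x + g x)%R <=
    ((nrm D f + nrm D g + (e + e)) ^+ 2)%:E)%E.
  move=> e0; set a := nrm D f; set b := nrm D g.
  have [a0 b0] : 0 <= a /\ 0 <= b by rewrite !nrm_ge0.
  set p := a + e; set q := b + e.
  have p0 : 0 < p by rewrite ltr_wpDl.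
  have q0 : 0 < q by rewrite ltr_wpDl.
  have [p1 q1] : 0 <= p /\ 0 <= q by split; exact: ltW.
  have mm h : cmeas D h -> forall c : R, measurable_fun D
      (fun x => (c%:E * ((cabs (h x)) ^+ 2)%:E)%E).
    by move=> mh c; apply: measurable_funeM; exact: measurable_cabs2.
  have mfg := cmeasD fi.1 gi.1.
  have h1 : (sqi D (fun x => f x + g x)%R <=
     ((p + q) / p)%:E * sqi D f + ((p + q) / q)%:E * sqi D g)%E.
    have Z h (k : R) : cmeas D h -> 0 <= k -> (k%:E * sqi D h =
        \int[mu]_(x in D) (k%:E * ((cabs (h x)) ^+ 2)%:E))%E.
      move=> mh k0; rewrite ge0_integralZl//; first exact: measurable_cabs2.
      by move=> x _; rewrite lee_fin sqr_ge0.
    have k1 : 0 <= (p + q) / p by apply: divr_ge0 => //; exact: addr_ge0.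
    have k2 : 0 <= (p + q) / q by apply: divr_ge0 => //; exact: addr_ge0.
    rewrite (Z _ _ fi.1 k1) (Z _ _ gi.1 k2) -ge0_integralD//; last 4 first.
    - by move=> x _; rewrite -EFinM lee_fin mulr_ge0 ?sqr_ge0.
    - exact: mm fi.1 _.
    - by move=> x _; rewrite -EFinM lee_fin mulr_ge0 ?sqr_ge0.
    - exact: mm gi.1 _.
    apply: ge0_le_integral => //.
    - by move=> x _; rewrite lee_fin sqr_ge0.
    - exact: measurable_cabs2.
    - by apply: emeasurable_funD; [exact: mm fi.1 _|exact: mm gi.1 _].
    - move=> x _; rewrite -!EFinM -EFinD lee_fin.
      rewrite (le_trans (cabs_sqrD (f x) (g x) p0 q0))// mulrDr.
      by rewrite ![_ / _ * _]mulrAC !mulrA.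
  apply: (le_trans h1); rewrite !sqiE// -!EFinM -EFinD lee_fin.
  rewrite -/a -/b.
  have -> : a + b + (e + e) = p + q by rewrite /p /q; ring.
  have e1 : a ^+ 2 / p <= p.
    by rewrite ler_pdivrMr// -expr2 ler_pXn2r ?nnegrE// /p lerDl ltW.
  have e2 : b ^+ 2 / q <= q.
    by rewrite ler_pdivrMr// -expr2 ler_pXn2r ?nnegrE// /q lerDl ltW.
  have -> : (p + q) / p * a ^+ 2 + (p + q) / q * b ^+ 2
     = (p + q) * (a ^+ 2 / p + b ^+ 2 / q) by ring.
  rewrite [X in _ <= X]expr2; apply: ler_wpM2l; [exact: addr_ge0|exact: lerD].
have i : inL2 D (fun x => f x + g x).
  by split; [exact: cmeasD fi.1 gi.1|apply: le_lt_trans (key 1 ltr01) (ltry _)].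
split => //; apply/ler_addgt0Pr => e e0.
have e20 : 0 < e / 2 by rewrite divr_gt0.
have := key _ e20; rewrite sqiE// lee_fin -splitr.
by rewrite ler_pXn2r ?nnegrE ?addr_ge0 ?nrm_ge0// ltW.
Qed.

Lemma inL2D D f g : measurable D -> inL2 D f -> inL2 D g ->
  inL2 D (fun x => f x + g x).
Proof. by move=> mD fi gi; have [] := inL2_nrmD mD fi gi. Qed.

Lemma nrmD D f g : measurable D -> inL2 D f -> inL2 D g ->
  nrm D (fun x => f x + g x) <= nrm D f + nrm D g.
Proof. by move=> mD fi gi; have [] := inL2_nrmD mD fi gi. Qed.

Lemma inL2B D f g : measurable D -> inL2 D f -> inL2 D g ->
  inL2 D (fun x => f x - g x).
Proof. by move=> mD fi gi; apply: inL2D => //; exact: inL2N. Qed.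

Lemma nrmB D f g : measurable D -> inL2 D f -> inL2 D g ->
  nrm D (fun x => f x - g x) <= nrm D f + nrm D g.
Proof.
by move=> mD fi gi; rewrite -(nrmN D g); apply: nrmD => //; exact: inL2N.
Qed.

Lemma inL20 D : measurable D -> inL2 D (fun=> 0).
Proof.
move=> mD; split; first exact: cmeas_cst.
by rewrite /sqi integral0_eq// => x _; rewrite cabs0 expr0n.
Qed.

Lemma nrm0 D : nrm D (fun=> 0) = 0.
Proof.
rewrite /nrm /sqi integral0_eq ?sqrtr0// => x _.
by rewrite cabs0 expr0n.
Qed.

Lemma inL2_sum D (I : Type) (r : seq I) (F : I -> R -> R[i]) : measurable D ->
  (forall i, inL2 D (F i)) -> inL2 D (fun x => \sum_(i <- r) F i x).
Proof.
move=> mD iF; elim: r => [|i r ih].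
  by under eq_fun do rewrite big_nil; exact: inL20.
by under eq_fun do rewrite big_cons; exact: inL2D.
Qed.

(** Integrate the weighted arithmetic-geometric inequality; the best weights are
    the two norms. When one of them vanishes, letting the weight grow shows that
    the integral does too. *)
Lemma CauchySchwarz D f g : measurable D -> inL2 D f -> inL2 D g ->
  cintble D (fun x => f x * g x) /\
  cabs (cintegral D (fun x => f x * g x)) <= nrm D f * nrm D g.
Proof.
move=> mD fi gi; have mfg := cmeasM fi.1 gi.1.
have isq h : inL2 D h -> mu.-integrable D (EFin \o (fun x => cabs (h x) ^+ 2)).
  move=> hi; apply/integrableP; split; first exact: measurable_cabs2 hi.1.
  under eq_integral do rewrite /= ger0_norm ?sqr_ge0//.
  by case: hi.
have key (p q : R) : 0 < p -> 0 < q ->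
    cintble D (fun x => f x * g x) /\
    cabs (cintegral D (fun x => f x * g x)) <=
      (q / p * nrm D f ^+ 2 + p / q * nrm D g ^+ 2) / 2.
  move=> p0 q0; pose h x := q / p / 2 * cabs (f x) ^+ 2 + p / q / 2 * cabs (g x) ^+ 2.
  have fgh x : D x -> cabs (f x * g x) <= h x.
    move=> _; rewrite cabsM -subr_ge0 /h.
    set a := cabs (f x); set b := cabs (g x).
    have -> : q / p / 2 * a ^+ 2 + p / q / 2 * b ^+ 2 - a * b
      = (q * a - p * b) ^+ 2 / (2 * p * q) by field; rewrite !gt_eqF.
    by rewrite divr_ge0 ?sqr_ge0// !mulr_ge0// ltW.
  have ih : mu.-integrable D (EFin \o h).
    have := @integrableD _ _ _ mu _ mD _ _ (integrableRZ (q / p / 2) mD (isq f fi))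
      (integrableRZ (p / q / 2) mD (isq g gi)).
    by apply: eq_integrable.
  have ifg := cintble_le mD mfg fgh ih; split => //.
  apply: (le_trans (cabs_cint mD ifg)).
  have : \int[mu]_(x in D) cabs (f x * g x) <= \int[mu]_(x in D) h x.
    by apply: le_Rintegral => //; exact: cintble_cabs.
  move/le_trans; apply; rewrite /h RintegralD//; first last.
  - exact: integrableRZ mD (isq g gi).
  - exact: integrableRZ mD (isq f fi).
  rewrite !RintegralZl//; first last.
  - exact: isq f fi.
  - exact: isq g gi.
  have nE k : inL2 D k -> \int[mu]_(x in D) (cabs (k x) ^+ 2) = nrm D k ^+ 2.
    by move=> ki; rewrite /Rintegral -/(sqi D k) sqiE.
  by rewrite !nE// le_eqVlt; apply/orP; left; apply/eqP; field; rewrite !gt_eqF.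
split; first by have [] := key 1 1 ltr01 ltr01.
set a := nrm D f in key *; set b := nrm D g in key *.
have [a0 b0] : 0 <= a /\ 0 <= b by rewrite !nrm_ge0.
set I := cabs _ in key *.
have I0 : 0 <= I by exact: cabs_ge0.
have [b00|bn0] := eqVneq b 0.
  rewrite b00 mulr0; apply/ler_addgt0Pr => e e0; rewrite add0r.
  have p0 : 0 < a ^+ 2 / e + 1 by rewrite ltr_wpDl// divr_ge0 ?sqr_ge0// ltW.
  apply: (le_trans (key _ _ p0 ltr01).2); rewrite b00 expr0n mulr0 addr0 mul1r.
  rewrite ler_pdivrMr// ler_pdivrMl// mulrC.
  have -> : e * 2 * (a ^+ 2 / e + 1) = 2 * a ^+ 2 + 2 * e by field; rewrite gt_eqF.
  have := sqr_ge0 a; lra.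
have [a00|an0] := eqVneq a 0.
  rewrite a00 mul0r; apply/ler_addgt0Pr => e e0; rewrite add0r.
  have p0 : 0 < b ^+ 2 / e + 1 by rewrite ltr_wpDl// divr_ge0 ?sqr_ge0// ltW.
  apply: (le_trans (key _ _ ltr01 p0).2); rewrite a00 expr0n mulr0 add0r mul1r.
  rewrite ler_pdivrMr// ler_pdivrMl// mulrC.
  have -> : e * 2 * (b ^+ 2 / e + 1) = 2 * b ^+ 2 + 2 * e by field; rewrite gt_eqF.
  have := sqr_ge0 b; lra.
have ap : 0 < a by rewrite lt_neqAle eq_sym an0.
have bp : 0 < b by rewrite lt_neqAle eq_sym bn0.
apply: (le_trans (key _ _ ap bp).2).
by rewrite le_eqVlt; apply/orP; left; apply/eqP; field; rewrite an0 bn0.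
Qed.

Lemma nrm_sqrB D f g : measurable D -> inL2 D f -> inL2 D g ->
  nrm D (fun x => f x - g x) ^+ 2 =
  nrm D f ^+ 2 + nrm D g ^+ 2
    - 2 * complex.Re (cintegral D (fun x => f x * (g x)^J)).
Proof.
move=> mD fi gi; have fgi := inL2B mD fi gi.
have gJ : inL2 D (fun x => (g x)^J).
  by split; [exact: cmeasJ gi.1|rewrite (@eq_sqi _ _ g) ?gi.2// => x _; rewrite cabsJ].
have isq h : inL2 D h -> mu.-integrable D (EFin \o (fun x => cabs (h x) ^+ 2)).
  move=> hi; apply/integrableP; split; first exact: measurable_cabs2 hi.1.
  under eq_integral do rewrite /= ger0_norm ?sqr_ge0//.
  by case: hi.
have nE k : inL2 D k -> nrm D k ^+ 2 = \int[mu]_(x in D) (cabs (k x) ^+ 2).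
  by move=> ki; rewrite /Rintegral -/(sqi D k) sqiE.
have [[iRe _] _] := CauchySchwarz mD fi gJ.
rewrite !nE//= -RintegralZl// -RintegralD//; try exact: isq.
have iS : mu.-integrable D (EFin \o (fun x => cabs (f x) ^+ 2 + cabs (g x) ^+ 2)).
  by have := @integrableD _ _ _ mu _ mD _ _ (isq f fi) (isq g gi); apply: eq_integrable.
rewrite -RintegralB//; last exact: integrableRZ.
apply: eq_Rintegral => x _; rewrite !cabs2E !cReImE; ring.
Qed.

Lemma nrm_cst1 (a b : R) : a <= b ->
  inL2 `[a, b] (fun=> 1) /\ nrm `[a, b] (fun=> 1 : R[i]) = Num.sqrt (b - a).
Proof.
move=> ab.
have e : sqi `[a, b] (fun=> 1) = (b - a)%:E.
  rewrite /sqi cabs1 expr1n integral_cst//= mul1e lebesgue_measure_itv/= lte_fin.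
  by move: ab; rewrite le_eqVlt => /predU1P[->|->//]; rewrite ltxx subrr.
by split; [split; [exact: cmeas_cst|rewrite e ltry]|rewrite /nrm e].
Qed.

Lemma inL2_cintble (a b : R) f : a <= b -> inL2 `[a, b] f ->
  cintble `[a, b] f /\
  \int[mu]_(x in `[a, b]) cabs (f x) <= Num.sqrt (b - a) * nrm `[a, b] f.
Proof.
move=> ab fi; have mD : measurable `[a, b]%classic by [].
have [i1 e1] := nrm_cst1 ab.
have [ii _] := CauchySchwarz mD i1 fi.
have fc : cintble `[a, b] f by apply: eq_cintble ii => // x _; rewrite mul1r.
split => //.
have fa : inL2 `[a, b] (fun x => (cabs (f x))%:C).
  split; first by apply: cmeasR; apply: measurable_cabs; case: fi.
  rewrite (@eq_sqi _ _ f); first by case: fi.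
  by move=> x _; rewrite cabsR ger0_norm ?cabs_ge0.
have [_ h] := CauchySchwarz mD i1 fa.
have := le_trans (ler_Re_cabs _) h.
rewrite e1 (@eq_cint _ _ _ (fun x => (cabs (f x))%:C)); last by move=> x _; rewrite mul1r.
rewrite cintR/=  (@eq_nrm _ _ f); last by move=> x _; rewrite cabsR ger0_norm ?cabs_ge0.
by move/(le_trans (ler_norm _)).
Qed.

Lemma inL2J D f : inL2 D f -> inL2 D (fun x => (f x)^J).
Proof.
by move=> fi; split; [exact: cmeasJ fi.1|rewrite (@eq_sqi _ _ f) ?fi.2// => x _; rewrite cabsJ].
Qed.

Lemma nrmJ D f : nrm D (fun x => (f x)^J) = nrm D f.
Proof. by apply: eq_nrm => x _; rewrite cabsJ. Qed.

End L2Norm.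

(** * Completeness of L2 *)

Section Completeness.
Context {R : realType}.
Local Notation mu := (@lebesgue_measure R).
Implicit Types (D : set R) (f g : R -> R[i]).

Lemma limn_einf_le (v : (\bar R)^nat) (M : \bar R) :
  (forall k, (v k <= M)%E) -> (limn_einf v <= M)%E.
Proof.
move=> vM; rewrite limn_einf_lim; apply: lime_le; first exact: is_cvg_einfs.
apply: nearW => n; apply: le_trans (vM n); apply: ereal_inf_lbound.
by exists n => /=.
Qed.

Lemma sqi_fatou D f (u : nat -> R -> R[i]) (M : \bar R) : measurable D ->
  cmeas D f -> (forall k, cmeas D (u k)) ->
  {ae mu, forall x, D x -> cabs (u k x - f x) @[k --> \oo] --> (0 : R)} ->
  (forall k, (sqi D (u k) <= M)%E) -> (sqi D f <= M)%E.
Proof.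
move=> mD mf mu_ [N [mN N0 sN]] uM.
have mDN : measurable (D `\` N) by exact: measurableD.
have DND : D `\` N `<=` D by exact: subDsetl.
rewrite /sqi (ge0_negligible_integral mN)//; first last.
- by move=> x _; rewrite lee_fin sqr_ge0.
- exact: measurable_cabs2.
have -> : (\int[mu]_(x in D `\` N) (cabs (f x) ^+ 2)%:E =
    \int[mu]_(x in D `\` N) limn_einf (fun k => (cabs (u k x) ^+ 2)%:E))%E.
  apply: eq_integral => x /set_mem[Dx Nx]; symmetry.
  have cx : cabs (u k x - f x) @[k --> \oo] --> (0 : R).
    by apply: contrapT => h; apply: Nx; apply: sN => /(_ Dx).
  have cu : cabs (u k x) @[k --> \oo] --> cabs (f x).
    apply/cvgrPdist_le => e e0; move/cvgrPdist_le : cx => /(_ _ e0).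
    apply: filterS => k; rewrite sub0r normrN ger0_norm ?cabs_ge0//.
    apply: le_trans; rewrite ler_norml; apply/andP; split.
      have := cabs_triangle (f x) (u k x - f x); rewrite addrC subrK; lra.
    have := cabs_triangle (u k x) (- (u k x - f x)); rewrite cabsN opprB addrC subrK; lra.
  have cE : (cabs (u k x) ^+ 2)%:E @[k --> \oo] --> (cabs (f x) ^+ 2)%:E.
    apply: cvg_EFin; first exact: nearW.
    under eq_fun do rewrite /= expr2.
    by rewrite expr2; exact: cvgM.
  by rewrite is_cvg_limn_einfE; [exact/cvg_lim|apply/cvg_ex; eexists; exact: cE].
apply: (le_trans (fatou mu mDN _ _)) => /=.
- by move=> n; apply: measurable_cabs2; exact: cmeasS (mu_ n).
- by move=> n x _; rewrite lee_fin sqr_ge0.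
apply: limn_einf_le => k; apply: le_trans (uM k).
by apply: sqiS.
Qed.

Lemma sum_geo_le (C r : R) j n : 0 <= C -> 0 <= r < 1 ->
  \sum_(i < n) C * r ^+ (j + i) <= C * r ^+ j / (1 - r).
Proof.
move=> C0 /andP[r0 r1]; have r1' : 0 < 1 - r by rewrite subr_gt0.
have -> : \sum_(i < n) C * r ^+ (j + i) = C * r ^+ j * (1 - r ^+ n) / (1 - r).
  apply: (mulIf (lt0r_neq0 r1')); rewrite mulfVK ?gt_eqF//.
  elim: n => [|n ih]; first by rewrite big_ord0 expr0 subrr mulr0 mul0r.
  by rewrite big_ord_recr/= mulrDl ih exprD exprS; ring.
by rewrite ler_pM2r ?invr_gt0// ler_piMr ?mulr_ge0 ?exprn_ge0// gerBl exprn_ge0.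
Qed.

(** Riesz-Fischer: a sequence with geometrically decreasing steps converges
    almost everywhere, because the sum of the moduli of its steps is integrable,
    and then in norm by Fatou's lemma. *)
Lemma L2_complete (a b : R) (u : nat -> R -> R[i]) (C r : R) :
  a <= b -> 0 <= C -> 0 <= r < 1 ->
  (forall j, inL2 `[a, b] (u j)) ->
  (forall j, nrm `[a, b] (fun x => u j.+1 x - u j x) <= C * r ^+ j) ->
  exists2 v, inL2 `[a, b] v &
    forall j, nrm `[a, b] (fun x => v x - u j x) <= C * r ^+ j / (1 - r).
Proof.
move=> ab C0 r01 iu du; set D := `[a, b]%classic.
have mD : measurable D by exact: measurable_itv.
pose d j x := u j.+1 x - u j x.
have id j : inL2 D (d j) by exact: inL2B.
pose S x : \bar R := (\sum_(0 <= j <oo) (cabs (d j x))%:E)%E.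
have md j : measurable_fun D (fun x => (cabs (d j x))%:E).
  by apply/measurable_EFinP; apply: measurable_cabs; case: (id j).
have mS : measurable_fun D S.
  apply: ge0_emeasurable_sum => // k x _ _; rewrite lee_fin; exact: cabs_ge0.
have intd j : (\int[mu]_(x in D) (cabs (d j x))%:E <=
   (Num.sqrt (b - a) * (C * r ^+ j))%:E)%E.
  have [i1 i2] := inL2_cintble ab (id j).
  have i3 := cintble_cabs mD i1.
  rewrite -(fineK (@integrable_fin_num _ _ _ mu _ mD _ i3)) lee_fin.
  by apply: (le_trans i2); rewrite ler_wpM2l ?sqrtr_ge0// du.
have intS : (\int[mu]_(x in D) S x <= (Num.sqrt (b - a) * C * r ^+ 0 / (1 - r))%:E)%E.
  rewrite /S integral_nneseries//; last by move=> n x _; rewrite lee_fin cabs_ge0.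
  apply: lime_le.
    apply: is_cvg_nneseries => n _ _; apply: integral_ge0 => x _.
    by rewrite lee_fin cabs_ge0.
  apply: nearW => n.
  apply: (@le_trans _ _ (\sum_(0 <= j < n) (Num.sqrt (b - a) * (C * r ^+ j))%:E)%E).
    by apply: lee_sum => j _; exact: intd.
  rewrite sumEFin lee_fin big_mkord.
  have := @sum_geo_le (Num.sqrt (b - a) * C) r 0 n _ r01.
  under eq_bigr do rewrite add0n -mulrA.
  by apply; rewrite mulr_ge0 ?sqrtr_ge0.
have iS : mu.-integrable D S.
  apply/integrableP; split => //.
  under eq_integral.
    move=> x _; rewrite gee0_abs; last first.
      by apply: nneseries_ge0 => n _ _; rewrite lee_fin cabs_ge0.
    over.
  exact: le_lt_trans intS (ltry _).
have aeS := @integrable_ae _ _ _ mu _ mD _ iS.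
pose rv x := fine (limn_esup (fun k => (complex.Re (u k x))%:E)).
pose iv x := fine (limn_esup (fun k => (complex.Im (u k x))%:E)).
pose v x := rv x +i* iv x.
have mlim (w : nat -> R -> R) : (forall k, measurable_fun D (w k)) ->
    measurable_fun D (fun x => fine (limn_esup (fun k => (w k x)%:E))).
  move=> mw; apply: (@measurableT_comp _ _ _ _ _ _ fine).
    exact: fine_measurable.
  by apply: measurable_fun_limn_esup => k; exact/measurable_EFinP.
have mv : cmeas D v.
  by split; apply: mlim => k; case: (iu k) => -[].
have cvv : {ae mu, forall x, D x -> cabs (u k x - v x) @[k --> \oo] --> (0 : R)}.
  apply: filterS aeS => x Sx Dx; have {}Sx := Sx Dx.
  have Sy : (S x < +oo)%E by rewrite -ge0_fin_numE// nneseries_ge0// => n _ _; rewrite lee_fin cabs_ge0.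
  have cvabs : cvgn (series (fun j => cabs (d j x))).
    by apply: nnseries_is_cvg => // j; exact: cabs_ge0.
  have comp (p : R[i] -> R) : (forall z, `|p z| <= cabs z) ->
      (forall z w, p (z - w) = p z - p w) ->
      p (u k x) @[k --> \oo] --> fine (limn_esup (fun k => (p (u k x))%:E)).
    move=> pc pB.
    have cs : cvgn (series (telescope (fun k => p (u k x)))).
      apply: normed_cvg; apply: (@series_le_cvg _ _ (fun j => cabs (d j x))) => //.
      - by move=> n; exact: normr_ge0.
      - by move=> n; exact: cabs_ge0.
      - by move=> n; rewrite /= /telescope /= -pB; exact: pc.
    have cp : cvgn (fun k => p (u k x)).
      rewrite (_ : (fun k => _) = (fun k => p (u 0%N x) + series (telescope (fun k => p (u k x))) k)).
        by apply: is_cvgD => //; exact: is_cvg_cst.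
      by apply/funext => k; rewrite -(eq_sum_telescope (fun k => p (u k x))).
    have cE : (p (u k x))%:E @[k --> \oo] --> (limn (fun k => p (u k x)))%:E.
      by apply: cvg_EFin; [exact: nearW|exact: cp].
    rewrite is_cvg_limn_esupE; last by apply/cvg_ex; eexists; exact: cE.
    by rewrite (cvg_lim _ cE).
  have cr := comp _ (@ler_Re_cabs R) (fun z w => etrans (cReD _ _) (congr1 _ (cReN _))).
  have ci := comp _ (@ler_Im_cabs R) (fun z w => etrans (cImD _ _) (congr1 _ (cImN _))).
  apply/cvgrPdist_le => e e0; have e2 : 0 < e / 2 by rewrite divr_gt0.
  move/cvgrPdist_le : cr => /(_ _ e2); move/cvgrPdist_le : ci => /(_ _ e2).
  apply: filterS2 => k hi hr; rewrite sub0r normrN ger0_norm ?cabs_ge0//.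
  rewrite (le_trans (cabs_le_ReIm _))// !cReImE/= -/(rv x) -/(iv x).
  by rewrite distrC [X in _ + X]distrC [leRHS]splitr lerD.
have dist j k : nrm D (fun x => u (j + k)%N x - u j x) <= C * r ^+ j / (1 - r).
  apply: le_trans (sum_geo_le j k C0 r01).
  elim: k => [|k ih].
    rewrite big_ord0 (_ : (fun _ => _) = (fun=> 0)) ?nrm0//.
    by apply/funext => x; rewrite addn0 subrr.
  rewrite big_ord_recr/=.
  apply: le_trans (lerD ih (du (j + k)%N)).
  rewrite (_ : (fun x => u (j + k.+1)%N x - _) = (fun x => (u (j + k)%N x - u j x) +
     (u (j + k).+1 x - u (j + k)%N x))); first by apply: nrmD => //; exact: inL2B.
  by apply/funext => x; rewrite addnS; ring.
have K0 j : 0 <= C * r ^+ j / (1 - r).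
  case/andP: r01 => r0 r1.
  by rewrite divr_ge0 ?mulr_ge0 ?exprn_ge0// subr_ge0 ltW.
have main j : inL2 D (fun x => v x - u j x) /\
    nrm D (fun x => v x - u j x) <= C * r ^+ j / (1 - r).
  apply: le_sqi_nrm => //; first by apply: cmeasB => //; case: (iu j).
  apply: (@sqi_fatou _ _ (fun k x => u (j + k)%N x - u j x)) => //.
  - by apply: cmeasB => //; case: (iu j).
  - by move=> k; apply: cmeasB; [case: (iu (j + k)%N)|case: (iu j)].
  - have := cvv; apply: (@filterS _ _ (ae_filter_ringOfSetsType mu)) => x h Dx; have {}h := h Dx.
    rewrite (_ : (fun k => _) = (fun k => cabs (u (j + k)%N x - v x))); last first.
      by apply/funext => k; rewrite opprB addrA subrK.
    rewrite (_ : (fun k => _) = (fun k => (fun k => cabs (u k x - v x)) (k + j)%N)); last first.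
      by apply/funext => k; rewrite addnC.
    by move: h; rewrite -(cvg_shiftn j).
  - move=> k; rewrite sqiE; last exact: inL2B.
    by rewrite lee_fin ler_pXn2r ?nnegrE ?nrm_ge0.
exists v; last by move=> j; case: (main j).
have := inL2D mD (main 0%N).1 (iu 0%N).
by apply: eq_inL2 => x _; rewrite subrK.
Qed.

End Completeness.

(** * Fourier coefficients and Bessel's inequality *)

Section FourierSeries.
Context {R : realType}.
Local Notation mu := (@lebesgue_measure R).
Implicit Types (f g : R -> R[i]) (n m : int).

Lemma Rintegral_FTC2 (f F : R -> R) (a b : R) : a < b ->
  (forall x : R, is_derive x (1 : R) F (f x)) -> continuous f ->
  \int[mu]_(x in `[a, b]) f x = F b - F a.
Proof.
move=> ab dF cf; rewrite /Rintegral (@continuous_FTC2 _ _ F) => //.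
- exact: continuous_subspaceT.
- have cF x : {for x, continuous F}.
    by apply: differentiable_continuous; apply/derivable1_diffP; case: (dF x).
  split.
  + by move=> x _; case: (dF x).
  + exact/cvg_at_right_filter/cF.
  + exact/cvg_at_left_filter/cF.
- by move=> x _; rewrite derive1E; case: (dF x).
Qed.

Lemma Rintegral1 (a b : R) : a <= b -> \int[mu]_(x in `[a, b]) (1 : R) = b - a.
Proof.
move=> ab; rewrite /Rintegral integral_cst//= mul1e lebesgue_measure_itv/= lte_fin.
by move: ab; rewrite le_eqVlt => /predU1P[->|->//]; rewrite ltxx subrr.
Qed.

Lemma sin_pi_int n : sin (pi * n%:~R) = 0 :> R.
Proof.
have h (k : nat) : sin (pi * k%:R) = 0 :> R.
  elim: k => [|k ih]; first by rewrite mulr0 sin0.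
  by rewrite -natr1 mulrDr mulr1 sinDpi ih oppr0.
case: n => k; first exact: h.
by rewrite NegzE intrN mulrN sinN h oppr0.
Qed.

(** The exponential is kept with a positive sign in the coefficients, so that
    they are values of an inverse Fourier transform. *)
Definition ek (T : R) n (x : R) : R[i] := cis (pi * n%:~R * x / T).

Arguments ek : simpl never.

Definition coef (T : R) f n : R[i] :=
  cintegral `[- T, T] (fun x => f x * ek T n x).

Lemma cmeas_ek D (T : R) n : cmeas D (ek T n).
Proof.
apply: cmeas_cis; apply: measurable_funM => //.
Qed.

Lemma cabs_ek (T : R) n x : cabs (ek T n x) = 1.
Proof. exact: cabs_cis. Qed.

Lemma ekD (T : R) n m x : ek T (n + m) x = ek T n x * ek T m x.
Proof. by rewrite -cisD /ek intrD; congr cis; ring. Qed.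

Lemma ekN (T : R) n x : ek T (- n) x = (ek T n x)^J.
Proof. by rewrite -cisN /ek intrN; congr cis; ring. Qed.

Lemma ek0 (T : R) x : ek T 0 x = 1.
Proof. by rewrite /ek mulr0 !mul0r cis0. Qed.

Context (T : R) (T0 : 0 < T).
Let D := `[- T, T]%classic.
Let mD : measurable D. Proof. exact: measurable_itv. Qed.
Let NTT : - T <= T. Proof. by rewrite ge0_cp// ltW. Qed.

Lemma inL2_ek n : inL2 D (ek T n).
Proof.
have [i1 _] := nrm_cst1 NTT.
have [h _] : inL2 D (ek T n) /\ nrm D (ek T n) <= 1 * nrm D (fun=> 1).
  apply: inL2_le => //; first exact: cmeas_ek.
  by move=> x _; rewrite cabs_ek cabs1 mulr1.
exact: h.
Qed.

Lemma cint_ek n : cintegral D (ek T n) = if n == 0 then (2 * T)%:C else 0.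
Proof.
case: eqP => [->|/eqP n0].
  rewrite (@eq_cint _ _ _ (fun=> (1 : R)%:C)); last by move=> x _; rewrite ek0.
  by rewrite cintR Rintegral1// opprK mulr_natl mulr2n.
have NT : - T < T by rewrite gtrN.
set c := pi * n%:~R / T.
have c0 : c != 0.
  by rewrite /c !mulf_neq0 ?invr_eq0 ?intr_eq0// ?(gt_eqF (pi_gt0 R)) ?(gt_eqF T0).
have dlin (x : R) : is_derive x (1 : R) (fun y : R => y * c) c.
  by have := @is_deriveM _ _ id (cst c) x 1 _ _ (is_derive_id _ _) (is_derive_cst _ _ _);
   rewrite /= scaler0 add0r /GRing.scale /= mulr1.
have clin : continuous (fun y : R => y * c).
  by move=> x; apply: cvgMl.
have argE x : pi * n%:~R * x / T = x * c by rewrite /c; ring.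
have cT : T * c = pi * n%:~R by rewrite /c; field; rewrite gt_eqF.
have cNT : - T * c = - (pi * n%:~R) by rewrite mulNr cT.
apply: complexE => /=.
  transitivity (\int[mu]_(x in `[- T, T]) cos (x * c)).
    by apply: eq_Rintegral => x _; rewrite /= argE.
  have d (x : R) : is_derive x (1 : R) (fun x => c^-1 * sin (x * c)) (cos (x * c)).
    have := @is_derive1_comp _ sin _ x _ _ (is_derive_sin _) (dlin x).
    move/(is_deriveZ c^-1) => h.
    rewrite (_ : (fun x => _) = c^-1 *: (sin \o (fun y => y * c)))//.
    apply: (is_derive_eq h).
    by rewrite /GRing.scale/= mulrCA mulVf// mulr1.
  rewrite (Rintegral_FTC2 NT d).
    by rewrite cT cNT sinN sin_pi_int oppr0 mulr0 subr0.
  by move=> x; apply: continuous_comp; [exact: clin|exact: continuous_cos].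
transitivity (\int[mu]_(x in `[- T, T]) sin (x * c)).
    by apply: eq_Rintegral => x _; rewrite /= argE.
have d (x : R) : is_derive x (1 : R) (fun x => - c^-1 * cos (x * c)) (sin (x * c)).
  have := @is_derive1_comp _ cos _ x _ _ (is_derive_cos _) (dlin x).
  move/(is_deriveZ (- c^-1)) => h.
  rewrite (_ : (fun x => _) = - c^-1 *: (cos \o (fun y => y * c)))//.
  apply: (is_derive_eq h).
  by rewrite /GRing.scale/=; field.
rewrite (Rintegral_FTC2 NT d).
  by rewrite cT cNT cosN subrr.
by move=> x; apply: continuous_comp; [exact: clin|exact: continuous_sin].
Qed.

Definition trig (a : int -> R[i]) (J : seq int) (x : R) : R[i] :=
  \sum_(n <- J) ((2 * T)^-1)%:C * (a n * (ek T n x)^J).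

Lemma inL2_trig a J : inL2 D (trig a J).
Proof.
apply: inL2_sum => // n; apply: inL2Z => //; apply: inL2Z => //.
exact/inL2J/inL2_ek.
Qed.

Lemma cintble_ek f n : inL2 D f -> cintble D (fun x => f x * ek T n x).
Proof. by move=> fi; have [] := CauchySchwarz mD fi (inL2_ek n). Qed.

Lemma cabs_coef f n : inL2 D f -> cabs (coef T f n) <= nrm D f * Num.sqrt (2 * T).
Proof.
move=> fi; have [_ h] := CauchySchwarz mD fi (inL2_ek n).
apply: (le_trans h); rewrite (@eq_nrm _ _ (ek T n) (fun=> 1)); last first.
  by move=> x _; rewrite cabs_ek cabs1.
by have [_ ->] := nrm_cst1 NTT; rewrite opprK -mulr2n mulr_natl.
Qed.

Lemma coefD f g n : inL2 D f -> inL2 D g ->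
  coef T (fun x => f x + g x) n = coef T f n + coef T g n.
Proof.
move=> fi gi; rewrite /coef -cintD//; try exact: cintble_ek.
by apply: eq_cint => x _; rewrite mulrDl.
Qed.

Lemma coefZ c f n : inL2 D f -> coef T (fun x => c * f x) n = c * coef T f n.
Proof.
move=> fi; rewrite /coef -cintZ//; try exact: cintble_ek.
by apply: eq_cint => x _; rewrite mulrA.
Qed.

Lemma coefB f g n : inL2 D f -> inL2 D g ->
  coef T (fun x => f x - g x) n = coef T f n - coef T g n.
Proof.
move=> fi gi; rewrite coefD//; last exact: inL2N.
rewrite -[in RHS]mulN1r -coefZ//; congr (_ + coef T _ n).
by apply/funext => x; rewrite mulN1r.
Qed.

Lemma eq_coef f g n : (forall x, D x -> f x = g x) -> coef T f n = coef T g n.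
Proof. by move=> fg; apply: eq_cint => x /fg ->. Qed.

Lemma coef_trig a J m : uniq J ->
  coef T (trig a J) m = if m \in J then a m else 0.
Proof.
move=> uJ; rewrite /coef.
rewrite (@eq_cint _ _ _ (fun x => \sum_(n <- J) ((2 * T)^-1)%:C * (a n * ek T (m - n) x))); last first.
  move=> x _; rewrite mulr_suml; apply: eq_bigr => n _.
  by rewrite ekD ekN; ring.
have ie n : cintble D (ek T n).
  have := cintble_ek 0 (inL2_ek n); apply: eq_cintble => // x _.
  by rewrite ek0 mulr1.
rewrite cint_sum//; last by move=> n; do 2 (apply: cintbleZ => //); exact: ie.
under eq_bigr do rewrite (cintZ _ mD (cintbleZ _ mD (ie _))) (cintZ _ mD (ie _)) cint_ek subr_eq0.
have T2 : (2 * T)%:C != 0 :> R[i].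
  by rewrite (inj_eq (@complexI R)) mulf_neq0// gt_eqF.
have e n : ((2 * T)^-1)%:C * (a n * (if m == n then (2 * T)%:C else 0)) =
    if n == m then a m else 0.
  rewrite [m == n]eq_sym; case: eqP => [->|_]; last by rewrite !mulr0.
  by rewrite mulrCA -rmorphM/= mulVf ?mulr1// mulf_neq0// gt_eqF.
under eq_bigr do rewrite e.
case: ifPn => mJ.
  by rewrite (bigD1_seq m)//= eqxx big1 ?addr0// => i /negbTE ->.
by rewrite big1_seq// => i /andP[_ iJ]; case: eqP => // im; rewrite -im iJ in mJ.
Qed.

Lemma cint_trigJ f a J : inL2 D f ->
  cintegral D (fun x => f x * (trig a J x)^J) =
  ((2 * T)^-1)%:C * \sum_(n <- J) (a n)^J * coef T f n.
Proof.
move=> fi.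
rewrite (@eq_cint _ _ _ (fun x => \sum_(n <- J) (((2 * T)^-1)%:C * (a n)^J) * (f x * ek T n x))); last first.
  move=> x _; rewrite /trig cJ_sum mulr_sumr; apply: eq_bigr => n _.
  by rewrite !cJM cJK cJR; ring.
rewrite cint_sum//; last by move=> n; apply: cintbleZ => //; exact: cintble_ek.
rewrite mulr_sumr; apply: eq_bigr => n _; rewrite cintZ ?mulrA//.
exact: cintble_ek.
Qed.

Lemma nrm2_cint f : inL2 D f ->
  nrm D f ^+ 2 = complex.Re (cintegral D (fun x => f x * (f x)^J)).
Proof.
move=> fi; rewrite (@eq_cint _ _ _ (fun x => (cabs (f x) ^+ 2)%:C)); last first.
  by move=> x _; rewrite mulcJ.
by rewrite cintR/= /Rintegral -/(sqi D f) sqiE.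
Qed.

Lemma nrm_trig a J : uniq J ->
  nrm D (trig a J) ^+ 2 = (2 * T)^-1 * \sum_(n <- J) cabs (a n) ^+ 2.
Proof.
move=> uJ; rewrite nrm2_cint ?cint_trigJ; try exact: inL2_trig.
rewrite cReM/= mul0r subr0 cRe_sum; congr (_ * _).
rewrite [LHS]big_seq [RHS]big_seq; apply: eq_bigr => n nJ.
by rewrite coef_trig// nJ mulrC mulcJ.
Qed.

(** The distance is least when a is the family of Fourier coefficients; its
    being nonnegative is then Bessel's inequality. *)
Lemma nrm_sub_trig f a J : uniq J -> inL2 D f ->
  nrm D (fun x => f x - trig a J x) ^+ 2 = nrm D f ^+ 2 + (2 * T)^-1 *
    (\sum_(n <- J) cabs (a n - coef T f n) ^+ 2 - \sum_(n <- J) cabs (coef T f n) ^+ 2).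
Proof.
move=> uJ fi; rewrite nrm_sqrB//; last exact: inL2_trig.
rewrite nrm_trig// cint_trigJ// cReM/= mul0r subr0 cRe_sum -addrA.
congr (_ + _); rewrite mulrCA -mulrBr; congr (_ * _).
rewrite mulr_sumr -!sumrB; apply: eq_bigr => n _.
rewrite !cabs2E !cReImE; ring.
Qed.

Lemma Bessel f J : uniq J -> inL2 D f ->
  \sum_(n <- J) cabs (coef T f n) ^+ 2 <= 2 * T * nrm D f ^+ 2.
Proof.
move=> uJ fi; have := @nrm_sub_trig f (coef T f) J uJ fi.
under eq_bigr do rewrite subrr cabs0 expr0n/=.
rewrite big1// sub0r => h.
have T2 : 0 < 2 * T by rewrite mulr_gt0.
rewrite -ler_pdivrMl// -subr_ge0 -mulrN -h; exact: sqr_ge0.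
Qed.

End FourierSeries.

(** * Pointwise convergence of Fourier series *)

Section Chernoff.
Context {R : realType}.
Local Notation mu := (@lebesgue_measure R).
Implicit Types (f g : R -> R[i]) (n m : int).

Lemma cmeasV D f : cmeas D f -> cmeas D (fun x => (f x)^-1).
Proof.
move=> mf.
have e x : (f x)^-1 = (f x)^J * ((cabs (f x) ^+ 2) `^ (-1))%:C.
  rewrite powR_inv1 ?sqr_ge0//.
  have [->|z0] := eqVneq (f x) 0.
    by rewrite cabs0 expr0n/= !invr0 rmorph0 mulr0.
  have cz : cabs (f x) ^+ 2 != 0.
    by rewrite expf_neq0//; apply/eqP => /cabs_eq0; exact/eqP.
  by apply: (mulfI z0); rewrite divff// mulrA mulcJ -rmorphM/= divff.
under eq_fun do rewrite e.
apply: cmeasM; first exact: cmeasJ.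
apply: cmeasR; apply: (@measurableT_comp _ _ _ _ _ _ (fun y : R => y `^ (-1))).
  exact: measurable_powR.
by apply: measurable_funX; exact: measurable_cabs.
Qed.

Lemma cabs_cisB1 (v : R) : cabs (cis v - 1) ^+ 2 = 2 * (1 - cos v).
Proof.
rewrite cabs2E !cReImE /= subr0.
have := cos2Dsin2 v => h.
have -> : (cos v - 1) ^+ 2 + sin v ^+ 2 = (cos v ^+ 2 + sin v ^+ 2) + 1 - 2 * cos v by ring.
by rewrite h; ring.
Qed.

Lemma cabs_cisB1_ge (m v : R) : 0 < m -> m <= `|v| -> `|v| <= 2 * pi - m ->
  2 * (1 - cos m) <= cabs (cis v - 1) ^+ 2.
Proof.
move=> m0 mv vm; rewrite cabs_cisB1 ler_pM2l// lerD2l lerN2 -(cos_norm v).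
have mono (x : R) : m <= x -> x <= pi -> cos x <= cos m.
  move=> mx xp; rewrite leNgt ltr_cos ?in_itv/= -?leNgt//; apply/andP; split => //.
  - by rewrite ltW// (lt_le_trans m0).
  - exact: ltW.
  - exact: le_trans xp.
have [vp|/ltW vp] := leP `|v| pi; first exact: mono.
rewrite -(opprK `|v|) cosN (_ : - `|v| = (2 * pi - `|v|) - pi *+ 2); last by ring.
rewrite -[X in X <= _](cosD2pi (_ - _)) subrK; apply: mono; lra.
Qed.

Lemma cos_lt1 (m : R) : 0 < m -> m <= pi -> cos m < 1.
Proof.
move=> m0 mp; rewrite -cos0 ltr_cos// in_itv/= ?lexx ?pi_ge0//.
by rewrite mp ltW.
Qed.

Context (T : R) (T0 : 0 < T).
Let D := `[- T, T]%classic.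
Let mD : measurable D. Proof. exact: measurable_itv. Qed.
Let NTT : - T <= T. Proof. by rewrite ge0_cp// ltW. Qed.

(** The range [-N, N) is half-open: the telescoping sum over it leaves the terms
    at N and -N. *)
Definition sym_range (N : nat) : seq int := [seq k%:Z - N%:Z | k <- iota 0 N.*2].

Lemma sym_range_uniq N : uniq (sym_range N).
Proof. by rewrite map_inj_uniq ?iota_uniq// => x y /addIr []. Qed.

Lemma coef_cvg0 g : inL2 D g ->
  cabs (coef T g k%:Z) @[k --> \oo] --> (0 : R) /\
  cabs (coef T g (- k%:Z)) @[k --> \oo] --> (0 : R).
Proof.
move=> gi.
suff h (s : nat -> int) : injective s -> cabs (coef T g (s k)) @[k --> \oo] --> (0 : R).
  by split; apply: h => x y; [case|move/oppr_inj; case].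
move=> si.
have c2 : (fun k => cabs (coef T g (s k)) ^+ 2) @ \oo --> (0 : R).
  apply: cvg_series_cvg_0; apply: nondecreasing_is_cvgn.
    apply/nondecreasing_seqP => k; rewrite /series/= big_nat_recr//= lerDl sqr_ge0//.
  exists (2 * T * nrm D g ^+ 2) => _ [k _ <-].
  rewrite /series/= -(big_map s predT (fun n => cabs (coef T g n) ^+ 2)).
  by apply: Bessel => //; rewrite map_inj_uniq// /index_iota iota_uniq.
apply/cvgrPdist_lt => e e0; move/cvgrPdist_lt : c2 => /(_ (e ^+ 2)).
rewrite exprn_gt0// => /(_ isT); apply: filterS => k.
rewrite !sub0r !normrN !ger0_norm ?sqr_ge0 ?cabs_ge0//.
by rewrite ltr_pXn2r// nnegrE ?cabs_ge0// ltW.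
Qed.

(** Chernoff's proof of pointwise convergence: if f is constant near x0, the
    quotient g of f - f x0 by the 2T-periodic function vanishing at x0 is
    square integrable, and the Fourier series of f - f x0 telescopes into two
    coefficients of g, which tend to 0 by Bessel's inequality. *)
Lemma trig_cvg_locally_cst f x0 (d : R) : inL2 D f -> - T < x0 < T -> 0 < d ->
  (forall x, D x -> `|x - x0| < d -> f x = f x0) ->
  cabs (trig T (coef T f) (sym_range N) x0 - f x0) @[N --> \oo] --> (0 : R).
Proof.
move=> fi /andP[x0l x0r] d0 floc.
pose w x := cis (pi * (x - x0) / T) - 1.
pose g x := (w x)^-1 * (f x - f x0).
pose f0 x := f x - f x0.
have f0i : inL2 D f0.
  apply: inL2B => //; have := inL2Z (f x0) mD (nrm_cst1 NTT).1.
  by apply: eq_inL2 => x _; rewrite mulr1.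
(* Where |x - x0| >= d, the phase pi (x - x0) / T is at distance at least m from
   the multiples of 2 pi, so that w stays away from 0. *)
pose m := Order.min (pi * d / T) (pi * (T - `|x0|) / T).
have x0T : `|x0| < T by rewrite ltr_norml x0l.
have pT : 0 < pi / T :> R by rewrite divr_gt0// pi_gt0.
have m0 : 0 < m.
  by rewrite lt_min; apply/andP; split; rewrite mulrAC mulr_gt0// subr_gt0.
have mpi : m <= pi.
  rewrite ge_min; apply/orP; right; rewrite ler_pdivrMr// ler_pM2l ?pi_gt0//.
  by rewrite gerBl.
set c := 2 * (1 - cos m).
have c0 : 0 < c by rewrite mulr_gt0// subr_gt0 cos_lt1.
have wc x : D x -> d <= `|x - x0| -> c <= cabs (w x) ^+ 2.
  rewrite /D/= in_itv/= => /andP[xl xr] dx.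
  have e : `|pi * (x - x0) / T| = pi / T * `|x - x0|.
    by rewrite -[in RHS](gtr0_norm pT) -normrM; congr `|_|; ring.
  apply: cabs_cisB1_ge => //; rewrite e.
    rewrite ge_min; apply/orP; left.
    by rewrite mulrAC ler_pM2l.
  have h1 : m <= pi / T * (T - `|x0|).
    by rewrite ge_min; apply/orP; right; rewrite mulrAC.
  have h2 : `|x - x0| <= T + `|x0|.
    by rewrite (le_trans (ler_normB _ _))// lerD2r ler_norml xl.
  have h3 : 2 * pi = pi / T * (2 * T) by field; rewrite gt_eqF.
  rewrite h3; apply: (@le_trans _ _ (pi / T * (2 * T) - pi / T * (T - `|x0|))).
    by rewrite -mulrBr ler_pM2l//; lra.
  by rewrite lerD2l lerN2.
have w_neq0 x : D x -> d <= `|x - x0| -> w x != 0.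
  move=> Dx dx; apply/eqP => w0; have := wc x Dx dx.
  by rewrite w0 cabs0 expr0n/= leNgt c0.
have mw : cmeas D w.
  apply: cmeasB; last exact: cmeas_cst.
  apply: cmeas_cis; apply: measurable_funM => //.
  apply: measurable_funM; first exact: measurable_cst.
  by apply: measurable_funB => //; exact: measurable_cst.
have gi : inL2 D g.
  suff : inL2 D g /\ nrm D g <= (Num.sqrt c)^-1 * nrm D f0 by case.
  apply: inL2_le => //.
    by apply: cmeasM; [exact: cmeasV|case: f0i].
  move=> x Dx; have [dx|dx] := ltP `|x - x0| d.
    by rewrite /g /f0 floc// subrr mulr0 cabs0 mulr0.
  have wp : 0 < cabs (w x).
    rewrite lt_def cabs_ge0 andbT; apply/eqP => /cabs_eq0 /eqP.
    exact/negP/w_neq0.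
  have sc : 0 < Num.sqrt c by rewrite sqrtr_gt0.
  rewrite cabsM ler_wpM2r ?cabs_ge0// cabsV lef_pV2 ?posrE//.
  by rewrite -(@ler_pXn2r _ 2)// ?nnegrE ?sqrtr_ge0 ?cabs_ge0// sqr_sqrtr ?wc// ltW.
have fg x : D x -> f0 x = w x * g x.
  move=> Dx; have [dx|dx] := ltP `|x - x0| d.
    by rewrite /g /f0 floc// subrr !mulr0.
  by rewrite /g mulrA divff ?mul1r// w_neq0.
have coef1 n : coef T (fun=> f x0) n = f x0 * (if n == 0 then (2 * T)%:C else 0).
  rewrite -cint_ek// -cintZ//.
  by have := cintble_ek T0 0 (inL2_ek T0 n); apply: eq_cintble => // x _; rewrite ek0 mulr1.
have csti : inL2 D (fun=> f x0).
  have := inL2Z (f x0) mD (nrm_cst1 NTT).1.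
  by apply: eq_inL2 => x _; rewrite mulr1.
pose h n := (ek T n x0)^J * coef T g n.
have tele n : (ek T n x0)^J * (coef T f n - coef T (fun=> f x0) n) = h (n + 1) - h n.
  rewrite -coefB// (@eq_coef _ _ _ (fun x => w x * g x)); last exact: fg.
  have gek k := cintble_ek T0 k gi.
  have -> : coef T (fun x => w x * g x) n = (ek T 1 x0)^J * coef T g (n + 1) - coef T g n.
    rewrite /coef -cintZ// -cintB//; last exact: cintbleZ.
    apply: eq_cint => x _; rewrite ekD /w.
    have -> : cis (pi * (x - x0) / T) = ek T 1 x * (ek T 1 x0)^J.
      by rewrite -cisN -cisD /ek; congr cis; ring.
    ring.
  by rewrite /h ekD cJM; ring.
have telesum N : \sum_(n <- sym_range N) (ek T n x0)^J * (coef T f n - coef T (fun=> f x0) n)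
    = h N%:Z - h (- N%:Z).
  under eq_bigr do rewrite tele.
  rewrite big_map.
  have -> : \sum_(k <- iota 0 N.*2) (h (k%:Z - N%:Z + 1) - h (k%:Z - N%:Z)) =
      \sum_(0 <= k < N.*2) (h (k.+1%:Z - N%:Z) - h (k%:Z - N%:Z)).
    rewrite /index_iota subn0; apply: eq_bigr => k _.
    by congr (h _ - _); rewrite -addn1 PoszD; ring.
  rewrite telescope_sumr// sub0r -addnn PoszD.
  by congr (h _ - _); ring.
have trigE N : (0 < N)%N -> trig T (coef T f) (sym_range N) x0 - f x0 =
    ((2 * T)^-1)%:C * (h N%:Z - h (- N%:Z)).
  move=> N0; rewrite -telesum.
  under [in RHS]eq_bigr do rewrite mulrBr.
  rewrite sumrB mulrBr /trig -mulr_sumr; congr (_ * _ - _).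
    by apply: eq_bigr => n _; rewrite mulrC.
  have J0 : (0 : int) \in sym_range N.
    apply/mapP; exists N; last by rewrite subrr.
    by rewrite mem_iota add0n -addnn -[X in (X < _)%N]addn0 ltn_add2l.
  rewrite [X in _ * X](_ : _ = (ek T 0 x0)^J * coef T (fun=> f x0) 0); last first.
    rewrite (bigD1_seq (0 : int) J0 (sym_range_uniq N)) big1; first exact: addr0.
    by move=> i /negbTE i0; rewrite coef1 i0 !mulr0.
  rewrite coef1 eqxx ek0 cJR mul1r mulrCA -rmorphM/= mulVf ?mulr1//.
  by rewrite mulf_neq0// gt_eqF.
have [c1 c2] := coef_cvg0 gi.
have cb : (fun N : nat => (2 * T)^-1 * (cabs (coef T g N%:Z) + cabs (coef T g (- N%:Z)))) @ \oo --> (0 : R).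
  rewrite (_ : (0 : R) = (2 * T)^-1 * (0 + 0)); last by rewrite addr0 mulr0.
  by apply: cvgMr; exact: cvgD.
have c0' : (fun _ : nat => (0 : R)) @ \oo --> (0 : R) by exact: cvg_cst.
apply: (squeeze_cvgr _ c0' cb).
exists 1%N => // N /= N0; rewrite cabs_ge0/= trigE// cabsM cabsR.
rewrite gtr0_norm ?invr_gt0 ?mulr_gt0// ler_pM2l ?invr_gt0 ?mulr_gt0//.
rewrite (le_trans (cabs_triangle _ _))// cabsN /h !cabsM !cabsJ !cabs_ek !mul1r//.
Qed.

End Chernoff.

(** * Uniqueness of Fourier coefficients *)

Section FourierCompleteness.
Context {R : realType}.
Local Notation mu := (@lebesgue_measure R).
Implicit Types (f g : R -> R[i]) (n m : int).

Lemma ae_imp2 (P Q S : R -> Prop) : (forall x, P x -> Q x -> S x) ->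
  {ae mu, forall x, P x} -> {ae mu, forall x, Q x} -> {ae mu, forall x, S x}.
Proof. exact: (@filterS2 _ _ (ae_filter_ringOfSetsType mu)). Qed.

Lemma ae_imp3 (P Q S U : R -> Prop) : (forall x, P x -> Q x -> S x -> U x) ->
  {ae mu, forall x, P x} -> {ae mu, forall x, Q x} -> {ae mu, forall x, S x} ->
  {ae mu, forall x, U x}.
Proof. exact: (@filterS3 _ _ (ae_filter_ringOfSetsType mu)). Qed.

Lemma ae_neq (a : R) : {ae mu, forall x, x != a}.
Proof.
exists [set a]; split; [exact: measurable_set1|exact: lebesgue_measure_set1|].
by move=> x /= /negP; rewrite negbK => /eqP.
Qed.

Definition chi (a b x : R) : R[i] := (\1_(`[a, b]) x)%:C.

Lemma chiE (a b x : R) : chi a b x = if a <= x <= b then 1 else 0.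
Proof.
rewrite /chi indicE; case: ifPn => h; first by rewrite mem_set//= in_itv/= h.
by rewrite memNset//= in_itv/=; exact/negP.
Qed.

Lemma chi_locally_cst (a b x0 : R) : x0 != a -> x0 != b ->
  exists2 d : R, 0 < d & forall x, `|x - x0| < d -> chi a b x = chi a b x0.
Proof.
move=> xa xb; exists (Order.min `|x0 - a| `|x0 - b|).
  by rewrite lt_min !normr_gt0 !subr_eq0 xa xb.
move=> x; rewrite lt_min => /andP[h1 h2]; rewrite !chiE.
suff -> : (a <= x <= b) = (a <= x0 <= b) by [].
move: xa xb h1 h2; rewrite /=.
have hx := ltr_norml.
case: (ltgtP x0 a) => // xa _; case: (ltgtP x0 b) => // xb _.
- rewrite (@ltr0_norm _ (x0 - a)) ?subr_lt0// (@ltr0_norm _ (x0 - b)) ?subr_lt0//.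
  rewrite !ltr_norml => /andP[h1 h2] /andP[h3 h4].
  by rewrite [a <= x]leNgt (_ : x < a)//; lra.
- rewrite (@ltr0_norm _ (x0 - a)) ?subr_lt0// (@gtr0_norm _ (x0 - b)) ?subr_gt0//.
  rewrite !ltr_norml => /andP[h1 h2] /andP[h3 h4].
  by rewrite [a <= x]leNgt (_ : x < a)//; lra.
- rewrite (@gtr0_norm _ (x0 - a)) ?subr_gt0// (@ltr0_norm _ (x0 - b)) ?subr_lt0//.
  rewrite !ltr_norml => /andP[h1 h2] /andP[h3 h4].
  by apply/andP; split; lra.
- rewrite (@gtr0_norm _ (x0 - a)) ?subr_gt0// (@gtr0_norm _ (x0 - b)) ?subr_gt0//.
  rewrite !ltr_norml => /andP[h1 h2] /andP[h3 h4].
  by rewrite andbC [x <= b]leNgt (_ : b < x)//; lra.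
Qed.

Context (T : R) (T0 : 0 < T).
Let D := `[- T, T]%classic.
Let mD : measurable D. Proof. exact: measurable_itv. Qed.
Let NTT : - T <= T. Proof. by rewrite ge0_cp// ltW. Qed.

Lemma inL2_chi (a b : R) : inL2 D (chi a b).
Proof.
suff : inL2 D (chi a b) /\ nrm D (chi a b) <= 1 * nrm D (fun=> 1) by case.
apply: inL2_le => //.
- exact/cmeasR/measurable_indic.
- exact: (nrm_cst1 NTT).1.
- by move=> x _; rewrite chiE; case: ifP => _; rewrite ?cabs0 cabs1 mulr1.
Qed.

Lemma ae_interior : {ae mu, forall x, D x -> - T < x < T}.
Proof.
apply: (ae_imp2 _ (ae_neq T) (ae_neq (- T))) => x xT xNT.
rewrite /D/= in_itv/= => /andP[h1 h2].
by rewrite !lt_neqAle h1 h2 xT eq_sym xNT.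
Qed.

(** By Fatou's lemma and pointwise convergence the partial sums cannot lose any of
    the norm of the indicator. *)
Lemma chi_dense (a b e : R) : 0 < e -> exists2 J, uniq J &
  nrm D (fun x => chi a b x - trig T (coef T (chi a b)) J x) ^+ 2 <= e.
Proof.
move=> e0; apply: contrapT => noJ; set c := coef T _ in noJ.
have ci := inL2_chi a b.
have bnd J : uniq J -> nrm D (trig T c J) ^+ 2 <= nrm D (chi a b) ^+ 2 - e.
  move=> uJ; have : e < nrm D (fun x => chi a b x - trig T c J x) ^+ 2.
    by rewrite ltNge; apply/negP => h; apply: noJ; exists J.
  rewrite nrm_sub_trig// nrm_trig//.
  under eq_bigr do rewrite subrr cabs0 expr0n/=.
  rewrite big1// sub0r; lra.
have := @sqi_fatou _ D (chi a b) (fun N => trig T c (sym_range N))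
  ((nrm D (chi a b) ^+ 2 - e)%:E) mD ci.1.
rewrite sqiE// lee_fin => /(_ _ _ _) h.
have : nrm D (chi a b) ^+ 2 <= nrm D (chi a b) ^+ 2 - e.
  apply: h.
  - by move=> k; have [] := inL2_trig T0 c (sym_range k).
  - apply: (ae_imp3 _ (ae_neq a) (ae_neq b) ae_interior).
    move=> x xa xb xD Dx; have [d d0 hd] := chi_locally_cst xa xb.
    by apply: (trig_cvg_locally_cst T0 ci (xD Dx) d0) => y _; exact: hd.
  - move=> k; rewrite sqiE ?lee_fin; last exact: inL2_trig.
    by apply: bnd; exact: sym_range_uniq.
by rewrite leNgt gtrBl e0.
Qed.

Lemma coef_eq0_cint_chi f (a b : R) : inL2 D f -> (forall n, coef T f n = 0) ->
  cintegral D (fun x => f x * chi a b x) = 0.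
Proof.
move=> fi f0; have ci := inL2_chi a b; apply: cabs_eq0; apply/eqP.
rewrite eq_le cabs_ge0 andbT; apply/ler_addgt0Pr => e e0; rewrite add0r.
have N0 : 0 < nrm D f + 1 by rewrite ltr_wpDl// nrm_ge0.
have [|J uJ hJ] := @chi_dense a b ((e / (nrm D f + 1)) ^+ 2).
  by rewrite exprn_gt0// divr_gt0.
set t := trig _ _ _ in hJ.
have ti : inL2 D t by exact: inL2_trig.
have di : inL2 D (fun x => chi a b x - t x) by exact: inL2B.
have -> : cintegral D (fun x => f x * chi a b x) =
    cintegral D (fun x => f x * (chi a b x - t x)^J).
  have [i1 _] := CauchySchwarz mD fi (inL2J ti).
  have [i2 _] := CauchySchwarz mD fi (inL2J di).
  rewrite -[RHS](addr0 _) -[X in _ + X](_ : cintegral D (fun x => f x * (t x)^J) = 0); last first.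
    rewrite cint_trigJ// big1 ?mulr0// => n _; by rewrite f0 mulr0.
  rewrite -cintD//; apply: eq_cint => x _.
  rewrite -mulrDr -cJD subrK; congr (_ * _).
  by rewrite /chi cJR.
have [_ h] := CauchySchwarz mD fi (inL2J di).
apply: (le_trans h); rewrite nrmJ.
have q0 : 0 <= e / (nrm D f + 1) := divr_ge0 (ltW e0) (ltW N0).
move: hJ; rewrite ler_pXn2r ?nnegrE ?nrm_ge0// => hJ.
apply: (le_trans (ler_wpM2l (nrm_ge0 _ _) hJ)).
by rewrite mulrCA ger_pMr// ler_pdivrMr// mul1r lerDl.
Qed.

Lemma coef_eq0_ae (p : R[i] -> R) f : (forall z, `|p z| <= cabs z) ->
  (forall a b, \int[mu]_(x in `[a, b]) ((p \o f) \_ D) x = 0) ->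
  measurable_fun D (p \o f) -> inL2 D f ->
  {ae mu, forall x, D x -> p (f x) = 0}.
Proof.
move=> pc p0 mpf fi; pose h := (p \o f) \_ D.
have [fint _] := inL2_cintble NTT fi.
have ih : mu.-integrable D (EFin \o (p \o f)).
  apply: le_integrable (cintble_cabs mD fint) => //; first exact/measurable_EFinP.
  by move=> x Dx /=; rewrite lee_fin (le_trans (pc _))// ler_norm.
have ihT : mu.-integrable setT (EFin \o h).
  by rewrite /h -restrict_EFin; apply/integrable_restrict => //; rewrite setTI.
have ihy y : mu.-integrable `[- T, y] (EFin \o h).
  exact: (@integrableS _ _ _ mu setT).
have /= aeF := @FTC1 R h (BLeft (- T)) ihy (integrable_locally_restrict mD ih).
apply: (ae_imp2 _ aeF ae_interior) => x hx xD Dx.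
have /andP[xl xr] := xD Dx.
have [] := hx _; first by rewrite lte_fin.
move=> _; rewrite /h/= patchE mem_set// => Fx.
rewrite -[p (f x)]/((p \o f) x) -Fx.
rewrite derive1E (@near_eq_derive _ _ _ _ (cst 0)) ?derive_cst//.
by near=> y; rewrite p0.
Unshelve. all: by end_near. Qed.

(** The integral of f over every interval vanishes, because indicators are limits
    of trigonometric polynomials, and the fundamental theorem of calculus
    recovers f almost everywhere from these integrals. *)
Lemma coef_eq0 f : inL2 D f -> (forall n, coef T f n = 0) -> nrm D f = 0.
Proof.
move=> fi f0.
have key (p : R[i] -> R) (a b : R) : (forall z c, p (z * c%:C) = p z * c) ->
   p (cintegral D (fun x => f x * chi a b x)) =
   \int[mu]_(x in D) p (f x * chi a b x) ->
   p 0 = 0 ->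
   \int[mu]_(x in `[a, b]) ((p \o f) \_ D) x = 0.
  move=> pM; rewrite coef_eq0_cint_chi// => h p0.
  rewrite -Rintegral_mkcondr setIC Rintegral_mkcondr -p0 h.
  apply: eq_Rintegral => x _; rewrite patchE chiE.
  case: ifPn => [/set_mem/=|/negP xab].
    by rewrite in_itv/= => ->; rewrite mulr1.
  case: ifPn => [h'|_]; last by rewrite mulr0.
  by exfalso; apply: xab; apply: mem_set; rewrite /= in_itv/= h'.
have [aeR aeI] : {ae mu, forall x, D x -> complex.Re (f x) = 0} /\
    {ae mu, forall x, D x -> complex.Im (f x) = 0}.
  split; apply: coef_eq0_ae => //.
  - exact: ler_Re_cabs.
  - move=> a b; apply: key => //.
    by move=> z c; rewrite cReM/= mulr0 subr0.
  - by case: fi => -[].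
  - exact: ler_Im_cabs.
  - move=> a b; apply: key => //.
    by move=> z c; rewrite cImM/= mulr0 add0r.
  - by case: fi => -[].
rewrite /nrm /sqi (@ge0_ae_eq_integral _ _ _ mu D _ (cst 0%E)) ?integral0 ?sqrtr0//.
- exact: measurable_cabs2 fi.1.
- by move=> x _; rewrite lee_fin sqr_ge0.
- apply: (ae_imp2 _ aeR aeI) => x h1 h2 Dx.
  by rewrite cabs2E h1// h2// expr0n addr0.
Qed.

End FourierCompleteness.

(** * Sums over the integers *)

Section FiniteSums.
Context {R : realType}.
Implicit Types (t : int -> R) (J : seq int).

Lemma esum_le_of t (M : R) : (forall J, uniq J -> \sum_(n <- J) t n <= M) ->
  (\esum_(n in [set: int]) (t n)%:E <= M%:E)%E.
Proof.
move=> h; apply: ub_ereal_sup => _ [X [fX _] <-].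
by rewrite fsbig_finite//= sumEFin lee_fin; apply: h; exact: fset_uniq.
Qed.

Lemma sum_le_esum t J : uniq J ->
  ((\sum_(n <- J) t n)%:E <= \esum_(n in [set: int]) (t n)%:E)%E.
Proof.
move=> uJ; apply: esum_ge; exists [set` J]; first by split => //; exact: finite_seq.
by rewrite -fsbig_seq// sumEFin.
Qed.

End FiniteSums.

(** * Parseval's identity and the Riesz-Fischer theorem *)

Section Parseval.
Context {R : realType}.
Local Notation mu := (@lebesgue_measure R).
Implicit Types (f g : R -> R[i]) (n m : int).

Lemma geo_le0 (x C r : R) : 0 <= r < 1 -> (forall j : nat, x <= C * r ^+ j) -> x <= 0.
Proof.
move=> /andP[r0 r1] h.
have c : (fun j : nat => C * r ^+ j) @ \oo --> (0 : R).
  rewrite -(mulr0 C); apply: cvgMr; apply: cvg_expr.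
  by rewrite ger0_norm.
rewrite -(cvg_lim _ c)//; apply: limr_ge; first by apply/cvg_ex; eexists; exact: c.
exact: nearW.
Qed.

Context (T : R) (T0 : 0 < T).
Let D := `[- T, T]%classic.
Let mD : measurable D. Proof. exact: measurable_itv. Qed.
Let NTT : - T <= T. Proof. by rewrite ge0_cp// ltW. Qed.

(** The finite sums have a supremum; a set that almost attains it leaves little
    for the disjoint ones. *)
Lemma tail_small (a : int -> R[i]) (M e : R) : 0 < e ->
  (forall J, uniq J -> \sum_(n <- J) cabs (a n) ^+ 2 <= M) ->
  exists J0, uniq J0 /\ forall J, uniq J -> (forall n, n \in J -> n \notin J0) ->
    \sum_(n <- J) cabs (a n) ^+ 2 <= e.
Proof.
move=> e0 aM; pose E := [set s | exists2 J, uniq J & s = \sum_(n <- J) cabs (a n) ^+ 2].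
have hE : has_sup E.
  split; first by exists 0; exists [::] => //; rewrite big_nil.
  by exists M => _ [J uJ ->]; exact: aM.
have [_ [J0 uJ0 ->] sJ0] := sup_adherent e0 hE.
exists J0; split => // J uJ dJ.
have : E (\sum_(n <- J0 ++ J) cabs (a n) ^+ 2).
  exists (J0 ++ J) => //; rewrite cat_uniq uJ0 uJ andbT/=.
  by apply/hasPn => n /dJ.
move/(sup_upper_bound hE); rewrite big_cat/=.
by move: sJ0; set s := sup E; set u := \sum_(_ <- _) _; set v := \sum_(_ <- _) _; lra.
Qed.

Lemma trig_sub a (J K : seq int) x :
  trig T a (J ++ K) x - trig T a J x = trig T a K x.
Proof. by rewrite /trig big_cat/= addrAC subrr add0r. Qed.

(** Exhaust the indices by finite sets whose complements carry geometrically
    decreasing energy, and apply completeness to the partial sums. *)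
Lemma riesz_fischer (a : int -> R[i]) (M : R) :
  (forall J, uniq J -> \sum_(n <- J) cabs (a n) ^+ 2 <= M) ->
  exists v, [/\ inL2 D v, forall n, coef T v n = a n &
    forall e, 0 < e -> exists2 J, uniq J & nrm D (fun x => v x - trig T a J x) <= e].
Proof.
move=> aM.
have q4 (j : nat) : 0 < (2^-1 : R) ^+ j by rewrite exprn_gt0.
have q42 (j : nat) : 0 < ((2^-1 : R) ^+ j) ^+ 2 by rewrite exprn_gt0.
have /choice[J0 hJ0] := fun j => tail_small (q42 j) aM.
pose step K j := K ++ [seq n <- J0 j | n \notin K].
pose K := fix K j := if j is j'.+1 then step (K j') j else J0 0%N.
have uK j : uniq (K j).
  elim: j => [|j ih] /=; first by case: (hJ0 0%N).
  rewrite cat_uniq ih filter_uniq ?(hJ0 j.+1).1// andbT/=.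
  by apply/hasPn => n; rewrite mem_filter => /andP[].
have subK j : {subset J0 j <= K j}.
  case: j => [|j] n nJ //=; rewrite mem_cat mem_filter nJ andbT.
  by case: (n \in K j).
have T2 : 0 < 2 * T by rewrite mulr_gt0.
pose C := Num.sqrt (2 * T)^-1.
have C0 : 0 <= C by exact: sqrtr_ge0.
have r01 : 0 <= (2^-1 : R) < 1 by apply/andP; split; lra.
pose u j := trig T a (K j).
have ui j : inL2 D (u j) by exact: inL2_trig.
have du j : nrm D (fun x => u j.+1 x - u j x) <= C * 2^-1 ^+ j.
  rewrite (_ : (fun x => _) = trig T a [seq n <- J0 j.+1 | n \notin K j]); last first.
    by apply/funext => x; rewrite /u /= /step trig_sub.
  have ud : uniq [seq n <- J0 j.+1 | n \notin K j] by rewrite filter_uniq ?(hJ0 _).1.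
  rewrite -(@ler_pXn2r _ 2)// ?nnegrE ?nrm_ge0 ?mulr_ge0 ?exprn_ge0//.
  rewrite nrm_trig// exprMn sqr_sqrtr ?invr_ge0 ?(ltW T2)// ler_pM2l ?invr_gt0//.
  apply: (hJ0 j).2 => // n; rewrite mem_filter => /andP[nK _].
  by apply: contra nK; exact: subK.
have [v vi hv] := L2_complete NTT C0 r01 ui du.
have cK n j : cabs (coef T (u j) n - a n) <= 2^-1 ^+ j.
  rewrite coef_trig//; case: ifPn => nK; first by rewrite subrr cabs0.
  rewrite sub0r cabsN -(@ler_pXn2r _ 2)// ?nnegrE ?cabs_ge0 ?exprn_ge0//.
  have := (hJ0 j).2 [:: n]; rewrite big_seq1; apply => // m.
  by rewrite inE => /eqP ->; apply: contra nK; exact: subK.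
exists v; split => //.
  move=> n; apply/eqP; rewrite -subr_eq0; apply/eqP/cabs_eq0/eqP.
  rewrite eq_le cabs_ge0 andbT.
  apply: (@geo_le0 _ (C / (1 - 2^-1) * Num.sqrt (2 * T) + 1) _ r01) => j.
  rewrite (_ : _ - _ = (coef T v n - coef T (u j) n) + (coef T (u j) n - a n)); last by ring.
  rewrite (le_trans (cabs_triangle _ _))// mulrDl mul1r lerD//.
  rewrite -coefB//; apply: (le_trans (cabs_coef T0 _ _)); first exact: inL2B.
  rewrite mulrAC ler_wpM2r ?sqrtr_ge0//.
  by rewrite mulrAC; exact: hv.
move=> e e0; apply: contrapT => hJ.
suff : e <= 0 by rewrite leNgt e0.
apply: (@geo_le0 _ (C / (1 - 2^-1)) _ r01) => j.
rewrite mulrAC; apply: le_trans (hv j).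
rewrite leNgt; apply/negP => /ltW h; apply: hJ; by exists (K j).
Qed.

(** The Riesz-Fischer function with the coefficients of f has an approximation
    by trigonometric polynomials, and equals f by uniqueness of coefficients. *)
Lemma fourier_dense f e : inL2 D f -> 0 < e -> exists2 J, uniq J &
  nrm D (fun x => f x - trig T (coef T f) J x) <= e.
Proof.
move=> fi e0.
have [v [vi vc vd]] := riesz_fischer (fun J uJ => Bessel T0 uJ fi).
have fv : nrm D (fun x => f x - v x) = 0.
  by apply: (coef_eq0 T0); [exact: inL2B|move=> n; rewrite coefB// vc subrr].
have [J uJ hJ] := vd e e0; exists J => //.
rewrite (_ : (fun x => _) = (fun x => (f x - v x) + (v x - trig T (coef T f) J x))); last first.
  by apply/funext => x; ring.
have ti : inL2 D (trig T (coef T f) J) by exact: inL2_trig.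
apply: le_trans (nrmD mD _ _) _; [exact: inL2B|exact: inL2B|].
by rewrite fv add0r.
Qed.

(** The converse of Bessel's inequality: the defect is the square distance to
    the partial sums, which is arbitrarily small. *)
Lemma Parseval_le f (M : R) : inL2 D f ->
  (forall J, uniq J -> \sum_(n <- J) cabs (coef T f n) ^+ 2 <= M) ->
  2 * T * nrm D f ^+ 2 <= M.
Proof.
move=> fi fM; have T2 : 0 < 2 * T by rewrite mulr_gt0.
have T2' : 0 < 2 * T + 1 by rewrite ltr_wpDr.
apply/ler_addgt0Pr => e e0.
have d0 : 0 < e / (2 * T + 1) by rewrite divr_gt0.
have s0 : 0 < Num.sqrt (e / (2 * T + 1)) by rewrite sqrtr_gt0.
have [J uJ hJ] := fourier_dense fi s0.
have := hJ; rewrite -(@ler_pXn2r _ 2)// ?nnegrE ?nrm_ge0 ?(ltW s0)//.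
rewrite nrm_sub_trig// (sqr_sqrtr (ltW d0)).
under eq_bigr do rewrite subrr cabs0 expr0n/=.
rewrite big1// sub0r => h.
have := fM J uJ; set S := \sum_(_ <- _) _ in h * => SM.
have h2 : 2 * T * nrm D f ^+ 2 - S <= 2 * T * (e / (2 * T + 1)).
  have -> : 2 * T * nrm D f ^+ 2 - S = 2 * T * (nrm D f ^+ 2 + (2 * T)^-1 * - S).
    by field; rewrite gt_eqF.
  by apply: ler_wpM2l; [exact: ltW|exact: h].
have h3 : 2 * T * (e / (2 * T + 1)) <= e.
  by rewrite mulrCA ger_pMr// ler_pdivrMr// mul1r lerDl.
lra.
Qed.

Lemma Parseval_esum f : inL2 D f ->
  (\esum_(n in [set: int]) (cabs (coef T f n) ^+ 2)%:E = (2 * T * nrm D f ^+ 2)%:E)%E.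
Proof.
move=> fi; apply/eqP; rewrite eq_le; apply/andP; split.
  by apply: esum_le_of => J uJ; exact: Bessel.
have sumle J := @sum_le_esum R (fun n => cabs (coef T f n) ^+ 2) J.
have : (\esum_(n in [set: int]) (cabs (coef T f n) ^+ 2)%:E <= (2 * T * nrm D f ^+ 2)%:E)%E.
  by apply: esum_le_of => J uJ; exact: Bessel.
have : (0 <= \esum_(n in [set: int]) (cabs (coef T f n) ^+ 2)%:E)%E.
  by apply: esum_ge0 => n _; rewrite lee_fin sqr_ge0.
case: (\esum_(n in [set: int]) (cabs (coef T f n) ^+ 2)%:E)%E sumle => //= r sr _ _.
by rewrite lee_fin; apply: Parseval_le => // J uJ; rewrite -lee_fin; exact: sr.
Qed.

End Parseval.

(** * Translation of integrals *)

Section Shift.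
Context {R : realType}.
Local Notation mu := (@lebesgue_measure R).

(** Lebesgue measure is characterized by its values on half-open intervals, and
    these are invariant. *)
Lemma lebesgue_measure_shift (c : R) (A : set R) : measurable A ->
  pushforward mu ((fun x => x + c) : _ -> measurableTypeR R) A = mu A.
Proof.
have ms : measurable_fun setT ((fun x => x + c) : _ -> measurableTypeR R).
  by apply: measurable_funD => //; exact: measurable_cst.
move=> mA; apply/esym/(@lebesgue_measure_unique R (pushforward mu _)) => //= _ [[a b]] _ <-.
rewrite /pushforward/= (_ : _ @^-1` _ = `]a - c, b - c]%classic).
  rewrite !lebesgue_measure_itv/= !lte_fin ltrD2r.
  by case: ifP => // _; congr (_%:E); ring.
by apply/seteqP; split => x /=; rewrite !in_itv/= ltrBlDr lerBrDr.
Qed.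

Lemma ge0_integral_shift (c : R) (D : set R) (f : R -> \bar R) :
  measurable D -> measurable_fun D f -> (forall x, D x -> (0 <= f x)%E) ->
  (\int[mu]_(x in D) f x =
   \int[mu]_(x in (fun x => (x + c)%R) @^-1` D) f (x + c)%R)%E.
Proof.
move=> mD mf f0.
pose ph : measurableTypeR R -> measurableTypeR R := fun x => x + c.
have ms : measurable_fun setT ph by exact: measurable_funD.
rewrite -[RHS](@ge0_integral_pushforward _ _ _ _ _ ph ms mu D f)//; last first.
  by move=> x /set_mem; exact: f0.
by apply: eq_measure_integral => //= A mA AS; exact/esym/lebesgue_measure_shift.
Qed.

Lemma integral_shift (c : R) (D : set R) (f : R -> \bar R) :
  measurable D -> measurable_fun D f ->
  (\int[mu]_(x in D) f x =
   \int[mu]_(x in (fun x => (x + c)%R) @^-1` D) f (x + c)%R)%E.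
Proof.
move=> mD mf; rewrite integralE [RHS]integralE; congr (_ - _)%E.
  rewrite (ge0_integral_shift c mD (measurable_funepos mf)) => [|x _]; last exact: funepos_ge0.
  by apply: eq_integral => x _; rewrite /= !funeposE.
rewrite (ge0_integral_shift c mD (measurable_funeneg mf)) => [|x _]; last exact: funeneg_ge0.
by apply: eq_integral => x _; rewrite /= !funenegE.
Qed.

Lemma cint_shift (c : R) D (f : R -> R[i]) : measurable D -> cmeas D f ->
  cintegral D f = cintegral ((fun x => x + c) @^-1` D) (fun x => f (x + c)).
Proof.
move=> mD [m1 m2]; rewrite /cintegral /Rintegral; congr (fine _ +i* fine _);
  by rewrite (integral_shift c)//; exact/measurable_EFinP.
Qed.

Lemma shift_itvcc (a b c : R) : (fun x => x + c) @^-1` `[a, b] = `[a - c, b - c]%classic.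
Proof. by apply/seteqP; split => x /=; rewrite !in_itv/= lerBlDr lerBrDr. Qed.

Lemma shift_itvco (a b c : R) : (fun x => x + c) @^-1` `[a, b[ = `[a - c, b - c[%classic.
Proof. by apply/seteqP; split => x /=; rewrite !in_itv/= lerBlDr ltrBrDr. Qed.

End Shift.

(** * Taylor bounds for sine and cosine *)

Section Taylor.
Context {R : realType}.

(** A function with nonnegative derivative increases, by the fundamental theorem
    of calculus. *)
Lemma le_from_deriv (F f : R -> R) (x : R) : (forall y : R, is_derive y (1 : R) F (f y)) ->
  continuous f -> (forall y, 0 <= y -> 0 <= f y) -> 0 <= x -> F 0 <= F x.
Proof.
move=> dF cf f0; rewrite le_eqVlt => /predU1P[<-//|x0].
rewrite -subr_ge0 -(Rintegral_FTC2 x0 dF cf); apply: Rintegral_ge0 => y /=.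
by rewrite in_itv/= => /andP[y0 _]; exact: f0.
Qed.

Definition sinp (m : nat) : {poly R} :=
  \sum_(i < m) ((-1) ^+ i / (i.*2.+1)`!%:R) *: 'X^(i.*2.+1).

Definition cosp (m : nat) : {poly R} :=
  \sum_(i < m) ((-1) ^+ i / (i.*2)`!%:R) *: 'X^(i.*2).

Let div_cancel (s a b : R) : a != 0 -> b != 0 -> s / (a * b) * a = s / b.
Proof. by move=> a0 b0; field; rewrite a0 b0. Qed.

Lemma deriv_sinp m : (sinp m)^`() = cosp m.
Proof.
rewrite /sinp /cosp raddf_sum; apply: eq_bigr => i _.
rewrite /= derivZ derivXn -['X^_ *+ _]scaler_nat scalerA/=; congr (_ *: _).
by rewrite factS natrM div_cancel// ?pnatr_eq0// -lt0n fact_gt0.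
Qed.

Lemma deriv_cosp m : (cosp m.+1)^`() = - sinp m.
Proof.
rewrite /sinp /cosp big_ord_recl derivD/= expr0 fact0 divr1 scale1r expr0 derivC add0r.
rewrite raddf_sum -sumrN; apply: eq_bigr => i _.
rewrite /= derivZ derivXn -['X^_ *+ _]scaler_nat scalerA/= -scaleNr; congr (_ *: _).
rewrite /bump/= add1n doubleS factS natrM div_cancel ?pnatr_eq0// -?lt0n ?fact_gt0//.
by rewrite exprS mulN1r mulNr.
Qed.

(** Successive integration from 0 shows that the Taylor polynomials of sine and
    cosine alternately over- and underestimate them. *)
Lemma taylor_sin_cos m (x : R) : 0 <= x ->
  0 <= (-1) ^+ m.+1 * (cos x - (cosp m.+1).[x]) /\
  0 <= (-1) ^+ m.+1 * (sin x - (sinp m.+1).[x]).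
Proof.
have ccos : continuous (@cos R) by exact: continuous_cos.
have csin : continuous (@sin R) by exact: continuous_sin.
have s_of_c k : (forall y : R, 0 <= y -> 0 <= (-1) ^+ k * (cos y - (cosp k).[y])) ->
    forall y : R, 0 <= y -> 0 <= (-1) ^+ k * (sin y - (sinp k).[y]).
  move=> h y y0.
  pose F := (-1) ^+ k *: (@sin R - horner (sinp k)).
  have F0 : F 0 = 0.
    transitivity ((-1) ^+ k * (sin 0 - (sinp k).[0])) => //.
    rewrite sin0 horner_sum big1 ?subrr ?mulr0//.
    by move=> i _; rewrite hornerZ hornerXn expr0n/= mulr0.
  rewrite -[X in X <= _]F0.
  apply: (@le_from_deriv F (fun y => (-1) ^+ k * (cos y - (cosp k).[y]))) => //.
  - move=> z; have h1 := is_deriveB (is_derive_sin z) (is_derive_poly (sinp k) z).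
    have h2 := is_deriveZ ((-1) ^+ k) h1; apply: (is_derive_eq h2).
    by rewrite deriv_sinp.
  - move=> z; apply: cvgMr; apply: cvgB; [exact: ccos|exact: continuous_horner].
have c_of_s k : (forall y : R, 0 <= y -> 0 <= (-1) ^+ k * (sin y - (sinp k).[y])) ->
    forall y : R, 0 <= y -> 0 <= (-1) ^+ k.+1 * (cos y - (cosp k.+1).[y]).
  move=> h y y0.
  pose F := (-1) ^+ k.+1 *: (@cos R - horner (cosp k.+1)).
  have F0 : F 0 = 0.
    transitivity ((-1) ^+ k.+1 * (cos 0 - (cosp k.+1).[0])) => //.
    rewrite cos0 horner_sum big_ord_recl/= big1.
      by rewrite hornerZ hornerXn !expr0 fact0 divr1 mulr1 addr0 subrr mulr0.
    by move=> i _; rewrite hornerZ hornerXn expr0n/= mulr0.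
  rewrite -[X in X <= _]F0.
  apply: (@le_from_deriv F (fun y => (-1) ^+ k * (sin y - (sinp k).[y]))) => //.
  - move=> z; have h1 := is_deriveB (is_derive_cos z) (is_derive_poly (cosp k.+1) z).
    have h2 := is_deriveZ ((-1) ^+ k.+1) h1; apply: (is_derive_eq h2).
    by rewrite deriv_cosp hornerN /GRing.scale/= exprS; ring.
  - move=> z; apply: cvgMr; apply: cvgB; [exact: csin|exact: continuous_horner].
have c1 (y : R) : 0 <= y -> 0 <= (-1) ^+ 1 * (cos y - (cosp 1).[y]).
  move=> _; rewrite /cosp big_ord1 hornerZ hornerXn expr0 fact0 divr1 expr0 mulr1.
  by rewrite expr1 mulN1r opprB subr_ge0 cos_le1.
have key k : forall y : R, 0 <= y -> 0 <= (-1) ^+ k.+1 * (cos y - (cosp k.+1).[y]).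
  elim: k => [|k ih] //; apply: c_of_s; exact: s_of_c.
by move=> x0; split; [exact: key|apply: s_of_c => // y; exact: key].
Qed.

Lemma horner_sinp m x : (sinp m).[x] = \sum_(i < m) ((-1) ^+ i / (i.*2.+1)`!%:R) * x ^+ (i.*2.+1).
Proof. by rewrite horner_sum; apply: eq_bigr => i _; rewrite hornerZ hornerXn. Qed.

Lemma horner_cosp m x : (cosp m).[x] = \sum_(i < m) ((-1) ^+ i / (i.*2)`!%:R) * x ^+ (i.*2).
Proof. by rewrite horner_sum; apply: eq_bigr => i _; rewrite hornerZ hornerXn. Qed.

Definition taylorE := (big_ord_recr, big_ord0, doubleS, double0, factS, fact0).

Lemma sin_le (x : R) : 0 <= x -> sin x <= x.
Proof.
move=> /(@taylor_sin_cos 0)[_]; rewrite horner_sinp !taylorE/=.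
have -> : 0 + (-1) ^+ 0 / (1 * 1)%:R * x ^+ 1 = x by field.
lra.
Qed.

Lemma cos_ge2 (x : R) : 1 - x ^+ 2 / 2 <= cos x.
Proof.
rewrite -cos_norm -(real_normK (num_real x)).
have /(@taylor_sin_cos 1)[+ _] := normr_ge0 x.
rewrite horner_cosp !taylorE/= => h.
have e : 0 + (-1) ^+ 0 / 1%:R * `|x| ^+ 0 + (-1) ^+ 1 / (2 * (1 * 1))%:R * `|x| ^+ 2
  = 1 - `|x| ^+ 2 / 2 by field.
by move: h; rewrite e; lra.
Qed.

Lemma cabs_cisB (a b : R) : cabs (cis a - cis b) <= `|a - b|.
Proof.
have -> : cis a - cis b = cis b * (cis (a - b) - 1).
  by rewrite mulrBr mulr1 -cisD (addrC b) subrK.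
rewrite cabsM cabs_cis mul1r -(@ler_pXn2r _ 2)// ?nnegrE ?cabs_ge0//.
rewrite cabs_cisB1 real_normK ?num_real//.
have := cos_ge2 (a - b); lra.
Qed.

End Taylor.

(** * Inverse Fourier transform and Plancherel's theorem *)

Section Lipschitz.
Context {R : realType}.

Lemma lip_continuous (F : R -> R[i]) (K : R) (p : R[i] -> R) :
  (forall z, `|p z| <= cabs z) -> (forall z w, p (z - w) = p z - p w) ->
  (forall x y, cabs (F x - F y) <= K * `|x - y|) -> continuous (p \o F).
Proof.
move=> pc pB FK x; apply/cvgrPdist_le => e e0.
have K1 : 0 < `|K| + 1 by rewrite ltr_wpDl.
near=> y; rewrite /= -pB (le_trans (pc _))// (le_trans (FK _ _))//.
apply: (@le_trans _ _ ((`|K| + 1) * `|x - y|)).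
  by rewrite ler_wpM2r// (le_trans (ler_norm _))// lerDl.
rewrite -ler_pdivlMl// mulrC; near: y.
by apply: cvgr_dist_le; rewrite ?divr_gt0//; exact: cvg_id.
Unshelve. all: by end_near. Qed.

Lemma Re_contr (z : R[i]) : `|complex.Re z| <= cabs z. Proof. exact: ler_Re_cabs. Qed.
Lemma Im_contr (z : R[i]) : `|complex.Im z| <= cabs z. Proof. exact: ler_Im_cabs. Qed.
Lemma cReB (z w : R[i]) : complex.Re (z - w) = complex.Re z - complex.Re w.
Proof. by rewrite cReD cReN. Qed.
Lemma cImB (z w : R[i]) : complex.Im (z - w) = complex.Im z - complex.Im w.
Proof. by rewrite cImD cImN. Qed.

Lemma lip_cmeas (F : R -> R[i]) (K : R) :
  (forall x y, cabs (F x - F y) <= K * `|x - y|) -> cmeas setT F.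
Proof.
by move=> FK; split; apply: continuous_measurable_fun;
  [exact: (lip_continuous Re_contr cReB FK)|exact: (lip_continuous Im_contr cImB FK)].
Qed.

End Lipschitz.

Section Plancherel.
Context {R : realType}.
Local Notation mu := (@lebesgue_measure R).
Implicit Types (f g : R -> R[i]) (n m : int).

Definition ift (D : set R) f (x : R) : R[i] :=
  cintegral D (fun xi => f xi * cis (2 * pi * x * xi)).

Lemma fourier_onE D f (xi : R) : fourier_on D f xi = ift D f (- xi).
Proof. by apply: eq_cint => x _; congr (_ * cis _); ring. Qed.

Context (T : R) (T0 : 0 < T).
Let D := `[- T, T]%classic.
Let mD : measurable D. Proof. exact: measurable_itv. Qed.
Let NTT : - T <= T. Proof. by rewrite ge0_cp// ltW. Qed.

Lemma cmeas_cis2 E (x : R) : cmeas E (fun xi => cis (2 * pi * x * xi)).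
Proof.
by apply: cmeas_cis; apply: measurable_funM => //; exact: measurable_cst.
Qed.

Lemma inL2_cis f (x : R) : inL2 D f ->
  inL2 D (fun xi => f xi * cis (2 * pi * x * xi)).
Proof.
move=> fi.
suff : inL2 D (fun xi => f xi * cis (2 * pi * x * xi)) /\
  nrm D (fun xi => f xi * cis (2 * pi * x * xi)) <= 1 * nrm D f by case.
apply: inL2_le => //; first by apply: cmeasM; [case: fi|exact: cmeas_cis2].
by move=> y _; rewrite cabsM cabs_cis mulr1 mul1r.
Qed.

Lemma nrm_cis f (x : R) :
  nrm D (fun xi => f xi * cis (2 * pi * x * xi)) = nrm D f.
Proof. by apply: eq_nrm => y _; rewrite cabsM cabs_cis mulr1. Qed.

Lemma cintble_ift f (x : R) : inL2 D f ->
  cintble D (fun xi => f xi * cis (2 * pi * x * xi)).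
Proof. by move=> fi; have [] := inL2_cintble NTT (inL2_cis x fi). Qed.

Lemma cabs_ift f (x : R) : inL2 D f -> cabs (ift D f x) <= Num.sqrt (2 * T) * nrm D f.
Proof.
move=> fi; have [h1 h2] := inL2_cintble NTT (inL2_cis x fi).
apply: (le_trans (cabs_cint mD h1)); apply: (le_trans h2).
by rewrite nrm_cis opprK -mulr2n mulr_natl.
Qed.

(** The exponential is 1-Lipschitz in its phase, and the frequencies are bounded
    by T. Continuity gives measurability of the transform. *)
Lemma ift_lip f (x y : R) : inL2 D f -> cabs (ift D f x - ift D f y) <=
  (2 * pi * T * \int[mu]_(t in D) cabs (f t)) * `|x - y|.
Proof.
move=> fi; rewrite /ift -cintB//; try exact: cintble_ift.
have [fint _] := inL2_cintble NTT fi; have fa := cintble_cabs mD fint.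
have i1 := cintbleB mD (cintble_ift x fi) (cintble_ift y fi).
apply: (le_trans (cabs_cint mD i1)).
rewrite [leRHS](_ : _ = (2 * pi * T * `|x - y|) * \int[mu]_(t in D) cabs (f t)); last by ring.
rewrite -(@RintegralZl _ _ _ mu D _ (2 * pi * T * `|x - y|) mD fa).
apply: le_Rintegral => //; first exact: cintble_cabs.
  exact: integrableRZ.
move=> t; rewrite /D/= in_itv/= => tD.
rewrite -mulrBr cabsM mulrC ler_wpM2r ?cabs_ge0//.
apply: (le_trans (cabs_cisB _ _)).
rewrite -mulrBl -mulrBr !normrM gtr0_norm// gtr0_norm ?pi_gt0//.
rewrite -!mulrA ler_pM2l// ler_pM2l ?pi_gt0// mulrC.
by rewrite ler_wpM2r// ler_norml.
Qed.

Lemma cmeas_ift f : inL2 D f -> cmeas setT (ift D f).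
Proof. by move=> fi; apply: lip_cmeas => x y; exact: ift_lip. Qed.

Let s (k : nat) : int := if odd k then Negz k./2 else Posz k./2.

Let s_bij : set_bij [set: nat] [set: int] s.
Proof.
rewrite setTT_bijective.
exists (fun n => match n with Posz k => k.*2 | Negz k => k.*2.+1 end).
  move=> k; rewrite /s; case: ifPn => ok; first by rewrite -[RHS](odd_double_half k) ok.
  by rewrite -[RHS](odd_double_half k) (negbTE ok).
case=> k; rewrite /s.
  by rewrite odd_double doubleK.
by rewrite oddS odd_double /= uphalf_double.
Qed.

(** Plancherel's theorem for compactly supported functions: cutting the line
    into intervals of length 1/(2T), the values of the transform at the points
    t + n/(2T) are the Fourier coefficients of a modulation of f, so that
    Parseval's identity gives the sum over the intervals. *)
Lemma plancherel_compact f : inL2 D f -> sqi setT (ift D f) = (nrm D f ^+ 2)%:E.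
Proof.
move=> fi; pose w : R := (2 * T)^-1.
have T2 : 0 < 2 * T by rewrite mulr_gt0.
have w0 : 0 < w by rewrite invr_gt0.
pose I k := `[(s k)%:~R * w, (s k + 1)%:~R * w[%classic : set R.
pose G x := ((cabs (ift D f x)) ^+ 2)%:E.
have mG E : measurable_fun E G.
  apply: (@measurable_funS _ _ _ _ setT) => //.
  by apply: measurable_cabs2; exact: cmeas_ift.
have G0 x : (0 <= G x)%E by rewrite lee_fin sqr_ge0.
have Ifloor k x : I k x <-> s k = Num.floor (x / w).
  rewrite /I/= in_itv/= -ler_pdivlMr// -ltr_pdivrMr//; split.
    by move=> h; symmetry; apply: floor_def.
  by move=> ->; exact: floor_itv.
have UI : \bigcup_k I k = setT.
  apply/seteqP; split => // x _; have [_ _ /(_ (Num.floor (x / w)) Logic.I)] := s_bij.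
  by move=> [k _ sk]; exists k => //; apply/Ifloor.
have tI : trivIset [set: nat] I.
  move=> i j _ _ [x [/Ifloor hi /Ifloor hj]].
  have [_ inj _] := s_bij; apply: (inj i j); [exact: mem_set|exact: mem_set|].
  by rewrite hi hj.
have mI k : measurable (I k) by exact: measurable_itv.
have -> : sqi setT (ift D f) = (\sum_(0 <= k <oo) \int[mu]_(x in I k) G x)%E.
  rewrite /sqi -UI (@ge0_integral_bigcup _ _ _ mu I G mI)//; exact: mG.
have e k : (\int[mu]_(x in I k) G x =
    \int[mu]_(x in `[0%R, w[) G (x + (s k)%:~R * w)%R)%E.
  rewrite (ge0_integral_shift ((s k)%:~R * w))//.
  rewrite shift_itvco subrr intrD mulrDl mul1r addrAC subrr add0r//.
transitivity (\sum_(0 <= k <oo) \int[mu]_(x in `[0%R, w[) G (x + (s k)%:~R * w)%R)%E.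
  by apply: eq_eseriesr => k _; exact: e.
have mGs k (E : set R) : measurable_fun E (fun x : R => G (x + (s k)%:~R * w)).
  apply: (@measurable_funS _ _ _ _ setT) => //.
  apply: (@measurableT_comp _ _ _ _ _ _ G) => //.
  exact: measurable_funD.
rewrite -integral_nneseries//; last by move=> k; exact: mGs.
under eq_integral.
  move=> t _.
  have -> : (\sum_(0 <= k <oo) G (t + (s k)%:~R * w)%R = (2 * T * nrm D f ^+ 2)%:E)%E.
    rewrite nneseries_esumT//.
    rewrite -(nrm_cis f t) -Parseval_esum//; last exact: inL2_cis.
    rewrite (reindex_esum _ _ _ _ s_bij); apply: eq_esum => k _.
    congr (_ ^+ 2)%:E; congr cabs; apply: eq_cint => x _.
    rewrite -[RHS]mulrA /ek -cisD; congr (_ * cis _).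
    by rewrite /w; field; rewrite gt_eqF.
  over.
rewrite integral_cst//.
rewrite /= lebesgue_measure_itv/= lte_fin w0 oppr0 adde0 -EFinM; congr (_%:E).
by rewrite /w mulrAC divff ?mul1r// gt_eqF.
Qed.

End Plancherel.

(** * L2 on the line and the multiplication formula *)

Section L2Line.
Context {R : realType}.
Local Notation mu := (@lebesgue_measure R).
Implicit Types (f g : R -> R[i]).

Lemma L2normE f : L2norm f = sqrte (sqi setT f).
Proof.
rewrite /L2norm unlock poweR12_sqrt; last first.
  by apply: integral_ge0 => x _; exact: poweR_ge0.
congr sqrte; apply: eq_integral => x _.
by rewrite /= ger0_norm ?cabs_ge0// powR_mulrn// cabs_ge0.
Qed.

Lemma L2E f : L2 f <-> inL2 setT f.
Proof.
have e : (L2norm f < +oo)%E = (sqi setT f < +oo)%E.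
  by rewrite L2normE; case: (sqi setT f) => [r||] //=; rewrite !ltry.
by split => [[m1 m2 fy]|[[m1 m2] fy]]; [split; rewrite -?e|split => //; rewrite e].
Qed.

Lemma L2norm_nrm f : inL2 setT f -> L2norm f = (nrm setT f)%:E.
Proof.
by move=> fi; rewrite L2normE sqiE//= sqrtr_sqr ger0_norm// nrm_ge0.
Qed.

Lemma cmeas_indic (D : set R) f : measurable D -> cmeas D f ->
  cmeas setT (fun x => f x * (\1_D x)%:C).
Proof.
move=> mD mf.
case: mf => m1 m2; split.
  rewrite (_ : (fun x => _) = (fun x => complex.Re (f x)) \_ D).
    exact/(measurable_restrictT _ _).1.
  apply/funext => x; rewrite patchE indicE; by case: (x \in D); rewrite cReM/= ?mulr1 ?mulr0 ?subr0.
rewrite (_ : (fun x => _) = (fun x => complex.Im (f x)) \_ D).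
  exact/(measurable_restrictT _ _).1.
apply/funext => x; rewrite patchE indicE; by case: (x \in D); rewrite cImM/= ?mulr1 ?mulr0 ?addr0 ?add0r.
Qed.

Lemma cint_indic (D : set R) f :
  cintegral D f = cintegral setT (fun x => f x * (\1_D x)%:C).
Proof.
rewrite /cintegral Rintegral_mkcond [X in _ +i* X = _]Rintegral_mkcond.
congr (_ +i* _); apply: eq_Rintegral => x _; rewrite patchE indicE;
  by case: (x \in D); rewrite cReImE /= ?mulr1 ?mulr0 ?subr0 ?addr0 ?add0r.
Qed.

Lemma cintble_indic (D : set R) f : measurable D -> cintble D f ->
  cintble setT (fun x => f x * (\1_D x)%:C).
Proof.
move=> mD fi; have fa := cintble_cabs mD fi.
apply: (cintble_le (h := (fun x => cabs (f x)) \_ D)) => //.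
- by apply: cmeas_indic => //; exact: cintble_meas.
- move=> x _; rewrite cabsM patchE indicE; case: (x \in D).
    by rewrite cabs1 mulr1.
  by rewrite cabs0 mulr0.
- by rewrite -restrict_EFin; apply/integrable_restrict => //; rewrite setTI.
Qed.

Lemma sqi_indic (D : set R) f : sqi setT (fun x => f x * (\1_D x)%:C) = sqi D f.
Proof.
rewrite [RHS]/sqi integral_mkcond; apply: eq_integral => x _.
rewrite patchE indicE; case: (x \in D); rewrite cabsM ?cabs1 ?mulr1//.
by rewrite cabs0 mulr0 expr0n.
Qed.

Lemma inL2_indic (D : set R) f : measurable D -> inL2 D f ->
  inL2 setT (fun x => f x * (\1_D x)%:C).
Proof. by move=> mD [mf fy]; split; [exact: cmeas_indic|rewrite sqi_indic]. Qed.

Lemma nrm_indic (D : set R) f : nrm setT (fun x => f x * (\1_D x)%:C) = nrm D f.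
Proof. by rewrite /nrm sqi_indic. Qed.

Lemma fubini_cisT f g : cintble setT f -> cintble setT g ->
  cintegral setT (fun x => f x * ift setT g x) =
  cintegral setT (fun y => g y * ift setT f y).
Proof.
move=> fi gi; have [mf mg] := (cintble_meas fi, cintble_meas gi).
have mT : measurable (setT : set R) by [].
pose K (z : R * R) : R[i] := f z.1 * g z.2 * cis (2 * pi * z.1 * z.2).
have mc1 (h : R -> R) : measurable_fun setT h -> measurable_fun setT (fun z : R * R => h z.1).
  by move=> mh; exact: measurableT_comp mh measurable_fst.
have mc2 (h : R -> R) : measurable_fun setT h -> measurable_fun setT (fun z : R * R => h z.2).
  by move=> mh; exact: measurableT_comp mh measurable_snd.
have marg : measurable_fun setT (fun z : R * R => 2 * pi * z.1 * z.2).
  apply: measurable_funM; last exact: measurable_snd.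
  by apply: measurable_funM => //; exact: measurable_fst.
have mcos : measurable_fun setT (fun z : R * R => cos (2 * pi * z.1 * z.2)).
  apply: (measurableT_comp _ marg); apply: continuous_measurable_fun; exact: continuous_cos.
have msin : measurable_fun setT (fun z : R * R => sin (2 * pi * z.1 * z.2)).
  apply: (measurableT_comp _ marg); apply: continuous_measurable_fun; exact: continuous_sin.
have [f1 f2] := (mc1 _ mf.1, mc1 _ mf.2).
have [g1 g2] := (mc2 _ mg.1, mc2 _ mg.2).
have mRe : measurable_fun setT (fun z => complex.Re (K z)).
  under eq_fun do rewrite !cReImE.
  by apply: measurable_funB; apply: measurable_funM => //;
    [apply: measurable_funB|apply: measurable_funD]; apply: measurable_funM.
have mIm : measurable_fun setT (fun z => complex.Im (K z)).
  under eq_fun do rewrite !cReImE.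
  by apply: measurable_funD; apply: measurable_funM => //;
    [apply: measurable_funB|apply: measurable_funD]; apply: measurable_funM.
have cK z : cabs (K z) = cabs (f z.1) * cabs (g z.2).
  by rewrite !cabsM cabs_cis mulr1.
have fa := cintble_cabs mT fi; have ga := cintble_cabs mT gi.
have intK (p : R[i] -> R) : (forall z, `|p z| <= cabs z) ->
    measurable_fun setT (fun z => p (K z)) ->
    (mu \x mu)%E.-integrable setT (fun z => (p (K z))%:E).
  move=> pc mp; apply/integrable12ltyP; first exact/measurable_EFinP.
  apply: (@le_lt_trans _ _ (\int[mu]_x \int[mu]_y (cabs (f x) * cabs (g y))%:E)%E).
    apply: ge0_le_integral => //.
    - by move=> x _; exact: integral_ge0.
    - apply: (@measurable_fun_fubini_tonelli_F _ _ _ _ _ mu (fun z => `|(p (K z))%:E|%E)) => //.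
      by apply: measurableT_comp => //; exact/measurable_EFinP.
    - apply: (@measurable_fun_fubini_tonelli_F _ _ _ _ _ mu (fun z => (cabs (f z.1) * cabs (g z.2))%:E)) => //.
      + apply/measurable_EFinP; apply: measurable_funM.
          exact: (mc1 _ (measurable_cabs mf)).
        exact: (mc2 _ (measurable_cabs mg)).
      + by move=> z; rewrite lee_fin mulr_ge0 ?cabs_ge0.
    - move=> x _; apply: ge0_le_integral => //.
      + apply: measurableT_comp => //; apply/measurable_EFinP.
        exact: (measurableT_comp mp (measurable_pair1 x)).
      + apply/measurable_EFinP; apply: measurable_funM => //.
        exact: measurable_cabs.
      + by move=> y _; rewrite /= lee_fin (le_trans (pc _))// cK.
  under eq_integral.
    move=> x _; under eq_integral do rewrite EFinM.
    rewrite ge0_integralZl//; last 3 first.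
    - by apply/measurable_EFinP; exact: measurable_cabs.
    - by move=> y _; rewrite lee_fin cabs_ge0.
    - by rewrite lee_fin cabs_ge0.
    rewrite -[X in (_ * X)%E](fineK (@integrable_fin_num _ _ _ mu _ mT _ ga)).
    over.
  under eq_integral do rewrite /= -EFinM mulrC EFinM.
  rewrite ge0_integralZl//; last 3 first.
  - by apply/measurable_EFinP; exact: measurable_cabs.
  - by move=> y _; rewrite lee_fin cabs_ge0.
  - by rewrite lee_fin fine_ge0// integral_ge0// => y _; rewrite lee_fin cabs_ge0.
  rewrite -[X in (_ * X)%E](fineK (@integrable_fin_num _ _ _ mu _ mT _ fa)).
  by rewrite -EFinM ltry.
have c1 x : cintble setT (fun y => g y * cis (2 * pi * x * y)).
  apply: (cintble_le (h := fun y => cabs (g y))) => //.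
    by apply: cmeasM => //; exact: cmeas_cis2.
  by move=> y _; rewrite cabsM cabs_cis mulr1.
have c2 y : cintble setT (fun x => f x * cis (2 * pi * y * x)).
  apply: (cintble_le (h := fun y => cabs (f y))) => //.
    by apply: cmeasM => //; exact: cmeas_cis2.
  by move=> x _; rewrite cabsM cabs_cis mulr1.
have e1 (x : R) : f x * ift setT g x = cintegral setT (fun y => K (x, y)).
  rewrite /ift -cintZ//; apply: eq_cint => y _; rewrite /K/=; ring.
have e2 (y : R) : g y * ift setT f y = cintegral setT (fun x => K (x, y)).
  rewrite /ift -cintZ//; apply: eq_cint => x _; rewrite /K/= (_ : 2 * pi * y * x = 2 * pi * x * y); ring.
have i1 (x : R) : cintble setT (fun y => K (x, y)).
  have := cintbleZ (f x) mT (c1 x); apply: eq_cintble => // y _; rewrite /K/=; ring.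
have i2 (y : R) : cintble setT (fun x => K (x, y)).
  have := cintbleZ (g y) mT (c2 y); apply: eq_cintble => // x _.
  rewrite /K/= (_ : 2 * pi * y * x = 2 * pi * x * y); ring.
have fub (p : R[i] -> R) : (forall z, `|p z| <= cabs z) ->
    measurable_fun setT (fun z => p (K z)) ->
    (forall x : R, mu.-integrable setT (EFin \o (fun y => p (K (x, y))))) ->
    (forall y : R, mu.-integrable setT (EFin \o (fun x => p (K (x, y))))) ->
    \int[mu]_(x in setT) (\int[mu]_(y in setT) p (K (x, y))) =
    \int[mu]_(y in setT) (\int[mu]_(x in setT) p (K (x, y))).
  move=> pc mp j1 j2; have h := Fubini (intK p pc mp).
  have L x : (fine (\int[mu]_y (p (K (x, y)))%:E)%E)%:E = (\int[mu]_y (p (K (x, y)))%:E)%E.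
    exact: (fineK (@integrable_fin_num _ _ _ mu _ mT _ (j1 x))).
  have M y : (fine (\int[mu]_x (p (K (x, y)))%:E)%E)%:E = (\int[mu]_x (p (K (x, y)))%:E)%E.
    exact: (fineK (@integrable_fin_num _ _ _ mu _ mT _ (j2 y))).
  transitivity (fine (\int[mu]_x \int[mu]_y (p (K (x, y)))%:E)%E).
    by apply: (congr1 fine); apply: eq_integral => x _; exact: L.
  transitivity (fine (\int[mu]_y \int[mu]_x (p (K (x, y)))%:E)%E).
    exact: (congr1 fine h).
  by apply: (congr1 fine); apply: eq_integral => y _; symmetry; exact: M.
apply: complexE; rewrite /=.
  under [in LHS]eq_Rintegral do rewrite e1/=.
  under [in RHS]eq_Rintegral do rewrite e2/=.
  apply: fub => //; [exact: Re_contr|by move=> x; case: (i1 x)|by move=> y; case: (i2 y)].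
under [in LHS]eq_Rintegral do rewrite e1/=.
under [in RHS]eq_Rintegral do rewrite e2/=.
apply: fub => //; [exact: Im_contr|by move=> x; case: (i1 x)|by move=> y; case: (i2 y)].
Qed.

Lemma ift_indic (D : set R) g (x : R) :
  ift D g x = ift setT (fun y => g y * (\1_D y)%:C) x.
Proof. by rewrite /ift cint_indic; apply: eq_cint => y _; rewrite mulrAC. Qed.

(** The multiplication formula: both sides are the double integral of
    f(x) g(y) e^(2 pi i x y). *)
Lemma fubini_cis (D E : set R) f g : measurable D -> measurable E ->
  cintble D f -> cintble E g ->
  cintegral D (fun x => f x * ift E g x) = cintegral E (fun y => g y * ift D f y).
Proof.
move=> mD mE fi gi.
have := fubini_cisT (cintble_indic mD fi) (cintble_indic mE gi).
move=> h; rewrite [LHS]cint_indic [RHS]cint_indic.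
transitivity (cintegral setT (fun x => f x * (\1_D x)%:C * ift setT (fun y => g y * (\1_E y)%:C) x)).
  by apply: eq_cint => x _; rewrite -ift_indic mulrAC.
by rewrite h; apply: eq_cint => x _; rewrite -ift_indic mulrAC.
Qed.

End L2Line.

(** * Entire extension and derivative *)

Section ComplexExponential.
Context {R : realType}.
Implicit Types z w : R[i].

Definition cexp z : R[i] := (expR (complex.Re z))%:C * cis (complex.Im z).

Lemma cexpD z w : cexp (z + w) = cexp z * cexp w.
Proof. by rewrite /cexp cReD cImD expRD cisD rmorphM/=; ring. Qed.

Lemma cabs_cexp z : cabs (cexp z) = expR (complex.Re z).
Proof. by rewrite cabsM cabs_cis mulr1 cabsR ger0_norm// expR_ge0. Qed.

Lemma expR_quad (a : R) : `|a| <= 2^-1 -> `|expR a - 1 - a| <= 2 * a ^+ 2.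
Proof.
rewrite ler_norml => /andP[al ar].
have h1 := expR_ge1Dx a; have h2 := expR_ge1Dx (- a).
have e0 := expR_gt0 a.
have eN : expR a * expR (- a) = 1 by rewrite -expRD subrr expR0.
have h3 : expR a * (1 - a) <= 1 by rewrite -[leRHS]eN ler_pM2l.
rewrite ger0_norm; last by lra.
have a2 := sqr_ge0 a.
have h4 : expR a * (1 - a) <= (1 + a + 2 * a ^+ 2) * (1 - a) by nra.
have h5 : expR a <= 1 + a + 2 * a ^+ 2 by rewrite -(@ler_pM2r _ (1 - a))//; lra.
lra.
Qed.

Lemma sin_abs_le (x : R) : `|sin x| <= `|x|.
Proof.
have key (y : R) : 0 <= y -> `|sin y| <= y.
  move=> y0; rewrite ler_norml; apply/andP; split; last exact: sin_le.
  have [y1|y1] := leP y pi; last by have := sin_geN1 y; have := pi_ge2 R; lra.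
  by rewrite (@le_trans _ _ 0) ?oppr_le0// sin_ge0_pi// y0.
have [x0|x0] := leP 0 x; first by rewrite [leRHS]ger0_norm// key.
by rewrite -(normrN (sin x)) -sinN [leRHS]ltr0_norm// key// oppr_ge0 ltW.
Qed.

Lemma sin_quad (x : R) : `|sin x - x| <= `|x| ^+ 2 * `|x|.
Proof.
have key (y : R) : 0 <= y -> `|sin y - y| <= y ^+ 2 * y.
  move=> y0; rewrite ler0_norm ?subr_le0 ?sin_le//.
  have [_] := @taylor_sin_cos R 1 y y0.
  rewrite horner_sinp !taylorE/=.
  have -> : 0 + (-1) ^+ 0 / (1 * 1)%:R * y ^+ 1 + (-1) ^+ 1 / (3 * (2 * (1 * 1)))%:R * y ^+ 3
    = y - y ^+ 2 * y / 6 by field.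
  have : 0 <= y ^+ 2 * y by rewrite mulr_ge0 ?sqr_ge0.
  lra.
have [x0|x0] := leP 0 x; first by rewrite (ger0_norm x0) key.
have := key (- x); rewrite oppr_ge0 => /(_ (ltW x0)).
rewrite (ltr0_norm x0) (_ : sin (- x) - - x = - (sin x - x)) ?normrN//.
by rewrite sinN; ring.
Qed.

(** An error quadratic in w survives integration over the frequencies, which is
    how the transform is differentiated under the integral sign. *)
Lemma cexp_quad w : cabs w <= 2^-1 -> cabs (cexp w - 1 - w) <= 8 * cabs w ^+ 2.
Proof.
move=> w2; set a := complex.Re w; set b := complex.Im w.
have a1 : `|a| <= 2^-1 by rewrite (le_trans (ler_Re_cabs w)).
have b1 : `|b| <= 2^-1 by rewrite (le_trans (ler_Im_cabs w)).
have ea := expR_quad a1.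
have e2 : expR a <= 2.
  move: ea a1; rewrite !ler_norml => /andP[_ h] /andP[h1 h2].
  have : 0 <= (2^-1 - a) * (2^-1 + a) by rewrite mulr_ge0//; lra.
  rewrite (_ : (2^-1 - a) * (2^-1 + a) = 4^-1 - a ^+ 2); last by field.
  lra.
have e0 := expR_gt0 a.
rewrite (le_trans (cabs_le_ReIm _))// !cReImE/= -/a -/b !subr0 cabs2E -/a -/b.
have nb : b ^+ 2 = `|b| ^+ 2 by rewrite real_normK ?num_real.
have na : a ^+ 2 = `|a| ^+ 2 by rewrite real_normK ?num_real.
have cb : `|cos b - 1| <= b ^+ 2 / 2.
  have := cos_le1 b; have := cos_ge2 b; rewrite ler_norml => h1 h2.
  by apply/andP; split; lra.
have sb := sin_abs_le b; have s2 := sin_quad b.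
have ea1 : `|expR a - 1| <= 2 * `|a|.
  rewrite (_ : expR a - 1 = (expR a - 1 - a) + a); last by ring.
  rewrite (le_trans (ler_normD _ _))//.
  have := normr_ge0 a; rewrite na in ea; nra.
have r1 : `|expR a * cos b - 0 * sin b - 1 - a| <= 2 * a ^+ 2 + b ^+ 2.
  rewrite (_ : _ - a = (expR a - 1 - a) + expR a * (cos b - 1)); last by ring.
  rewrite (le_trans (ler_normD _ _))// lerD// normrM (gtr0_norm e0).
  have := normr_ge0 (cos b - 1); nra.
have r2 : `|expR a * sin b + 0 * cos b - b| <= 2 * (`|a| * `|b|) + b ^+ 2.
  rewrite (_ : _ - b = (expR a - 1) * sin b + (sin b - b)); last by ring.
  rewrite (le_trans (ler_normD _ _))// lerD//.
    rewrite normrM mulrA ler_pM//.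
  rewrite (le_trans s2)// nb ler_piMr ?sqr_ge0//; lra.
rewrite (le_trans (lerD r1 r2))// na nb.
have := normr_ge0 a; have := normr_ge0 b; nra.
Qed.

End ComplexExponential.

Section EntireExtension.
Context {R : realType}.
Local Notation mu := (@lebesgue_measure R).

(** A quadratic error in the increment determines the derivative. *)
Lemma derive1_of_quad (f : R -> R) (x l K d : R) : 0 < d ->
  (forall h, `|h| <= d -> `|f (h + x) - f x - h * l| <= K * h ^+ 2) ->
  derive1 f x = l.
Proof.
move=> d0 fK; apply: cvg_lim => //; apply/cvgrPdist_le => e e0.
have K0 : 0 < `|K| + 1 by rewrite ltr_wpDl.
near=> h.
have h0 : h != 0 by near: h; exact: nbhs_dnbhs_neq.
have hd : `|h| <= d.
  by near: h; apply: dnbhs0_le.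
have he : `|h| <= e / (`|K| + 1).
  by near: h; apply: dnbhs0_le; rewrite divr_gt0.
rewrite distrC (_ : h^-1 *: _ - l = h^-1 * (f (h + x) - f x - h * l)); last first.
  by rewrite /GRing.scale/= [RHS]mulrBr mulKf.
rewrite normrM normrV ?unitfE// ler_pdivrMl ?normr_gt0//.
apply: (le_trans (fK _ hd)).
rewrite -(real_normK (num_real h)) expr2 mulrCA ler_wpM2l//.
apply: (@le_trans _ _ ((`|K| + 1) * `|h|)).
  by rewrite ler_wpM2r// (le_trans (ler_norm _))// lerDl.
by rewrite -ler_pdivlMl// mulrC.
Unshelve. all: by end_near. Qed.

Context (T : R) (T0 : 0 < T).
Let D := `[- T, T]%classic.
Let mD : measurable D. Proof. exact: measurable_itv. Qed.
Let NTT : - T <= T. Proof. by rewrite ge0_cp// ltW. Qed.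

Let A (xi : R) : R[i] := (2 * pi * xi)%:C * 'i%C.

Definition cift (f : R -> R[i]) (z : R[i]) : R[i] :=
  cintegral D (fun xi => f xi * cexp (A xi * z)).

Definition freq (f : R -> R[i]) (xi : R) : R[i] := A xi * f xi.

Lemma ReA (xi : R) z : complex.Re (A xi * z) = (- (2 * pi * complex.Im z)) * xi.
Proof. by rewrite /A !cReImE/=; ring. Qed.

Lemma ImA (xi : R) z : complex.Im (A xi * z) = (2 * pi * complex.Re z) * xi.
Proof. by rewrite /A !cReImE/=; ring. Qed.

Lemma cabsA xi : D xi -> cabs (A xi) <= 2 * pi * T.
Proof.
rewrite /D/= in_itv/= => xD; rewrite cabsM cabsi mulr1 cabsR !normrM.
rewrite gtr0_norm// gtr0_norm ?pi_gt0// ler_wpM2l ?mulr_ge0 ?pi_ge0//.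
by rewrite ler_norml.
Qed.

Lemma cmeas_expA E z : cmeas E (fun xi => cexp (A xi * z)).
Proof.
rewrite /cexp; under eq_fun do rewrite ReA ImA.
apply: cmeasM.
  apply: cmeasR; apply: measurableT_comp; first exact: measurable_expR.
  exact: measurable_funM.
by apply: cmeas_cis; exact: measurable_funM.
Qed.

Lemma cmeasA E : cmeas E A.
Proof.
apply: cmeasM; last exact: cmeas_cst.
by apply: cmeasR; exact: measurable_funM.
Qed.

Lemma expA_bound xi z : D xi -> cabs (cexp (A xi * z)) <= expR (2 * pi * T * cabs z).
Proof.
move=> Dx; rewrite cabs_cexp ler_expR (le_trans (ler_norm _))//.
rewrite (le_trans (ler_Re_cabs _))// cabsM ler_wpM2r ?cabs_ge0//.
exact: cabsA.
Qed.

Lemma cintble_cift f z : inL2 D f -> cintble D (fun xi => f xi * cexp (A xi * z)).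
Proof.
move=> fi; have [fint _] := inL2_cintble NTT fi.
apply: (cintble_le (h := fun xi => expR (2 * pi * T * cabs z) * cabs (f xi))) => //.
- by apply: cmeasM; [case: fi|exact: cmeas_expA].
- by move=> x Dx; rewrite cabsM mulrC ler_wpM2r ?cabs_ge0// expA_bound.
- by apply: integrableRZ => //; exact: cintble_cabs.
Qed.

Lemma inL2_freq f : inL2 D f -> inL2 D (freq f) /\ nrm D (freq f) <= 2 * pi * T * nrm D f.
Proof.
move=> fi; apply: inL2_le => //.
- by rewrite !mulr_ge0 ?pi_ge0// ltW.
- by apply: cmeasM; [exact: cmeasA|case: fi].
- by move=> x Dx; rewrite cabsM ler_wpM2r ?cabs_ge0// cabsA.
Qed.

(** The kernel is the exponential of a linear function of z with bounded slope on
    D, so that the quadratic error may be integrated against f. *)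
Lemma cift_quad f z : inL2 D f -> exists K d : R, 0 < d /\
  forall h, cabs h <= d ->
    cabs (cift f (h + z) - cift f z - h * cift (freq f) z) <= K * cabs h ^+ 2.
Proof.
move=> fi; have [fint _] := inL2_cintble NTT fi; have fa := cintble_cabs mD fint.
have pT : 0 < 2 * pi * T by rewrite !mulr_gt0 ?pi_gt0.
pose C := expR (2 * pi * T * cabs z) * (8 * (2 * pi * T) ^+ 2).
exists (C * \int[mu]_(xi in D) cabs (f xi)), ((2 * pi * T)^-1 / 2); split.
  by rewrite divr_gt0// invr_gt0.
move=> h hd; have [gi _] := inL2_freq fi.
have c1 := cintble_cift (h + z) fi; have c2 := cintble_cift z fi.
have c3 := cintbleZ h mD (cintble_cift z gi).
rewrite /cift -cintZ//; last exact: cintble_cift.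
rewrite -cintB// -cintB//; last exact: cintbleB.
apply: (le_trans (cabs_cint mD (cintbleB mD (cintbleB mD c1 c2) c3))).
rewrite [leRHS](_ : _ = (C * cabs h ^+ 2) * \int[mu]_(xi in D) cabs (f xi)); last by ring.
rewrite -(@RintegralZl _ _ _ mu D _ (C * cabs h ^+ 2) mD fa).
apply: le_Rintegral => //.
- by apply: cintble_cabs => //; apply: cintbleB => //; exact: cintbleB.
- exact: integrableRZ.
move=> xi Dx.
have -> : f xi * cexp (A xi * (h + z)) - f xi * cexp (A xi * z) -
    h * (freq f xi * cexp (A xi * z)) =
    f xi * cexp (A xi * z) * (cexp (A xi * h) - 1 - A xi * h).
  by rewrite mulrDr cexpD /freq; ring.
rewrite cabsM (cabsM (f xi)) -mulrA mulrC ler_wpM2r ?cabs_ge0//.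
have Ah : cabs (A xi * h) <= 2^-1.
  rewrite cabsM (le_trans (ler_pM (cabs_ge0 _) (cabs_ge0 _) (cabsA Dx) hd))//.
  by rewrite mulrA divff ?mul1r// gt_eqF.
rewrite /C -mulrA; apply: ler_pM; rewrite ?cabs_ge0 ?expA_bound//.
apply: (le_trans (cexp_quad Ah)); rewrite -mulrA ler_pM2l// -exprMn cabsM.
rewrite ler_pXn2r ?nnegrE ?mulr_ge0 ?cabs_ge0 ?pi_ge0 ?(ltW T0)//.
by rewrite ler_wpM2r ?cabs_ge0// cabsA.
Qed.

Lemma cift_real f (x : R) : cift f x%:C = ift D f x.
Proof.
apply: eq_cint => xi _; rewrite /cexp ReA ImA /= mulr0 oppr0 mul0r expR0 mul1r//.
Qed.

(** The quadratic estimate cift_quad holds around every complex point. *)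
Lemma entire_cift f : inL2 D f -> entire (cift f : Cplx -> Cplx).
Proof.
move=> fi z; have [K [d [d0 hK]]] := @cift_quad f z fi.
apply/cvg_ex; exists (cift (freq f) z : Cplx^o).
apply/cvgrPdist_le => e e0.
have eR : e = (cabs e)%:C by rewrite -normc_cabs gtr0_norm.
have e0' : 0 < cabs e by rewrite -ltcR -eR.
have K0 : 0 < `|K| + 1 by rewrite ltr_wpDl.
have dn (r : R) : 0 < r -> \forall h \near (0 : Cplx)^', `|h| <= r%:C.
  by move=> r0; apply: dnbhs0_le; rewrite ltcR.
near=> h.
have h0 : h != 0 by near: h; exact: nbhs_dnbhs_neq.
have hd : cabs h <= d.
  have : `|h| <= d%:C by near: h; exact: dn.
  by rewrite normc_cabs lecR.
have he : cabs h <= cabs e / (`|K| + 1).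
  have : `|h| <= (cabs e / (`|K| + 1))%:C by near: h; apply: dn; rewrite divr_gt0.
  by rewrite normc_cabs lecR.
rewrite eR normc_cabs lecR -cabsN opprB /=.
rewrite [X in cabs (X - _)](_ : _ = h^-1 * (cift f (h + z) - cift f z)); last first.
  by rewrite /GRing.scale/= mulr1.
have hc : cabs h != 0 by apply/eqP => /cabs_eq0 /eqP; apply/negP.
have hc0 : 0 < cabs h by rewrite lt_def hc cabs_ge0.
rewrite -(@ler_pM2l _ (cabs h))// -cabsM mulrBr mulrA divff// mul1r.
apply: (le_trans (hK h hd)); rewrite expr2 mulrCA ler_wpM2l ?cabs_ge0//.
apply: (@le_trans _ _ ((`|K| + 1) * cabs h)).
  by rewrite ler_wpM2r ?cabs_ge0// (le_trans (ler_norm _))// lerDl.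
by rewrite -ler_pdivlMl// mulrC.
Unshelve. all: by end_near. Qed.

Lemma cderive_ift f (x : R) : inL2 D f -> cderive (ift D f) x = ift D (freq f) x.
Proof.
move=> fi; have [K [d [d0 hK]]] := @cift_quad f x%:C fi.
have hR (h : R) : `|h| <= d -> cabs (ift D f (h + x) - ift D f x - h%:C * ift D (freq f) x)
    <= K * h ^+ 2.
  move=> hd; have := hK h%:C; rewrite cabsR => /(_ hd).
  by rewrite -!cift_real rmorphD/= real_normK ?num_real.
apply: complexE => /=; apply: (derive1_of_quad d0) => h hd.
- rewrite (_ : _ - _ - _ = complex.Re (ift D f (h + x) - ift D f x - h%:C * ift D (freq f) x)).
    exact: le_trans (ler_Re_cabs _) (hR h hd).
  by rewrite !cReImE/=; ring.
- rewrite (_ : _ - _ - _ = complex.Im (ift D f (h + x) - ift D f x - h%:C * ift D (freq f) x)).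
    exact: le_trans (ler_Im_cabs _) (hR h hd).
  by rewrite !cReImE/=; ring.
Qed.

End EntireExtension.

(** * The Paley-Wiener representation *)

Section PaleyWiener.
Context {R : realType}.
Local Notation mu := (@lebesgue_measure R).
Implicit Types (f g phi : R -> R[i]).
Local Notation D1 := (`[- (1 : R), 1]%classic).

Let mD1 : measurable D1. Proof. exact: measurable_itv. Qed.

Lemma iftD (T x : R) f g : 0 < T -> inL2 `[- T, T] f -> inL2 `[- T, T] g ->
  ift `[- T, T] (fun x => f x + g x) x = ift `[- T, T] f x + ift `[- T, T] g x.
Proof.
move=> T0 fi gi; rewrite -cintD; last 3 first.
- exact: measurable_itv.
- exact: (cintble_ift T0 x fi).
- exact: (cintble_ift T0 x gi).
by apply: eq_cint => y _; rewrite mulrDl.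
Qed.

Lemma iftZ (T x : R) c f : 0 < T -> inL2 `[- T, T] f ->
  ift `[- T, T] (fun x => c * f x) x = c * ift `[- T, T] f x.
Proof.
move=> T0 fi; rewrite -cintZ; last 2 first.
- exact: measurable_itv.
- exact: (cintble_ift T0 x fi).
by apply: eq_cint => y _; rewrite mulrA.
Qed.

Lemma iftB (T x : R) f g : 0 < T -> inL2 `[- T, T] f -> inL2 `[- T, T] g ->
  ift `[- T, T] (fun x => f x - g x) x = ift `[- T, T] f x - ift `[- T, T] g x.
Proof.
move=> T0 fi gi; rewrite -cintB; last 3 first.
- exact: measurable_itv.
- exact: (cintble_ift T0 x fi).
- exact: (cintble_ift T0 x gi).
by apply: eq_cint => y _; rewrite mulrBl.
Qed.

Lemma itv_sym_sub (S T : R) : S <= T -> `[- S, S] `<=` `[- T, T].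
Proof.
by move=> ST x /=; rewrite !in_itv/= => /andP[x1 x2]; apply/andP; split; lra.
Qed.

Lemma fourier_onJ D f (xi : R) : measurable D -> cintble D f ->
  fourier_on D f xi = (ift D (fun x => (f x)^J) xi)^J.
Proof.
move=> mD fi; rewrite /ift -cintJ//; last first.
  have fa := cintble_cabs mD fi.
  apply: cintble_le fa => //.
    by apply: cmeasM; [exact/cmeasJ/cintble_meas|exact: cmeas_cis2].
  by move=> x _; rewrite cabsM cabsJ cabs_cis mulr1.
apply: eq_cint => x _; rewrite cJM cJK -cisN; congr (_ * cis _); ring.
Qed.

Lemma nrm_fourier_on (T : R) f : 0 < T -> inL2 `[- T, T] f ->
  inL2 setT (fourier_on `[- T, T] f) /\
  nrm setT (fourier_on `[- T, T] f) = nrm `[- T, T] f.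
Proof.
move=> T0 fi; have NTT : - T <= T by rewrite ge0_cp// ltW.
have [fint _] := inL2_cintble NTT fi.
have fJ := inL2J fi.
have pl := plancherel_compact T0 fJ; rewrite nrmJ in pl.
have ii : inL2 setT (ift `[- T, T] (fun x => (f x)^J)).
  by split; [exact: cmeas_ift|rewrite pl ltry].
have e : fourier_on `[- T, T] f = (fun xi => (ift `[- T, T] (fun x => (f x)^J) xi)^J).
  by apply/funext => xi; exact: fourier_onJ.
rewrite e; split; first exact: inL2J.
by rewrite nrmJ /nrm pl/= sqrtr_sqr ger0_norm// nrm_ge0.
Qed.

(** Monotone convergence of the square integrals over growing intervals. *)
Lemma nrm_exhaust f (e : R) : inL2 setT f -> 0 < e ->
  exists2 N : R, 0 < N & forall T, N <= T -> nrm setT f ^+ 2 - e <= nrm `[- T, T] f ^+ 2.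
Proof.
move=> fi e0.
have mI (k : nat) : measurable (`[- k%:R, k%:R]%classic : set R) by exact: measurable_itv.
have mI' (T : R) : measurable (`[- T, T]%classic : set R) by exact: measurable_itv.
have := @ge0_nondecreasing_set_cvg_integral _ (measurableTypeR R) R (fun k : nat => `[- k%:R, k%:R]%classic : set R)
  (fun x => ((cabs (f x)) ^+ 2)%:E) mu.
have -> : \bigcup_i `[- i%:R, i%:R]%classic = (setT : set R).
  apply/seteqP; split => // x _; exists (Num.bound `|x|) => //=.
  rewrite in_itv/= -ler_norml; apply: ltW; exact: archi_boundP.
move=> /(_ _ mI _ _) h.
have {}h : sqi `[- k%:R, k%:R] f @[k --> \oo] --> sqi setT f.
  apply: h.
  - by move=> n m nm; apply/subsetPset; apply: itv_sym_sub; rewrite ler_nat.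
  - by move=> i; apply: measurable_cabs2; exact: cmeasS fi.1.
  - by move=> i x _; rewrite lee_fin sqr_ge0.
rewrite sqiE// in h; move/fine_cvgP : h => [_ /cvgrPdist_le/(_ _ e0)[N _ hN]].
exists (N.+1%:R) => // T NT.
have fS (T' : R) : inL2 `[- T', T'] f by exact: inL2S fi.
have := hN N.+1 (leqnSn N); rewrite /= sqiE//=.
move/(le_trans (ler_norm _)); rewrite lerBlDl -lerBlDr => /le_trans; apply.
rewrite ler_pXn2r ?nnegrE ?nrm_ge0//; apply: nrmS => //.
exact: itv_sym_sub.
Qed.

Section Representation.
Variable phi : R -> R[i].
Hypothesis phii : inL2 D1 phi.
Let g := ift D1 phi.
Let phi1 := fun x => phi x * (\1_D1 x)%:C.

Lemma inL2_ift : inL2 setT g /\ nrm setT g = nrm D1 phi.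
Proof.
have pl := plancherel_compact ltr01 phii.
split; first by split; [exact: (cmeas_ift ltr01 phii)|rewrite pl ltry].
by rewrite /nrm pl/= sqrtr_sqr ger0_norm// nrm_ge0.
Qed.

(** The multiplication formula turns the inner product of phi with the transform
    of the truncation of g into the square norm of this truncation; by
    Plancherel that is also the square norm of the transform. Thus the error
    is the part of the square norm of g that lies outside [-T, T]. *)
Lemma inversion_defect (T : R) : 0 < T ->
  inL2 setT (fun xi => phi1 xi - fourier_on `[- T, T] g xi) /\
  nrm setT (fun xi => phi1 xi - fourier_on `[- T, T] g xi) ^+ 2
    = nrm D1 phi ^+ 2 - nrm `[- T, T] g ^+ 2.
Proof.
move=> T0; have NTT : - T <= T by rewrite ge0_cp// ltW.
have mE : measurable (`[- T, T]%classic : set R) by exact: measurable_itv.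
have gi : inL2 `[- T, T] g by apply: inL2S inL2_ift.1.
have gJ := inL2J gi.
have [ghi ghn] := nrm_fourier_on T0 gi.
have p1 := inL2_indic mD1 phii.
split; first exact: inL2B.
have N11 : - (1 : R) <= 1 by rewrite ge0_cp.
have [gint _] := inL2_cintble NTT gi.
have [gJint _] := inL2_cintble NTT gJ.
have [pint _] := inL2_cintble N11 phii.
have n1 : nrm setT phi1 = nrm D1 phi := nrm_indic D1 phi.
rewrite (@nrm_sqrB _ setT phi1 (fourier_on `[- T, T] g) measurableT p1 ghi) ghn n1.
have -> : cintegral setT (fun x => phi1 x * (fourier_on `[- T, T] g x)^J) =
    cintegral `[- T, T] (fun x => (g x) * (g x)^J).
  transitivity (cintegral D1 (fun x => phi x * ift `[- T, T] (fun y => (g y)^J) x)).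
    rewrite [RHS]cint_indic; apply: eq_cint => x _.
    by rewrite (fourier_onJ x mE gint) cJK; exact: mulrAC.
  rewrite (fubini_cis mD1 mE pint gJint); apply: eq_cint => x _; exact: mulrC.
have -> : complex.Re (cintegral `[- T, T] (fun x => (g x) * (g x)^J)) = nrm `[- T, T] g ^+ 2.
  by rewrite (nrm2_cint gi).
move: (nrm D1 phi ^+ 2) (nrm `[- T, T] g ^+ 2) => u v; ring.
Qed.

(** By inversion_defect the error is the tail of a convergent integral. *)
Lemma is_fourier_ift : is_fourier_L2 g phi1.
Proof.
split; first by apply/L2E; case: inL2_ift.
  by apply/L2E; exact: inL2_indic.
have [gi gn] := inL2_ift.
apply/fine_cvgP; split.
  near=> T; have T0 : 0 < T by near: T; exact: nbhs_pinfty_gt.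
  by rewrite L2norm_nrm//; case: (inversion_defect T0).
apply/cvgrPdist_le => e e0; have e2 : 0 < e ^+ 2 by rewrite exprn_gt0.
have [N N0 hN] := nrm_exhaust gi e2.
near=> T; have NT : N <= T by near: T; apply: nbhs_pinfty_ge; exact: num_real.
have T0 : 0 < T by exact: lt_le_trans NT.
have [di dE] := inversion_defect T0.
rewrite /= L2norm_nrm//= sub0r normrN ger0_norm ?nrm_ge0//.
rewrite -(@ler_pXn2r _ 2)// ?nnegrE ?nrm_ge0 ?(ltW e0)// dE -gn.
by rewrite lerBlDr addrC -lerBlDr; exact: hN.
Unshelve. all: by end_near. Qed.

Lemma PW_ift : PW2pi g.
Proof.
split.
- by apply/L2E; case: inL2_ift.
- exists phi1; first exact: is_fourier_ift.
  apply: aeW => xi xi1; rewrite /phi1 indicE memNset ?mulr0//=.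
  by rewrite in_itv/= -ler_norml leNgt xi1.
- exists (cift 1 phi); first exact: entire_cift.
  by move=> x; rewrite cift_real.
Qed.

End Representation.

(** A nonzero value of a continuous function persists on an interval, whose
    length bounds the norm from below. *)
Lemma continuous_nrm0 f (p : R[i] -> R) (x : R) : (forall z, `|p z| <= cabs z) ->
  continuous (p \o f) -> inL2 setT f ->
  (forall T, 0 < T -> nrm `[- T, T] f = 0) -> p (f x) = 0.
Proof.
move=> pc cf fi f0; apply: contrapT => /eqP px.
have c0 : 0 < `|p (f x)| / 2 by rewrite divr_gt0// normr_gt0.
have /cvgrPdist_lt/(_ _ c0)/nbhs_ballP[d /= d0 hd] := cf x.
set I := `[x - d / 2, x + d / 2]%classic.
have xI : x - d / 2 <= x + d / 2 by lra.
have mI : measurable I by exact: measurable_itv.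
have [i1 n1] := nrm_cst1 xI.
have fI : inL2 I f by exact: inL2S fi.
have [_ ] : inL2 I (fun=> (1 : R[i])) /\
    nrm I (fun=> (1 : R[i])) <= (`|p (f x)| / 2)^-1 * nrm I f.
  apply: inL2_le => //.
  move=> y; rewrite /I/= in_itv/= => /andP[y1 y2].
  have /hd /= h : ball x d y.
    by rewrite /ball/= ltr_distlC; apply/andP; split; lra.
  rewrite cabs1 -ler_pdivrMl ?invr_gt0// invrK mulr1.
  apply: le_trans (pc _).
  have := ler_normD (p (f x) - p (f y)) (p (f y)); rewrite subrK.
  by move: h; rewrite /=; lra.
pose T := `|x| + d.
have T0 : 0 < T by rewrite ltr_wpDl.
have := f0 T T0 => fT.
have fI0 : nrm I f = 0.
  apply/eqP; rewrite eq_le nrm_ge0 andbT -fT; apply: nrmS => //.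
    move=> y; rewrite /I/= !in_itv/= => /andP[y1 y2].
    have := ler_norm (- x); rewrite normrN; have := ler_norm x; rewrite /T => h1 h2.
    by apply/andP; split; lra.
  exact: inL2S fi.
rewrite fI0 mulr0 n1 leNgt sqrtr_gt0; move/negP; apply; lra.
Qed.

Lemma entire_continuous (p : R[i] -> R) f (F : Cplx -> Cplx) :
  (forall z, `|p z| <= cabs z) -> (forall z w, p (z - w) = p z - p w) ->
  entire F -> (forall x : R, F x%:C = f x) -> continuous (p \o f).
Proof.
move=> pc pB eF Ff x; apply/cvgrPdist_le => e e0.
have cF : {for (x%:C : Cplx), continuous (F : Cplx -> Cplx^o)}.
  by apply: differentiable_continuous; apply/derivable1_diffP; exact: eF.
have eC : (0 : Cplx) < e%:C by rewrite ltcR.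
have /cvgrPdist_le/(_ _ eC)/nbhs_ballP[d /= d0 hd] := cF.
have dR : d = (cabs d)%:C by rewrite -normc_cabs gtr0_norm.
have d0' : 0 < cabs d by rewrite -ltcR -dR.
apply/nbhs_ballP; exists (cabs d) => //= y xy.
rewrite -pB (le_trans (pc _))// -!Ff.
have /hd : ball (x%:C : Cplx) d (y%:C).
  rewrite /ball/= dR (_ : x%:C - y%:C = (x - y)%:C); last by rewrite rmorphB.
  by rewrite normc_cabs cabsR ltcR.
by rewrite /= normc_cabs lecR.
Qed.

(** The spectrum is phi, the L2 Fourier transform of f. The difference of f and the
    inverse transform g of phi has on [-T, T] the norm of the transform of its
    truncation, and the truncated transforms of f and g both tend to phi. So f
    and g agree almost everywhere, hence everywhere by continuity. *)
Lemma PW_rep f : PW2pi f -> exists2 phi, inL2 D1 phi & f = ift D1 phi.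
Proof.
move=> [/L2E fi [phi [_ /L2E phii fphi] phi0] [F eF Ff]].
have pD : inL2 D1 phi by exact: inL2S phii.
exists phi => //; set g := ift D1 phi.
have [gi gn] := inL2_ift pD.
pose phi1 x := phi x * (\1_D1 x)%:C.
have gphi : L2norm (fun xi => phi1 xi - fourier_on `[- T, T] g xi) @[T --> +oo] --> 0%E.
  by case: (is_fourier_ift pD).
have p1 : inL2 setT phi1 by exact: inL2_indic.
have dphi : nrm setT (fun x => phi x - phi1 x) = 0.
  rewrite /nrm /sqi (@ge0_ae_eq_integral _ _ _ mu setT _ (cst 0%E)) ?integral0 ?sqrtr0//.
  - apply: measurable_cabs2; apply: cmeasB; [exact: phii.1|exact: p1.1].
  - by move=> x _; rewrite lee_fin sqr_ge0.
  - apply: (ae_imp2 _ phi0 phi0) => x h _ _; rewrite /phi1 indicE.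
    have [x1|x1] := ltP 1 `|x|; first by rewrite h// mul0r subr0 cabs0 expr0n.
    rewrite mem_set/= ?mulr1 ?subrr ?cabs0 ?expr0n//.
    by rewrite in_itv/= -ler_norml.
have small (T0 : R) : 0 < T0 -> nrm `[- T0, T0] (fun x => f x - g x) = 0.
  move=> T00; apply/eqP; rewrite eq_le nrm_ge0 andbT.
  apply/ler_addgt0Pr => e e0; rewrite add0r; have e2 : 0 < e / 2 by rewrite divr_gt0.
  move/fine_cvgP : fphi => [_ /cvgrPdist_le/(_ _ e2) near1].
  move/fine_cvgP : gphi => [_ /cvgrPdist_le/(_ _ e2) near2].
  have [T [[h1 h2] T0T]] := filter_ex (filterI (filterI near1 near2) (nbhs_pinfty_ge (num_real T0))).
  rewrite /= in T0T; have Tp : 0 < T by exact: lt_le_trans T0T.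
  have mT : measurable (`[- T, T]%classic : set R) by exact: measurable_itv.
  have NTT : - T <= T by rewrite ge0_cp// ltW.
  have fT : inL2 `[- T, T] f by exact: inL2S fi.
  have gT : inL2 `[- T, T] g by exact: inL2S gi.
  have dT := inL2B mT fT gT.
  have [fh _] := nrm_fourier_on Tp fT.
  have [gh _] := nrm_fourier_on Tp gT.
  have [dh dn] := nrm_fourier_on Tp dT.
  have mTT : measurable (setT : set R) by [].
  have a1 : nrm setT (fun xi => phi xi - fourier_on `[- T, T] f xi) <= e / 2.
    have h : `|0 - fine (L2norm (fun xi => phi xi - fourier_on `[- T, T] f xi))| <= e / 2 := h1.
    rewrite (L2norm_nrm (inL2B mTT phii fh)) sub0r normrN in h.
    exact: le_trans (ler_norm _) h.
  have a2 : nrm setT (fun xi => phi1 xi - fourier_on `[- T, T] g xi) <= e / 2.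
    have h : `|0 - fine (L2norm (fun xi => phi1 xi - fourier_on `[- T, T] g xi))| <= e / 2 := h2.
    rewrite (L2norm_nrm (inL2B mTT p1 gh)) sub0r normrN in h.
    exact: le_trans (ler_norm _) h.
  apply: (@le_trans _ _ (nrm `[- T, T] (fun x => f x - g x))).
    by apply: nrmS => //; exact: itv_sym_sub.
  rewrite -dn.
  have -> : fourier_on `[- T, T] (fun x => f x - g x) =
      (fun xi => (phi1 xi - fourier_on `[- T, T] g xi) +
        ((phi xi - phi1 xi) - (phi xi - fourier_on `[- T, T] f xi))).
    apply/funext => xi; rewrite !fourier_onE.
    have -> : ift `[- T, T] (fun x => f x - g x) (- xi) =
        ift `[- T, T] f (- xi) - ift `[- T, T] g (- xi).
      exact: (iftB _ Tp fT gT).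
    move: (phi xi) (phi1 xi) (ift `[- T, T] f (- xi)) (ift `[- T, T] g (- xi)) => a b c d.
    ring.
  have i1 := inL2B mTT p1 gh; have i2 := inL2B mTT phii p1.
  have i3 := inL2B mTT phii fh.
  apply: (le_trans (nrmD mTT i1 (inL2B mTT i2 i3))).
  have := nrmB mTT i2 i3; rewrite dphi add0r => h.
  by rewrite [leRHS]splitr; exact: (lerD a2 (le_trans h a1)).
have di : inL2 setT (fun x => f x - g x) by exact: inL2B.
have zero (p : R[i] -> R) x : (forall z, `|p z| <= cabs z) ->
    (forall z w, p (z - w) = p z - p w) -> p (f x - g x) = 0.
  move=> pc pB; apply: (@continuous_nrm0 (fun x => f x - g x) p x) => //.
  rewrite (_ : p \o _ = (fun x => (p \o f) x - (p \o g) x)); last first.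
    by apply/funext => y; rewrite /= pB.
  move=> y; apply: cvgB; first exact: (entire_continuous pc pB eF Ff).
  exact: (lip_continuous pc pB (fun x y => ift_lip ltr01 x y pD)).
apply/funext => x; apply/eqP; rewrite -subr_eq0; apply/eqP; apply: complexE.
  exact: (zero _ x Re_contr cReB).
exact: (zero _ x Im_contr cImB).
Qed.

End PaleyWiener.

(** * Numerical bounds *)

Section NumericalBounds.
Context {R : realType}.
Implicit Types x y : R.

Lemma sin_le5 x : 0 <= x -> sin x <= x - x ^+ 3 / 6 + x ^+ 5 / 120.
Proof.
move=> x0; have [_] := @taylor_sin_cos R 2 x x0; rewrite horner_sinp !taylorE/=.
set s := (X in sin x - X).
have -> : s = x - x ^+ 3 / 6 + x ^+ 5 / 120 by rewrite /s; field.
by rewrite exprS expr2; lra.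
Qed.

Lemma sin_ge3 x : 0 <= x -> x - x ^+ 3 / 6 <= sin x.
Proof.
move=> x0; have [_] := @taylor_sin_cos R 1 x x0; rewrite horner_sinp !taylorE/=.
set s := (X in sin x - X).
have -> : s = x - x ^+ 3 / 6 by rewrite /s; field.
by rewrite expr2; lra.
Qed.

Lemma cos_ge6 x : 0 <= x -> 1 - x ^+ 2 / 2 + x ^+ 4 / 24 - x ^+ 6 / 720 <= cos x.
Proof.
move=> x0; have [+ _] := @taylor_sin_cos R 3 x x0; rewrite horner_cosp !taylorE/=.
set s := (X in cos x - X).
have -> : s = 1 - x ^+ 2 / 2 + x ^+ 4 / 24 - x ^+ 6 / 720 by rewrite /s; field.
by rewrite 2!exprS expr2; lra.
Qed.

Lemma cos_le8 x : 0 <= x ->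
  cos x <= 1 - x ^+ 2 / 2 + x ^+ 4 / 24 - x ^+ 6 / 720 + x ^+ 8 / (720 * 56).
Proof.
move=> x0; have [+ _] := @taylor_sin_cos R 4 x x0; rewrite horner_cosp !taylorE/= !natrM.
set s := (X in cos x - X).
have -> : s = 1 - x ^+ 2 / 2 + x ^+ 4 / 24 - x ^+ 6 / 720 + x ^+ 8 / (720 * 56) by rewrite /s; field.
by rewrite 3!exprS expr2; lra.
Qed.

(** The Taylor polynomial of degree 8 makes the cosine of 11/7 negative, so that
    11/7 exceeds pi/2. *)
Lemma pi_le : pi <= 22 / 7 :> R.
Proof.
rewrite leNgt; apply/negP => h.
have x0 : 0 <= (11 / 7 : R) by rewrite divr_ge0.
have : 0 < cos (11 / 7 : R) by apply: cos_gt0_pihalf; apply/andP; split; lra.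
have := cos_le8 x0.
have -> : 1 - (11 / 7) ^+ 2 / 2 + (11 / 7) ^+ 4 / 24 - (11 / 7) ^+ 6 / 720
   + (11 / 7) ^+ 8 / (720 * 56) = 1 - 121 / 98 * (1 - 121 / 588 * (1 - 121 / 1470 * (1 - 121 / 2744))) :> R.
  set x := 11 / 7; have e : 121 / 49 = x ^+ 2 by rewrite /x; field.
  have -> : 121 / 98 = x ^+ 2 / 2 by rewrite -e; field.
  have -> : 121 / 588 = x ^+ 2 / 12 by rewrite -e; field.
  have -> : 121 / 1470 = x ^+ 2 / 30 by rewrite -e; field.
  have -> : 121 / 2744 = x ^+ 2 / 56 by rewrite -e; field.
  by move: (x) => z; field.
lra.
Qed.

(** The product of 22/7 and 111/1000: it bounds the angles pi eps_n. *)
Definition th0 : R := 1221 / 3500.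

Lemma th0_ge0 : 0 <= th0. Proof. by rewrite /th0; lra. Qed.

Lemma pi_eps_le (e : R) : `|e| <= 111 / 1000 -> `|pi * e| <= th0.
Proof.
move=> eL; rewrite normrM (gtr0_norm (pi_gt0 R)).
apply: (le_trans (ler_pM (pi_ge0 R) (normr_ge0 e) pi_le eL)).
by rewrite /th0; lra.
Qed.

Lemma sin_mono x y : 0 <= x -> x <= y -> y <= 1 -> sin x <= sin y.
Proof.
move=> x0 xy y1; have p1 := @pihalf_ge1 R.
rewrite leNgt ltr_sin ?in_itv/= -?leNgt//; apply/andP; split; lra.
Qed.

Lemma sin_norm x : `|x| <= 1 -> `|sin x| = sin `|x|.
Proof.
move=> x1; have p1 := @pihalf_ge1 R.
have key y : 0 <= y -> y <= 1 -> 0 <= sin y.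
  by move=> y0 y1; apply: sin_ge0_pi; rewrite y0/=; lra.
have [x0|x0] := leP 0 x.
  by rewrite (ger0_norm x0) ger0_norm// key// -(ger0_norm x0).
rewrite (ltr0_norm x0) sinN ler0_norm// -oppr_ge0 -sinN key//.
  by rewrite oppr_ge0 ltW.
by rewrite -(ltr0_norm x0).
Qed.

Lemma le_pow k x y : 0 <= x -> x <= y -> x ^+ k <= y ^+ k.
Proof. by move=> x0 xy; rewrite lerXn2r// nnegrE// (le_trans x0). Qed.

Lemma th0_le : th0 <= 2^-1. Proof. by rewrite /th0; lra. Qed.

Lemma th0_taylor5 : th0 - th0 ^+ 3 / 6 + th0 ^+ 5 / 120 <= 342 / 1000 :> R.
Proof. by rewrite /th0 !exprS expr0; lra. Qed.

Lemma th0_taylor5x2 :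
  th0 * 2 - (th0 * 2) ^+ 3 / 6 + (th0 * 2) ^+ 5 / 120 <= 644 / 1000 :> R.
Proof. by rewrite /th0 !exprS expr0; lra. Qed.

(** On [0, 1] the sine is increasing, so that its Taylor polynomial has only to
    be evaluated at th0. *)
Lemma sin2_bound x : `|x| <= th0 -> sin x ^+ 2 <= 117 / 1000.
Proof.
move=> xt; have t1 := th0_le.
rewrite -(real_normK (num_real (sin x))) sin_norm; last by lra.
have h : sin `|x| <= 342 / 1000 :> R.
  have := @sin_mono `|x| th0 (normr_ge0 x) xt; have := sin_le5 th0_ge0.
  have := th0_taylor5; lra.
have h0 : 0 <= sin `|x| by rewrite -sin_norm//; lra.
have : sin `|x| * sin `|x| <= 342 / 1000 * (342 / 1000).
  by apply: ler_pM.
rewrite expr2; lra.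
Qed.

Lemma sincosE x : sin x * cos x = sin (x * 2) / 2.
Proof. by rewrite mulr_natr sin_mulr2n -mulr_natr; field. Qed.

Lemma sincos_bound x : `|x| <= th0 -> `|sin x * cos x| <= 322 / 1000.
Proof.
move=> xt; have t1 := th0_le.
have e2 : `|x * 2| = `|x| * 2 by rewrite normrM (@ger0_norm _ 2).
have n1 : `|x * 2| <= 1 by rewrite e2; lra.
have h0 : 0 <= 2^-1 :> R by rewrite invr_ge0.
rewrite sincosE normrM (ger0_norm h0) (sin_norm n1) e2.
have := @sin_mono (`|x| * 2) (th0 * 2).
rewrite mulr_ge0// ler_pM2r// => /(_ isT xt) h1.
have t2 : 0 <= th0 * 2 by rewrite mulr_ge0// th0_ge0.
have := sin_le5 t2.
have := th0_taylor5x2; lra.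
Qed.

Lemma theta_sincos_bound x : `|x| <= th0 -> `|x - sin x * cos x| <= 29 / 1000.
Proof.
move=> xt.
have key y : 0 <= y -> y <= th0 -> `|y - sin y * cos y| <= 29 / 1000.
  move=> y0 yt; rewrite sincosE; have y2 : 0 <= y * 2 by rewrite mulr_ge0.
  have h1 := sin_le y2; have h2 := sin_ge3 y2.
  have h3 : (y * 2) ^+ 3 <= (th0 * 2) ^+ 3.
    by apply: le_pow y2 _; move: (th0) yt => t yt; lra.
  have h4 : (th0 * 2) ^+ 3 <= 34 / 100 :> R by rewrite /th0 exprS expr2; lra.
  have h5 := le_trans h3 h4; clear h3 h4 yt; move: (sin _) h1 h2 => a h1 h2; rewrite ger0_norm; lra.
have [x0|x0] := leP 0 x; first by apply: key => //; rewrite -(ger0_norm x0).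
have := key (- x); rewrite -(ltr0_norm x0) normr_ge0 xt => /(_ isT isT).
rewrite (ltr0_norm x0) sinN cosN mulNr -opprD normrN.
by [].
Qed.

(** The double angle reduces both products to sin 2y and cos 2y, with y = |x|; by
    their Taylor polynomials the quantity lies between
    -(y^2/2 + y^4/3 + 2 y^6/45) and y^2/2. *)
Lemma second_order_bound x : `|x| <= th0 ->
  `|x * (sin x * cos x) - x ^+ 2 / 2 - sin x ^+ 2| <= 67 / 1000.
Proof.
move=> xt.
have key y : 0 <= y -> y <= th0 ->
    `|y * (sin y * cos y) - y ^+ 2 / 2 - sin y ^+ 2| <= 67 / 1000.
  move=> y0 yt; have y2 : 0 <= y * 2 by rewrite mulr_ge0.
  have c2 : sin y ^+ 2 = (1 - cos (y * 2)) / 2.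
    have e : cos (y * 2) = (1 - sin y ^+ 2) * 2 - 1.
      by rewrite mulr_natr cos_mulr2n cos2sin2 mulr_natr.
    by rewrite e; move: (sin y) => z; field.
  have h1 := sin_le y2; have h2 := sin_ge3 y2; have h3 := cos_ge6 y2.
  have z0 := le_pow 2 y0 yt.
  have z1 := le_pow 4 y0 yt.
  have z2 := le_pow 6 y0 yt.
  have n2 : th0 ^+ 2 <= 61 / 500 :> R by rewrite /th0 expr2; lra.
  have n4 : th0 ^+ 4 <= 3 / 200 :> R.
    by rewrite /th0 3!exprS expr1; lra.
  have n6 : th0 ^+ 6 <= 1 / 500 :> R.
    by rewrite /th0 5!exprS expr1; lra.
  have p2 := sqr_ge0 y; have p4 := exprn_ge0 4 y0; have p6 := exprn_ge0 6 y0.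
  have w2 := le_trans z0 n2; have w4 := le_trans z1 n4; have w6 := le_trans z2 n6.
  clear z0 z1 z2 n2 n4 n6 yt.
  have u1 : y * sin (y * 2) <= 2 * y ^+ 2.
    apply: (le_trans (ler_wpM2l y0 h1)); by rewrite le_eqVlt; apply/orP; left; apply/eqP; ring.
  have u2 : 2 * y ^+ 2 - 4 / 3 * y ^+ 4 <= y * sin (y * 2).
    apply: le_trans (ler_wpM2l y0 h2).
    by rewrite le_eqVlt; apply/orP; left; apply/eqP; field.
  have u3 : 1 - 2 * y ^+ 2 + 2 / 3 * y ^+ 4 - 4 / 45 * y ^+ 6 <= cos (y * 2).
    apply: le_trans h3.
    by rewrite le_eqVlt; apply/orP; left; apply/eqP; field.
  have u4 := sqr_ge0 (sin y); rewrite c2 in u4.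
  rewrite sincosE c2 mulrA; clear h1 h2 h3 y2 c2.
  move: (y * sin _) u1 u2 (cos _) u3 u4 => a u1 u2 b u3 u4.
  move: (y ^+ 2) (y ^+ 4) (y ^+ 6) p2 p4 p6 w2 w4 w6 u1 u2 u3 => q2 q4 q6 p2 p4 p6 w2 w4 w6 u1 u2 u3.
  by clear -p2 p4 p6 w2 w4 w6 u1 u2 u3 u4; rewrite ler_norml; apply/andP; split; lra.
have [x0|x0] := leP 0 x; first by apply: key => //; rewrite -(ger0_norm x0).
have := key (- x); rewrite -(ltr0_norm x0) normr_ge0 xt => /(_ isT isT).
by rewrite (ltr0_norm x0) sinN cosN !mulNr mulrN opprK !sqrrN.
Qed.

(** The terms at least halve at each step, so that the partial sums become
    decreasing when twice the next term is added to them; the sum of six terms,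
    corrected in this way, is below 567/400. *)
Lemma exp_partial_le K : \sum_(k < K) th0 ^+ k / k`!%:R <= 567 / 400 :> R.
Proof.
have t0 := th0_ge0; have t1 := th0_le.
have pos k : 0 <= th0 ^+ k / k`!%:R :> R by rewrite divr_ge0 ?exprn_ge0.
pose f n : R := \sum_(k < n) th0 ^+ k / k`!%:R + 2 * (th0 ^+ n / n`!%:R).
have fS n : f n.+1 <= f n.
  rewrite /f big_ord_recr/= -addrA lerD2l exprS factS natrM invfM.
  have -> : th0 * th0 ^+ n * (n.+1%:R^-1 * n`!%:R^-1) = (th0 / n.+1%:R) * (th0 ^+ n / n`!%:R) by ring.
  have h : th0 / n.+1%:R <= 2^-1 :> R.
    rewrite ler_pdivrMr//; apply: (le_trans t1); rewrite ler_pMr//.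
    by rewrite ler1n.
  have := ler_wpM2r (pos n) h; have := pos n.
  set v := _ / n`!%:R; set w := _ / _ * v; lra.
have f6 n : f (n + 6)%N <= f 6%N.
  by elim: n => // n ih; rewrite addSn (le_trans (fS _)).
apply: (@le_trans _ _ (f (K + 6)%N)).
  rewrite /f big_split_ord/= -addrA lerDl.
  by apply: addr_ge0; [apply: sumr_ge0 => i _; exact: pos|apply: mulr_ge0 => //; exact: pos].
apply: (le_trans (f6 K)).
rewrite /f !big_ord_recr big_ord0/= !(factS, fact0)/=.
set v := (X in X <= _).
have -> : v = 1 + th0 + th0 ^+ 2 / 2 + th0 ^+ 3 / 6 + th0 ^+ 4 / 24 + th0 ^+ 5 / 120
   + th0 ^+ 6 / 360 by rewrite /v; field.
rewrite /th0 !exprS expr0; lra.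
Qed.

End NumericalBounds.

(** * Square summable sequences *)

Section SmallL2.
Context {R : realType}.
Implicit Types (a b : int -> R[i]) (J : seq int).

(** Finite lists of indices replace infinite sums: a bound uniform in the list is
    a bound for the norm of l^2(Z). *)
Definition l2 J a : R := Num.sqrt (\sum_(n <- J) cabs (a n) ^+ 2).

Lemma l2_ge0 J a : 0 <= l2 J a. Proof. exact: sqrtr_ge0. Qed.

Lemma l2_sqr J a : l2 J a ^+ 2 = \sum_(n <- J) cabs (a n) ^+ 2.
Proof. by rewrite sqr_sqrtr// sumr_ge0// => n _; exact: sqr_ge0. Qed.

Lemma l2_le_sqr J a M : 0 <= M -> \sum_(n <- J) cabs (a n) ^+ 2 <= M ^+ 2 -> l2 J a <= M.
Proof. by move=> M0; rewrite -l2_sqr ler_pXn2r// nnegrE ?l2_ge0. Qed.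

Lemma eq_l2 J a b : (forall n, a n = b n) -> l2 J a = l2 J b.
Proof. by move=> e; rewrite /l2; congr Num.sqrt; apply: eq_bigr => n _; rewrite e. Qed.

Lemma l2D J a b : l2 J (fun n => a n + b n) <= l2 J a + l2 J b.
Proof.
apply/ler_addgt0Pl => e e0; set p := l2 J a; set q := l2 J b.
have p0 : 0 < p + e / 2 by rewrite ltr_wpDl ?l2_ge0 ?divr_gt0.
have q0 : 0 < q + e / 2 by rewrite ltr_wpDl ?l2_ge0 ?divr_gt0.
have -> : e + (p + q) = (p + e / 2) + (q + e / 2) by field.
apply: l2_le_sqr; first by rewrite addr_ge0// ltW.
apply: (@le_trans _ _ (((p + e / 2) + (q + e / 2)) * ((p + e / 2) + (q + e / 2)))); last by rewrite expr2.
apply: (@le_trans _ _ (\sum_(n <- J) ((p + e / 2) + (q + e / 2)) *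
   (cabs (a n) ^+ 2 / (p + e / 2) + cabs (b n) ^+ 2 / (q + e / 2)))).
  by apply: ler_sum => n _; exact: cabs_sqrD.
rewrite -mulr_sumr ler_wpM2l//; first by rewrite addr_ge0// ltW.
rewrite big_split/= -!mulr_suml -!l2_sqr -/p -/q.
have key (r s : R) : 0 <= r -> r <= s -> 0 < s -> r ^+ 2 / s <= s.
  move=> r0 rs s0; rewrite ler_pdivrMr// -expr2 ler_pXn2r// nnegrE//; exact: ltW.
by rewrite lerD// key// ?l2_ge0// lerDl divr_ge0// ltW.
Qed.

Lemma l2_scale J a b M : 0 <= M -> (forall n, cabs (a n) <= M * cabs (b n)) ->
  l2 J a <= M * l2 J b.
Proof.
move=> M0 ab; apply: l2_le_sqr; first by rewrite mulr_ge0// l2_ge0.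
rewrite exprMn l2_sqr mulr_sumr ler_sum// => n _.
by rewrite -exprMn ler_pXn2r// ?nnegrE ?mulr_ge0 ?cabs_ge0.
Qed.

Lemma l2N J a : l2 J (fun n => - a n) = l2 J a.
Proof. by rewrite /l2; congr Num.sqrt; apply: eq_bigr => n _; rewrite cabsN. Qed.

Lemma l2_sup J a M : 0 <= M -> (forall n, cabs (a n) <= M) -> l2 J a <= (size J)%:R * M.
Proof.
move=> M0 aM; elim: J => [|n J ih] /=.
  by rewrite /l2 big_nil sqrtr0 mul0r.
apply: l2_le_sqr; first by rewrite mulr_ge0.
rewrite big_cons -l2_sqr -natr1 mulrDl mul1r.
have s0 : 0 <= (size J)%:R * M by rewrite mulr_ge0.
have h1 : cabs (a n) ^+ 2 <= M ^+ 2 by rewrite ler_pXn2r ?nnegrE ?cabs_ge0.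
have h2 : l2 J a ^+ 2 <= ((size J)%:R * M) ^+ 2 by rewrite ler_pXn2r ?nnegrE ?l2_ge0.
rewrite addrC sqrrD; apply: (le_trans (lerD h2 h1)).
by rewrite lerD2r lerDl mulrn_wge0// mulr_ge0.
Qed.

End SmallL2.

(** * Remainders of the exponential series *)

Section ExpRemainder.
Context {R : realType}.
Implicit Types (u : R) (m k : nat).

Definition expi_term k u : R[i] := 'i%C ^+ k * (u ^+ k / k`!%:R)%:C.

Definition expi_rem m u : R[i] := cis u - \sum_(k < m) expi_term k u.

Lemma cabs_expi_term k u : cabs (expi_term k u) = `|u| ^+ k / k`!%:R.
Proof.
rewrite /expi_term (@cabsM R) cabsR normrM normrX normfV normr_nat.
suff -> : cabs ('i%C ^+ k : R[i]) = 1 by rewrite mul1r.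
by elim: k => [|k ih]; rewrite ?expr0 ?cabs1// exprS (@cabsM R) cabsi ih mul1r.
Qed.

(** The even partial sums separate into the Taylor polynomials of cosine and
    sine, whose remainders alternate. *)
Lemma expi_partial_even m u :
  \sum_(k < m.*2) expi_term k u = (cosp m).[u] +i* (sinp m).[u].
Proof.
elim: m => [|m ih]; first by rewrite /cosp /sinp double0 !big_ord0 !horner0.
have ik : 'i%C ^+ (m.*2) = ((-1) ^+ m)%:C :> R[i].
  by rewrite -mul2n exprM sqr_i rmorphXn/= rmorphN1.
rewrite doubleS !big_ord_recr/= ih /expi_term exprS ik !horner_cosp !horner_sinp !big_ord_recr/=.
set t1 := u ^+ _ / _; set t2 := u ^+ _ / _.
have e1 : (-1) ^+ m / (m.*2)`!%:R * u ^+ m.*2 = (-1) ^+ m * t1 by rewrite /t1; ring.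
have e2 : (-1) ^+ m / (m.*2.+1)`!%:R * u ^+ m.*2.+1 = (-1) ^+ m * t2 by rewrite /t2; ring.
rewrite e1 e2; move: ((-1) ^+ m) => s.
by apply: complexE; rewrite !(cReD, cImD, cReM, cImM)/=; ring.
Qed.

(** Two consecutive partial sums of an alternating expansion enclose the value. *)
Lemma alternating_rem (F P : R) (t : R) m :
  0 <= (-1) ^+ m.+1 * (F - P) -> 0 <= (-1) ^+ m.+2 * (F - (P + (-1) ^+ m.+1 * t)) ->
  `|F - P| <= t.
Proof.
move=> h1; have -> : `|F - P| = (-1) ^+ m.+1 * (F - P).
  by rewrite -(ger0_norm h1) normrM normrX normrN1 expr1n mul1r.
have sq : (-1) ^+ m.+1 * (-1) ^+ m.+1 = 1 :> R by rewrite -exprMn mulN1r opprK expr1n.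
by rewrite [_ ^+ m.+2]exprS mulN1r mulNr oppr_ge0 opprD addrA mulrBr mulrA sq mul1r subr_le0.
Qed.

Lemma expi_rem_even m u : 0 <= u -> u <= 1 -> cabs (expi_rem m.+1.*2 u) <= 2 / m.+1%:R.
Proof.
move=> u0 u1; rewrite /expi_rem expi_partial_even (le_trans (cabs_le_ReIm _))//.
have small k : (m.+1 <= k)%N -> u ^+ k / k`!%:R <= m.+1%:R^-1.
  move=> mk; apply: (@le_trans _ _ (k`!%:R^-1)).
    by rewrite ler_piMl ?invr_ge0// exprn_ile1.
  rewrite lef_pV2 ?posrE ?ltr0n ?fact_gt0// ler_nat (leq_trans mk)//.
  by case: (k) => // j; rewrite factS leq_pmulr// fact_gt0.
have [c1 s1] := taylor_sin_cos m u0; have [c2 s2] := taylor_sin_cos m.+1 u0.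
have h1 : `|cos u - (cosp m.+1).[u]| <= u ^+ m.+1.*2 / (m.+1.*2)`!%:R.
  apply: (alternating_rem c1); move: c2; rewrite !horner_cosp [in X in X -> _]big_ord_recr/=.
  by rewrite -mulrA [_^-1 * _]mulrC.
have h2 : `|sin u - (sinp m.+1).[u]| <= u ^+ m.+1.*2.+1 / (m.+1.*2.+1)`!%:R.
  apply: (alternating_rem s1); move: s2; rewrite !horner_sinp [in X in X -> _]big_ord_recr/=.
  by rewrite -mulrA [_^-1 * _]mulrC.
have mm : (m.+1 <= m.+1.*2)%N by rewrite -addnn leq_addr.
have l1 := le_trans h1 (small _ mm); have l2 := le_trans h2 (small _ (leqW mm)).
rewrite cReD cImD cReN cImN/= (_ : 2 = 1 + 1)// mulrDl !mul1r; exact: lerD.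
Qed.

Lemma expi_rem_evenN m u : `|u| <= 1 -> cabs (expi_rem m.+1.*2 u) <= 2 / m.+1%:R.
Proof.
have [u0|u0] := leP 0 u; first by rewrite ger0_norm// => /expi_rem_even -/(_ m u0).
rewrite ltr0_norm// => u1.
suff -> : expi_rem m.+1.*2 u = (expi_rem m.+1.*2 (- u))^J.
  by rewrite cabsJ expi_rem_even// oppr_ge0 ltW.
rewrite /expi_rem cJD -cisN opprK; congr (_ + _).
rewrite -mulN1r -[X in X^J]mulN1r cJM cJ_sum; congr (_ * _).
  by apply: complexE; rewrite /= ?oppr0.
apply: eq_bigr => k _; rewrite /expi_term cJM cJR exprNn.
have -> : ('i%C ^+ k : R[i])^J = 'i%C ^+ k * ((-1) ^+ k)%:C.
  elim: (nat_of_ord k) => [|j ih]; first by rewrite !expr0 mul1r -[1]/(1%:C) cJR.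
  have i1 : ('i%C : R[i])^J = 'i%C * (-1)%:C by apply: complexE; rewrite ?cReM ?cImM/=; ring.
  by rewrite !exprS cJM ih i1 (rmorphM (real_complex R)); ring.
rewrite -!mulrA -!rmorphM/=; congr (_ * _%:C).
by rewrite !mulrA -exprMn mulN1r opprK expr1n mul1r.
Qed.

End ExpRemainder.

(** * Fourier coefficients of slowly modulated functions *)

Section OperatorBound.
Context {R : realType}.
Implicit Types (f psi : R -> R[i]) (g : R -> R[i]) (n : int) (J : seq int).

Local Notation I := (`[- (2^-1 : R), 2^-1]%classic).
Local Notation cf := (coef (2^-1 : R)).

Let half_gt0 : 0 < 2^-1 :> R. Proof. by rewrite invr_gt0. Qed.
Let mI : measurable I. Proof. exact: measurable_itv. Qed.

Lemma Bessel_half J psi : uniq J -> inL2 I psi -> l2 J (cf psi) <= nrm I psi.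
Proof.
move=> uJ pi; apply: l2_le_sqr; first exact: nrm_ge0.
by have := Bessel half_gt0 uJ pi; rewrite mulfV// mul1r.
Qed.

Lemma Parseval_half psi M : 0 <= M -> inL2 I psi ->
  (forall J, uniq J -> l2 J (cf psi) <= M) -> nrm I psi <= M.
Proof.
move=> M0 pi h; rewrite -(@ler_pXn2r _ 2)// ?nnegrE ?nrm_ge0//.
have := Parseval_le half_gt0 pi; rewrite mulfV// mul1r; apply => J uJ.
by rewrite -l2_sqr ler_pXn2r ?nnegrE ?l2_ge0// h.
Qed.

Lemma cabs_coef_half psi n : inL2 I psi -> cabs (cf psi n) <= nrm I psi.
Proof.
by move=> /(cabs_coef half_gt0 n); rewrite mulfV// sqrtr1 mulr1.
Qed.

Lemma inL2_mul g psi M : 0 <= M -> cmeas I g -> (forall s, I s -> cabs (g s) <= M) ->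
  inL2 I psi -> inL2 I (fun s => g s * psi s) /\ nrm I (fun s => g s * psi s) <= M * nrm I psi.
Proof.
move=> M0 mg gM pi; apply: (inL2_le mI M0 _ pi).
  by apply: cmeasM => //; case: pi.
by move=> s Is; rewrite (@cabsM R) ler_wpM2r ?cabs_ge0// gM.
Qed.

(** On the interval of length one the frequency is measured by sigma = 2 s, so
    that it stays in [-1, 1]. *)
Lemma sigma_le1 (s : R) : I s -> `|2 * s| <= 1.
Proof.
by rewrite /= in_itv/= => /andP[a b]; rewrite ler_norml; apply/andP; split; lra.
Qed.

Lemma inL2_poly k psi : inL2 I psi ->
  inL2 I (fun s => ((2 * s) ^+ k)%:C * psi s) /\
  nrm I (fun s => ((2 * s) ^+ k)%:C * psi s) <= nrm I psi.
Proof.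
move=> pi; rewrite -[X in _ /\ _ <= X]mul1r; apply: inL2_mul => //.
  by apply: cmeasR; apply: measurable_funX; apply: measurable_funM => //.
by move=> s Is; rewrite cabsR normrX exprn_ile1// sigma_le1.
Qed.

Lemma inL2_cis_lin (t : R) psi : inL2 I psi ->
  inL2 I (fun s => cis (t * (2 * s)) * psi s).
Proof.
move=> pi; apply: (proj1 (@inL2_mul _ psi 1 _ _ _ pi)) => //; last by move=> s _; rewrite cabs_cis.
by apply: cmeas_cis; apply: measurable_funM => //; apply: measurable_funM.
Qed.

Lemma expi_term_sigma k (t s : R) :
  expi_term k (t * (2 * s)) = expi_term k t * ((2 * s) ^+ k)%:C.
Proof.
rewrite /expi_term exprMn -mulrA -(rmorphM (real_complex R)); congr (_ * _%:C); ring.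
Qed.

Lemma inL2_expi_term k t psi : inL2 I psi ->
  inL2 I (fun s => expi_term k (t * (2 * s)) * psi s).
Proof.
move=> pi; have [h _] := inL2_poly k pi.
have := inL2Z (expi_term k t) mI h; apply: eq_inL2 => s _.
by rewrite expi_term_sigma mulrA.
Qed.

Lemma inL2_expi_rem m t psi : inL2 I psi ->
  inL2 I (fun s => expi_rem m (t * (2 * s)) * psi s).
Proof.
move=> pi; have h1 := inL2_cis_lin t pi.
have h2 : inL2 I (fun s => \sum_(k < m) expi_term k (t * (2 * s)) * psi s).
  by apply: inL2_sum => // k; exact: inL2_expi_term.
have := inL2B mI h1 h2; apply: eq_inL2 => s _.
by rewrite /expi_rem mulrBl mulr_suml.
Qed.

Section Estimate.
Variables (th : int -> R) (psi : R -> R[i]) (J : seq int).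
Hypotheses (thl : forall n, `|th n| <= th0) (psii : inL2 I psi) (uJ : uniq J).

Lemma l2_expi_term k :
  l2 J (fun n => cf (fun s => expi_term k (th n * (2 * s)) * psi s) n) <=
  th0 ^+ k / k`!%:R * nrm I psi.
Proof.
have [h hn] := inL2_poly k psii.
have k0 : 0 <= th0 ^+ k / k`!%:R :> R by rewrite divr_ge0// exprn_ge0// th0_ge0.
apply: (@le_trans _ _ (th0 ^+ k / k`!%:R * l2 J (cf (fun s => ((2 * s) ^+ k)%:C * psi s)))).
  apply: l2_scale => // n.
  rewrite (@eq_coef _ _ _ (fun s => expi_term k (th n) * (((2 * s) ^+ k)%:C * psi s))); last first.
    by move=> s _; rewrite expi_term_sigma mulrA.
  rewrite (coefZ half_gt0 _ _ h) (@cabsM R) cabs_expi_term ler_wpM2r ?cabs_ge0//.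
  by rewrite ler_pM2r ?invr_gt0 ?ltr0n ?fact_gt0// le_pow.
apply: ler_wpM2l => //; exact: le_trans (Bessel_half uJ h) hn.
Qed.

(** Passing from the remainder of order m to the next one costs the m-th term. *)
Lemma expi_rem_step m d :
  l2 J (fun n => cf (fun s => expi_rem m (th n * (2 * s)) * psi s) n) +
    \sum_(k < m) th0 ^+ k / k`!%:R * nrm I psi <=
  l2 J (fun n => cf (fun s => expi_rem (m + d) (th n * (2 * s)) * psi s) n) +
    \sum_(k < m + d) th0 ^+ k / k`!%:R * nrm I psi.
Proof.
elim: d => [|d ih]; first by rewrite addn0.
apply: (le_trans ih); rewrite addnS big_ord_recr/= addrA [leRHS]addrAC lerD2r.
apply: le_trans (lerD (lexx _) (l2_expi_term (m + d)%N)).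
apply: le_trans (l2D _ _ _); rewrite le_eqVlt; apply/orP; left; apply/eqP.
apply: eq_l2 => n.
rewrite -(coefD half_gt0 n (inL2_expi_rem (m + d).+1 (th n) psii) (inL2_expi_term (m + d) (th n) psii)).
apply: eq_coef => s _; rewrite /expi_rem big_ord_recr/=; ring.
Qed.

(** Expanding e^(i theta_n sigma) in powers of sigma decouples the sample index
    n from the frequency: the k-th term is theta_n^k times a Fourier coefficient
    of sigma^k psi, which Bessel's inequality controls. *)
Lemma expi_rem_bound m :
  l2 J (fun n => cf (fun s => expi_rem m (th n * (2 * s)) * psi s) n) <=
  (567 / 400 - \sum_(k < m) th0 ^+ k / k`!%:R) * nrm I psi.
Proof.
rewrite mulrBl lerBrDr mulr_suml; apply/ler_addgt0Pl => e e0.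
set C := (size J)%:R * (2 * nrm I psi).
have C0 : 0 <= C by rewrite mulr_ge0// mulr_ge0// nrm_ge0.
have [N /ltW CN] : exists N, C / e < N.+1%:R.
  exists (Num.truncn (C / e)); exact: truncnS_gt.
set M := (m + N)%N.
have mM : (m <= M.+1.*2)%N by rewrite -addnn (leq_trans _ (leq_addr _ _))// leqW// leq_addr.
have := expi_rem_step m (M.+1.*2 - m); rewrite subnKC// => /le_trans; apply.
apply: lerD; last first.
  by rewrite -mulr_suml ler_wpM2r ?nrm_ge0// exp_partial_le.
have small n : cabs (cf (fun s => expi_rem M.+1.*2 (th n * (2 * s)) * psi s) n)
    <= 2 / M.+1%:R * nrm I psi.
  apply: (le_trans (cabs_coef_half n (inL2_expi_rem _ _ psii))).
  apply: (proj2 (inL2_le mI _ _ psii _)).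
  - by rewrite divr_ge0.
  - by case: (inL2_expi_rem M.+1.*2 (th n) psii).
  move=> s Is; rewrite (@cabsM R) ler_wpM2r ?cabs_ge0// expi_rem_evenN//.
  rewrite normrM (le_trans (ler_pM _ _ (thl n) (sigma_le1 Is)))// mulr1.
  by rewrite (le_trans th0_le)// invf_le1// ler1n.
apply: (le_trans (l2_sup _ _ small)); first by rewrite mulr_ge0 ?divr_ge0 ?nrm_ge0.
have -> : (size J)%:R * (2 / M.+1%:R * nrm I psi) = C / M.+1%:R by rewrite /C; ring.
rewrite ler_pdivrMr ?ltr0n// mulrC -ler_pdivrMr//; apply: (le_trans CN).
by rewrite ler_nat ltnS leq_addl.
Qed.

End Estimate.
End OperatorBound.

(** * The matrix of symbols *)

Section SymbolBounds.
Context {R : realType}.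
Implicit Types (f psi A B : R -> R[i]) (g h : int -> R -> R[i]) (n : int) (J : seq int).

Local Notation I := (`[- (2^-1 : R), 2^-1]%classic).
Local Notation cf := (coef (2^-1 : R)).

Let half_gt0 : 0 < 2^-1 :> R. Proof. by rewrite invr_gt0. Qed.
Let mI : measurable I. Proof. exact: measurable_itv. Qed.

(** The symbol g defines the operator from L^2(I) to l^2(Z) sending psi to the
    sequence of the n-th Fourier coefficients of g_n psi; this says that its
    norm is at most K. *)
Definition symbol_le g (K : R) := forall psi, inL2 I psi ->
  (forall n, inL2 I (fun s => g n s * psi s)) /\
  forall J, uniq J -> l2 J (fun n => cf (fun s => g n s * psi s) n) <= K * nrm I psi.

Lemma symbol_eq g h K : (forall n s, g n s = h n s) -> symbol_le g K -> symbol_le h K.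
Proof.
move=> e gK psi pi; have [h1 h2] := gK psi pi; split=> [n|J uJ].
  by apply: eq_inL2 (h1 n) => s _; rewrite e.
apply: le_trans (h2 J uJ); rewrite le_eqVlt; apply/orP; left; apply/eqP.
by apply: eq_l2 => n; apply: eq_coef => s _; rewrite e.
Qed.

Lemma symbolW g K K' : K <= K' -> symbol_le g K -> symbol_le g K'.
Proof.
move=> KK gK psi pi; have [h1 h2] := gK psi pi; split=> // J uJ.
by apply: (le_trans (h2 J uJ)); rewrite ler_wpM2r// nrm_ge0.
Qed.

Lemma symbolD g h K K' : symbol_le g K -> symbol_le h K' ->
  symbol_le (fun n s => g n s + h n s) (K + K').
Proof.
move=> gK hK psi pi; have [g1 g2] := gK psi pi; have [h1 h2] := hK psi pi.
split=> [n|J uJ].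
  by apply: eq_inL2 (inL2D mI (g1 n) (h1 n)) => s _; rewrite mulrDl.
rewrite mulrDl; apply: le_trans (lerD (g2 J uJ) (h2 J uJ)).
apply: le_trans (l2D _ _ _); rewrite le_eqVlt; apply/orP; left; apply/eqP.
apply: eq_l2 => n; rewrite -(coefD half_gt0 n (g1 n) (h1 n)).
by apply: eq_coef => s _; rewrite mulrDl.
Qed.

Lemma symbolZ (a : int -> R[i]) M g K : (forall n, cabs (a n) <= M) ->
  symbol_le g K -> symbol_le (fun n s => a n * g n s) (M * K).
Proof.
move=> aM gK psi pi; have [g1 g2] := gK psi pi.
have M0 : 0 <= M by exact: le_trans (cabs_ge0 (a 0)) (aM 0).
split=> [n|J uJ].
  by apply: eq_inL2 (inL2Z (a n) mI (g1 n)) => s _; rewrite mulrA.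
rewrite -mulrA; apply: le_trans (ler_wpM2l M0 (g2 J uJ)).
apply: l2_scale => // n.
rewrite (@eq_coef _ _ _ (fun s => a n * (g n s * psi s))); last by move=> s _; rewrite mulrA.
by rewrite (coefZ half_gt0 _ _ (g1 n)) (@cabsM R) ler_wpM2r ?cabs_ge0.
Qed.

Lemma symbolX k g K : 0 <= K -> symbol_le g K ->
  symbol_le (fun n s => g n s * ((2 * s) ^+ k)%:C) K.
Proof.
move=> K0 gK psi pi; have [p1 p2] := inL2_poly k pi; have [g1 g2] := gK _ p1.
split=> [n|J uJ]; first by apply: eq_inL2 (g1 n) => s _; rewrite mulrA.
apply: le_trans (ler_wpM2l K0 p2); apply: le_trans (g2 J uJ).
rewrite le_eqVlt; apply/orP; left; apply/eqP.
by apply: eq_l2 => n; apply: eq_coef => s _; rewrite mulrA.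
Qed.

Lemma symbol1 : symbol_le (fun _ _ => 1) 1.
Proof.
move=> psi pi; split=> [n|J uJ]; first by apply: eq_inL2 pi => s _; rewrite mul1r.
rewrite mul1r; apply: le_trans (Bessel_half uJ pi).
rewrite le_eqVlt; apply/orP; left; apply/eqP.
by apply: eq_l2 => n; apply: eq_coef => s _; rewrite mul1r.
Qed.

Variable th : int -> R.
Hypothesis thl : forall n, `|th n| <= th0.

Lemma symbol_rem m :
  symbol_le (fun n s => expi_rem m (th n * (2 * s))) (567 / 400 - \sum_(k < m) th0 ^+ k / k`!%:R).
Proof.
move=> psi pi; split=> [n|J uJ]; first exact: inL2_expi_rem.
exact: expi_rem_bound.
Qed.

Local Notation r0 := (567 / 400 : R).
Local Notation r1 := (567 / 400 - 1 : R).
Local Notation r2 := (567 / 400 - 1 - th0 : R).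
Local Notation r3 := (567 / 400 - 1 - th0 - th0 ^+ 2 / 2 : R).

Lemma symbol_rem0123 :
  [/\ symbol_le (fun n s => expi_rem 0 (th n * (2 * s))) r0,
      symbol_le (fun n s => expi_rem 1 (th n * (2 * s))) r1,
      symbol_le (fun n s => expi_rem 2 (th n * (2 * s))) r2 &
      symbol_le (fun n s => expi_rem 3 (th n * (2 * s))) r3].
Proof.
have e0 : th0 ^+ 0 / 0`!%:R = 1 :> R by rewrite expr0 fact0 divr1.
have e1 : th0 ^+ 1 / 1`!%:R = th0 :> R by rewrite expr1 divr1.
have e2 : th0 ^+ 2 / 2`!%:R = th0 ^+ 2 / 2 :> R by [].
have s0 := symbol_rem 0; have s1 := symbol_rem 1; have s2 := symbol_rem 2; have s3 := symbol_rem 3.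
move: s0 s1 s2 s3; rewrite !big_ord_recr !big_ord0/= e0 e1 e2 subr0 !add0r !opprD !addrA.
by [].
Qed.

Lemma expi_rem0 u : expi_rem 0 u = cis u :> R[i].
Proof. by rewrite /expi_rem big_ord0 subr0. Qed.

Lemma expi_remS m u : expi_rem m.+1 u = expi_rem m u - expi_term m u :> R[i].
Proof. by rewrite /expi_rem big_ord_recr/= opprD addrA. Qed.

Let i2 : 'i%C * 'i%C = -1 :> R[i]. Proof. by rewrite -expr2 sqr_i. Qed.

(** The entries of the matrix that maps (A, B) to the rotated data at a node
    displaced by t / pi, relative to the harmonic of the undisplaced node: it is
    the identity for t = 0, and is found by expanding the two products in
    dataX_glue and dataY_glue below. *)
Definition m11 t s : R[i] := cis (t * (2 * s)) *
  (1 - ((2 * s) ^+ 2 * sin t ^+ 2)%:C - 'i%C * (2 * s * (sin t * cos t))%:C).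
Definition m12 t s : R[i] := cis (t * (2 * s)) * (2 * s * sin t ^+ 2)%:C.
Definition m21 t s : R[i] := cis (t * (2 * s)) *
  (- (2 * s * sin t ^+ 2)%:C - 'i%C * ((2 * s) ^+ 2 * (sin t * cos t))%:C).
Definition m22 t s : R[i] := cis (t * (2 * s)) * (1 + 'i%C * (2 * s * (sin t * cos t))%:C).

(** The first-order term i t sigma of the exponential almost cancels against
    i sigma sin t cos t, and the second-order terms combine likewise. Estimating
    the two differences, rather than their terms, keeps the norm below 0.175. *)
Lemma m11_decomp t s : m11 t s - 1 =
  expi_rem 3 (t * (2 * s))
  + (- 'i%C * (sin t * cos t)%:C) * (expi_rem 2 (t * (2 * s)) * ((2 * s) ^+ 1)%:C)
  + (- (sin t ^+ 2)%:C) * (expi_rem 1 (t * (2 * s)) * ((2 * s) ^+ 2)%:C)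
  + ('i%C * (t - sin t * cos t)%:C) * (1 * ((2 * s) ^+ 1)%:C)
  + (t * (sin t * cos t) - t ^+ 2 / 2 - sin t ^+ 2)%:C * (1 * ((2 * s) ^+ 2)%:C).
Proof.
rewrite !expi_remS expi_rem0 /expi_term /m11 !fact0 factS fact0.
have -> : (2`! = 2)%N by [].
move: (cis (t * (2 * s))) (sin t) (cos t) (2 * s) => z a b c.
rewrite !expr0 !expr1 !divr1 ['i%C ^+ 2]expr2 i2.
by apply: complexE; rewrite !(cReD, cImD, cReN, cImN, cReM, cImM)/=; field.
Qed.

Lemma m12_decomp t s : m12 t s =
  (sin t ^+ 2)%:C * (expi_rem 0 (t * (2 * s)) * ((2 * s) ^+ 1)%:C).
Proof.
rewrite expi_rem0 /m12; move: (cis (t * (2 * s))) (sin t) (2 * s) => z a c.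
by apply: complexE; rewrite !(cReD, cImD, cReN, cImN, cReM, cImM)/=; ring.
Qed.

Lemma m21_decomp t s : m21 t s =
  (- (sin t ^+ 2)%:C) * (expi_rem 0 (t * (2 * s)) * ((2 * s) ^+ 1)%:C) +
  (- 'i%C * (sin t * cos t)%:C) * (expi_rem 0 (t * (2 * s)) * ((2 * s) ^+ 2)%:C).
Proof.
rewrite expi_rem0 /m21; move: (cis (t * (2 * s))) (sin t) (cos t) (2 * s) => z a b c.
by apply: complexE; rewrite !(cReD, cImD, cReN, cImN, cReM, cImM)/=; ring.
Qed.

Lemma m22_decomp t s : m22 t s - 1 =
  expi_rem 1 (t * (2 * s)) +
  ('i%C * (sin t * cos t)%:C) * (expi_rem 0 (t * (2 * s)) * ((2 * s) ^+ 1)%:C).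
Proof.
rewrite expi_remS expi_rem0 /m22 /expi_term; move: (cis (t * (2 * s))) (sin t) (cos t) (2 * s) => z a b c.
rewrite !expr0 expr1 fact0 divr1.
by apply: complexE; rewrite !(cReD, cImD, cReN, cImN, cReM, cImM)/=; ring.
Qed.

Let iR (x : R) : cabs ('i%C * x%:C) = `|x|.
Proof. by rewrite (@cabsM R) cabsi mul1r cabsR. Qed.
Let NiR (x : R) : cabs (- 'i%C * x%:C) = `|x|.
Proof. by rewrite mulNr cabsN iR. Qed.

Let sc n : `|sin (th n) * cos (th n)| <= 322 / 1000. Proof. exact: sincos_bound. Qed.
Let s2 n : `|sin (th n) ^+ 2| <= 117 / 1000.
Proof. by rewrite ger0_norm ?sqr_ge0//; exact: sin2_bound. Qed.

Let r0_ge0 : 0 <= r0. Proof. lra. Qed.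
Let r1_ge0 : 0 <= r1. Proof. lra. Qed.
Let r2_ge0 : 0 <= r2. Proof. rewrite /th0; lra. Qed.

Lemma symbol11 : symbol_le (fun n s => m11 (th n) s - 1) (1748 / 10000).
Proof.
have [_ S1 S2 S3] := symbol_rem0123.
apply: (symbol_eq (fun n s => esym (m11_decomp (th n) s))).
apply: (@symbolW _ (r3 + 322 / 1000 * r2 + 117 / 1000 * r1 + 29 / 1000 * 1 + 67 / 1000 * 1)).
  by rewrite /th0 expr2; lra.
apply: symbolD; last first.
  apply: symbolZ; last exact: symbolX symbol1.
  by move=> n; rewrite cabsR second_order_bound.
apply: symbolD; last first.
  apply: symbolZ; last exact: symbolX symbol1.
  by move=> n; rewrite iR theta_sincos_bound.
apply: symbolD; last first.
  by apply: symbolZ; [move=> n; rewrite cabsN cabsR|exact: symbolX].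
apply: symbolD => //.
by apply: symbolZ; [move=> n; rewrite NiR|exact: symbolX].
Qed.

Lemma symbol12 : symbol_le (fun n s => m12 (th n) s) (1659 / 10000).
Proof.
have [S0 _ _ _] := symbol_rem0123.
apply: (symbol_eq (fun n s => esym (m12_decomp (th n) s))).
apply: (@symbolW _ (117 / 1000 * r0)); first lra.
by apply: symbolZ; [move=> n; rewrite cabsR|exact: symbolX].
Qed.

Lemma symbol21 : symbol_le (fun n s => m21 (th n) s) (6223 / 10000).
Proof.
have [S0 _ _ _] := symbol_rem0123.
apply: (symbol_eq (fun n s => esym (m21_decomp (th n) s))).
apply: (@symbolW _ (117 / 1000 * r0 + 322 / 1000 * r0)); first lra.
apply: symbolD; apply: symbolZ; try exact: symbolX.
  by move=> n; rewrite cabsN cabsR.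
by move=> n; rewrite NiR.
Qed.

Lemma symbol22 : symbol_le (fun n s => m22 (th n) s - 1) (874 / 1000).
Proof.
have [S0 S1 _ _] := symbol_rem0123.
apply: (symbol_eq (fun n s => esym (m22_decomp (th n) s))).
apply: (@symbolW _ (r1 + 322 / 1000 * r0)); first lra.
apply: symbolD => //; apply: symbolZ; try exact: symbolX.
by move=> n; rewrite iR.
Qed.

End SymbolBounds.

(** * The perturbation argument *)

Section RowBounds.
Context {R : realType}.
Implicit Types a b x y p q : R.

Lemma rowX_ge0 a b : 0 <= a -> 0 <= b -> 0 <= 1748 / 10000 * a + 1659 / 10000 * b.
Proof. by move=> a0 b0; lra. Qed.

Lemma rowY_ge0 a b : 0 <= a -> 0 <= b -> 0 <= 6223 / 10000 * a + 874 / 1000 * b.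
Proof. by move=> a0 b0; lra. Qed.

(** The weight 53/40 equilibrates the two rows: it nearly is an eigenvector of
    the matrix of the four bounds, whose spectral radius is just below 1. *)
Lemma weighted_contraction a b : 0 <= a -> 0 <= b ->
  (1748 / 10000 * a + 1659 / 10000 * b) + 53 / 40 * (6223 / 10000 * a + 874 / 1000 * b) <=
  1999 / 2000 * (a + 53 / 40 * b).
Proof. by move=> a0 b0; lra. Qed.

(** The factor 2000 is 1 / (1 - 1999/2000). *)
Lemma weighted_absorb a b p q : 0 <= a -> 0 <= b ->
  a <= p + (1748 / 10000 * a + 1659 / 10000 * b) ->
  b <= q + (6223 / 10000 * a + 874 / 1000 * b) ->
  a + 53 / 40 * b <= 2000 * (p + 53 / 40 * q).
Proof. by move=> a0 b0 ha hb; lra. Qed.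

Lemma rowX_le a b x : 0 <= a -> 0 <= b -> x <= 1748 / 10000 * a + 1659 / 10000 * b + a ->
  x <= 2 * (a + b).
Proof. by move=> a0 b0; lra. Qed.

Lemma rowY_le a b x : 0 <= a -> 0 <= b -> x <= 6223 / 10000 * a + 874 / 1000 * b + b ->
  x <= 2 * (a + b).
Proof. by move=> a0 b0; lra. Qed.

Lemma rows_le_add a b : 0 <= a -> 0 <= b ->
  1748 / 10000 * a + 1659 / 10000 * b <= a + b /\ 6223 / 10000 * a + 874 / 1000 * b <= a + b.
Proof. by move=> a0 b0; split; lra. Qed.

End RowBounds.

Section Perturbation.
Context {R : realType}.
Implicit Types (f psi A B : R -> R[i]) (n : int) (J : seq int).

Local Notation I := (`[- (2^-1 : R), 2^-1]%classic).
Local Notation cf := (coef (2^-1 : R)).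

Let half_gt0 : 0 < 2^-1 :> R. Proof. by rewrite invr_gt0. Qed.
Let mI : measurable I. Proof. exact: measurable_itv. Qed.

Variable th : int -> R.
Hypothesis thl : forall n, `|th n| <= th0.

(** The two components of the data; they are compared to the Fourier coefficients
    of A and of B respectively. *)
Definition dataX A B n : R[i] :=
  cf (fun s => m11 (th n) s * A s) n + cf (fun s => m12 (th n) s * B s) n.
Definition dataY A B n : R[i] :=
  cf (fun s => m21 (th n) s * A s) n + cf (fun s => m22 (th n) s * B s) n.

Local Notation errX := (fun A B n => dataX A B n - cf A n).
Local Notation errY := (fun A B n => dataY A B n - cf B n).

Let inL2_of1 g psi : inL2 I psi -> inL2 I (fun s => (g s - 1) * psi s) ->
  inL2 I (fun s => g s * psi s).
Proof.
move=> h1 h2; apply: eq_inL2 (inL2D mI h1 h2) => s _; ring.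
Qed.

Let coef_of1 g psi n : inL2 I psi -> inL2 I (fun s => (g s - 1) * psi s) ->
  cf (fun s => g s * psi s) n = cf psi n + cf (fun s => (g s - 1) * psi s) n.
Proof.
move=> h1 h2; rewrite -(coefD half_gt0 n h1 h2); apply: eq_coef => s _; ring.
Qed.

Lemma inL2_m11 n A : inL2 I A -> inL2 I (fun s => m11 (th n) s * A s).
Proof. by move=> Ai; have [h _] := symbol11 thl Ai; exact: inL2_of1. Qed.
Lemma inL2_m12 n A : inL2 I A -> inL2 I (fun s => m12 (th n) s * A s).
Proof. by move=> Ai; have [h _] := symbol12 thl Ai. Qed.
Lemma inL2_m21 n A : inL2 I A -> inL2 I (fun s => m21 (th n) s * A s).
Proof. by move=> Ai; have [h _] := symbol21 thl Ai. Qed.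
Lemma inL2_m22 n A : inL2 I A -> inL2 I (fun s => m22 (th n) s * A s).
Proof. by move=> Ai; have [h _] := symbol22 thl Ai; exact: inL2_of1. Qed.

Let coefMB g n A A' : inL2 I (fun s => g s * A s) -> inL2 I (fun s => g s * A' s) ->
  cf (fun s => g s * (A s - A' s)) n = cf (fun s => g s * A s) n - cf (fun s => g s * A' s) n.
Proof.
by move=> h h'; rewrite -(coefB half_gt0 n h h'); apply: eq_coef => s _; rewrite mulrBr.
Qed.

Lemma dataXB A A' B B' n : inL2 I A -> inL2 I A' -> inL2 I B -> inL2 I B' ->
  dataX (fun s => A s - A' s) (fun s => B s - B' s) n = dataX A B n - dataX A' B' n.
Proof.
move=> h1 h2 h3 h4; rewrite /dataX (coefMB _ (inL2_m11 n h1) (inL2_m11 n h2)).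
by rewrite (coefMB _ (inL2_m12 n h3) (inL2_m12 n h4)) opprD addrACA.
Qed.

Lemma dataYB A A' B B' n : inL2 I A -> inL2 I A' -> inL2 I B -> inL2 I B' ->
  dataY (fun s => A s - A' s) (fun s => B s - B' s) n = dataY A B n - dataY A' B' n.
Proof.
move=> h1 h2 h3 h4; rewrite /dataY (coefMB _ (inL2_m21 n h1) (inL2_m21 n h2)).
by rewrite (coefMB _ (inL2_m22 n h3) (inL2_m22 n h4)) opprD addrACA.
Qed.

Let sum3_sub1 (x y z : R[i]) : y + z = x + y + z - x. Proof. by ring. Qed.
Let sum3_sub2 (x y z : R[i]) : y + z = y + (x + z) - x. Proof. by ring. Qed.

Lemma errX_le A B J : uniq J -> inL2 I A -> inL2 I B ->
  l2 J (errX A B) <= 1748 / 10000 * nrm I A + 1659 / 10000 * nrm I B.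
Proof.
move=> uJ Ai Bi; have [a1 a2] := symbol11 thl Ai; have [b1 b2] := symbol12 thl Bi.
apply: le_trans (lerD (a2 J uJ) (b2 J uJ)); apply: le_trans (l2D _ _ _).
rewrite le_eqVlt; apply/orP; left; apply/eqP; apply: eq_l2 => n.
rewrite /= /dataX (coef_of1 n Ai (a1 n)); move: (cf A n) => z; exact: (esym (sum3_sub1 _ _ _)).
Qed.

Lemma errY_le A B J : uniq J -> inL2 I A -> inL2 I B ->
  l2 J (errY A B) <= 6223 / 10000 * nrm I A + 874 / 1000 * nrm I B.
Proof.
move=> uJ Ai Bi; have [a1 a2] := symbol21 thl Ai; have [b1 b2] := symbol22 thl Bi.
apply: le_trans (lerD (a2 J uJ) (b2 J uJ)); apply: le_trans (l2D _ _ _).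
rewrite le_eqVlt; apply/orP; left; apply/eqP; apply: eq_l2 => n.
rewrite /= /dataY (coef_of1 n Bi (b1 n)); move: (cf B n) => z; exact: (esym (sum3_sub2 _ _ _)).
Qed.

Local Notation w := (53 / 40 : R).
Local Notation rho := (1999 / 2000 : R).

(** By Parseval the norms of A and B are those of their coefficients, which
    differ from the data by a contraction that is absorbed on the left. *)
Lemma data_lower A B (p q : R) : 0 <= p -> 0 <= q -> inL2 I A -> inL2 I B ->
  (forall J, uniq J -> l2 J (dataX A B) <= p) ->
  (forall J, uniq J -> l2 J (dataY A B) <= q) ->
  nrm I A + w * nrm I B <= 2000 * (p + w * q).
Proof.
move=> p0 q0 Ai Bi hX hY.
have a0 := nrm_ge0 I A; have b0 := nrm_ge0 I B.
have ha : nrm I A <= p + (1748 / 10000 * nrm I A + 1659 / 10000 * nrm I B).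
  apply: Parseval_half; [|by []|move=> J uJ].
    exact: (addr_ge0 p0 (rowX_ge0 a0 b0)).
  apply: le_trans (lerD (hX J uJ) (errX_le uJ Ai Bi)).
  rewrite -[X in _ <= _ + X]l2N; apply: le_trans (l2D _ _ _).
  by rewrite le_eqVlt; apply/orP; left; apply/eqP; apply: eq_l2 => n; rewrite opprB addrC subrK.
have hb : nrm I B <= q + (6223 / 10000 * nrm I A + 874 / 1000 * nrm I B).
  apply: Parseval_half; [|by []|move=> J uJ].
    exact: (addr_ge0 q0 (rowY_ge0 a0 b0)).
  apply: le_trans (lerD (hY J uJ) (errY_le uJ Ai Bi)).
  rewrite -[X in _ <= _ + X]l2N; apply: le_trans (l2D _ _ _).
  by rewrite le_eqVlt; apply/orP; left; apply/eqP; apply: eq_l2 => n; rewrite opprB addrC subrK.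
exact: weighted_absorb.
Qed.

Lemma data_upper A B J : uniq J -> inL2 I A -> inL2 I B ->
  l2 J (dataX A B) <= 2 * (nrm I A + nrm I B) /\ l2 J (dataY A B) <= 2 * (nrm I A + nrm I B).
Proof.
move=> uJ Ai Bi; have a0 := nrm_ge0 I A; have b0 := nrm_ge0 I B.
have h1 := errX_le uJ Ai Bi; have h2 := errY_le uJ Ai Bi.
have h3 := Bessel_half uJ Ai; have h4 := Bessel_half uJ Bi.
have h5 : l2 J (dataX A B) <= l2 J (errX A B) + l2 J (cf A).
  apply: le_trans (l2D _ _ _); rewrite le_eqVlt; apply/orP; left; apply/eqP.
  by apply: eq_l2 => n; rewrite subrK.
have h6 : l2 J (dataY A B) <= l2 J (errY A B) + l2 J (cf B).
  apply: le_trans (l2D _ _ _); rewrite le_eqVlt; apply/orP; left; apply/eqP.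
  by apply: eq_l2 => n; rewrite subrK.
split.
  exact: (rowX_le a0 b0 (le_trans h5 (lerD h1 h3))).
exact: (rowY_le a0 b0 (le_trans h6 (lerD h2 h4))).
Qed.

End Perturbation.

(** * Interpolation by a contraction *)

Section Interpolation.
Context {R : realType}.
Implicit Types (f psi A B : R -> R[i]) (n : int) (J : seq int).

Local Notation I := (`[- (2^-1 : R), 2^-1]%classic).
Local Notation cf := (coef (2^-1 : R)).

Let half_gt0 : 0 < 2^-1 :> R. Proof. by rewrite invr_gt0. Qed.
Let mI : measurable I. Proof. exact: measurable_itv. Qed.

Variable th : int -> R.
Hypothesis thl : forall n, `|th n| <= th0.
Local Notation X := (dataX th).
Local Notation Y := (dataY th).
Local Notation w := (53 / 40 : R).
Local Notation rho := (1999 / 2000 : R).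

Lemma riesz_fischer_l2 (a : int -> R[i]) M : 0 <= M ->
  (forall J, uniq J -> l2 J a <= M) -> exists2 v, inL2 I v & forall n, cf v n = a n.
Proof.
move=> M0 h; have [J uJ|v [v1 v2 _]] := riesz_fischer half_gt0 (a := a) (M := M ^+ 2); last by exists v.
by rewrite -l2_sqr ler_pXn2r ?nnegrE ?l2_ge0// h.
Qed.

Variables (a b : int -> R[i]) (p q : R).
Hypotheses (p0 : 0 <= p) (q0 : 0 <= q).
Hypotheses (ap : forall J, uniq J -> l2 J a <= p) (bq : forall J, uniq J -> l2 J b <= q).

Let T := ((R -> R[i]) * (R -> R[i]))%type.
Let good (P : T) := inL2 I P.1 /\ inL2 I P.2.
Let N (P : T) := nrm I P.1 + w * nrm I P.2.
Let sub (P Q : T) : T := (fun s => P.1 s - Q.1 s, fun s => P.2 s - Q.2 s).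

Let goodB P Q : good P -> good Q -> good (sub P Q).
Proof. by move=> [p1 p2] [q1 q2]; split; exact: inL2B. Qed.

Let w_ge0 : 0 <= w. Proof. by lra. Qed.
Let w_ge1 : 1 <= w. Proof. by lra. Qed.
Let rho_ge0 : 0 <= rho. Proof. by lra. Qed.
Let rho_le1 : rho <= 1. Proof. by lra. Qed.
Let rho_lt1 : rho < 1. Proof. by lra. Qed.
Let rho_compl : 0 <= 1 - rho. Proof. by lra. Qed.

Let step_ex (P : T) : exists Q : T, good P -> good Q /\
  forall n, cf Q.1 n = a n - (X P.1 P.2 n - cf P.1 n) /\
            cf Q.2 n = b n - (Y P.1 P.2 n - cf P.2 n).
Proof.
have [gP|nP] := pselect (good P); last by exists P.
have [p1 p2] := gP; have a0 := nrm_ge0 I P.1; have b0 := nrm_ge0 I P.2.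
have [|J uJ|A Ai hA] := @riesz_fischer_l2 (fun n => a n - (X P.1 P.2 n - cf P.1 n))
   (p + (1748 / 10000 * nrm I P.1 + 1659 / 10000 * nrm I P.2)).
- exact: (addr_ge0 p0 (rowX_ge0 a0 b0)).
- apply: (le_trans (l2D _ _ _)); rewrite l2N.
  exact: (lerD (ap uJ) (errX_le thl uJ p1 p2)).
have [|J uJ|B Bi hB] := @riesz_fischer_l2 (fun n => b n - (Y P.1 P.2 n - cf P.2 n))
   (q + (6223 / 10000 * nrm I P.1 + 874 / 1000 * nrm I P.2)).
- exact: (addr_ge0 q0 (rowY_ge0 a0 b0)).
- apply: (le_trans (l2D _ _ _)); rewrite l2N.
  exact: (lerD (bq uJ) (errY_le thl uJ p1 p2)).
by exists (A, B).
Qed.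

Let step_contr (P Q P' Q' : T) : good P -> good Q -> good P' -> good Q' ->
  (forall n, cf P'.1 n = a n - (X P.1 P.2 n - cf P.1 n) /\
            cf P'.2 n = b n - (Y P.1 P.2 n - cf P.2 n)) ->
  (forall n, cf Q'.1 n = a n - (X Q.1 Q.2 n - cf Q.1 n) /\
            cf Q'.2 n = b n - (Y Q.1 Q.2 n - cf Q.2 n)) ->
  N (sub Q' P') <= rho * N (sub Q P).
Proof.
move=> gP gQ gP' gQ' hP hQ; have [s1 s2] := goodB gQ gP.
have [t1 t2] := goodB gQ' gP'.
have [P1 P2] := gP; have [Q1 Q2] := gQ; have [P1' P2'] := gP'; have [Q1' Q2'] := gQ'.
have a0 := nrm_ge0 I (sub Q P).1; have b0 := nrm_ge0 I (sub Q P).2.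
apply: le_trans (weighted_contraction a0 b0); rewrite {1}/N.
have h1 : nrm I (sub Q' P').1 <= 1748 / 10000 * nrm I (sub Q P).1 + 1659 / 10000 * nrm I (sub Q P).2.
  apply: Parseval_half; [|by []|move=> J uJ].
    exact: (rowX_ge0 a0 b0).
  apply: le_trans (errX_le thl uJ s1 s2); rewrite -[leRHS]l2N.
  rewrite le_eqVlt; apply/orP; left; apply/eqP; apply: eq_l2 => n.
  rewrite /sub/= (coefB half_gt0 n Q1' P1') (coefB half_gt0 n Q1 P1) (dataXB thl)//.
  by rewrite (proj1 (hP n)) (proj1 (hQ n)); ring.
have h2 : nrm I (sub Q' P').2 <= 6223 / 10000 * nrm I (sub Q P).1 + 874 / 1000 * nrm I (sub Q P).2.
  apply: Parseval_half; [|by []|move=> J uJ].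
    exact: (rowY_ge0 a0 b0).
  apply: le_trans (errY_le thl uJ s1 s2); rewrite -[leRHS]l2N.
  rewrite le_eqVlt; apply/orP; left; apply/eqP; apply: eq_l2 => n.
  rewrite /sub/= (coefB half_gt0 n Q2' P2') (coefB half_gt0 n Q2 P2) (dataYB thl)//.
  by rewrite (proj2 (hP n)) (proj2 (hQ n)); ring.
apply: (lerD h1); exact: (ler_wpM2l w_ge0 h2).
Qed.

Let errXn A B n : inL2 I A -> inL2 I B -> cabs (X A B n - cf A n) <= nrm I A + nrm I B.
Proof.
move=> Ai Bi; have := errX_le thl (J := [:: n]) isT Ai Bi.
rewrite /l2 big_seq1 sqrtr_sqr ger0_norm ?cabs_ge0// => h; apply: (le_trans h).
exact: (proj1 (rows_le_add (nrm_ge0 I A) (nrm_ge0 I B))).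
Qed.

Let errYn A B n : inL2 I A -> inL2 I B -> cabs (Y A B n - cf B n) <= nrm I A + nrm I B.
Proof.
move=> Ai Bi; have := errY_le thl (J := [:: n]) isT Ai Bi.
rewrite /l2 big_seq1 sqrtr_sqr ger0_norm ?cabs_ge0// => h; apply: (le_trans h).
exact: (proj2 (rows_le_add (nrm_ge0 I A) (nrm_ge0 I B))).
Qed.

Let eq_of_small (z : R[i]) (C : R) : (forall j : nat, cabs z <= C * rho ^+ j) -> z = 0.
Proof.
move=> h; apply: cabs_eq0; apply/eqP; rewrite eq_le cabs_ge0 andbT.
by apply: (geo_le0 _ h); rewrite rho_ge0 rho_lt1.
Qed.

(** The map sending (A, B) to the function with Fourier coefficients
    a - (X(A,B) - coef A), b - (Y(A,B) - coef B) is a contraction, and its fixed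
    point has the prescribed data. *)
Lemma interpolation : exists A B, [/\ inL2 I A, inL2 I B &
  forall n, X A B n = a n /\ Y A B n = b n].
Proof.
have /choice[F hF] := step_ex.
pose u j := iter j F ((fun=> 0, fun=> 0) : T).
have gu j : good (u j).
  elim: j => [|j ih]; first by split; exact: inL20.
  exact: (proj1 (hF _ ih)).
pose C := N (sub (u 1%N) (u 0%N)).
have Nd j : N (sub (u j.+1) (u j)) <= C * rho ^+ j.
  elim: j => [|j ih]; first by rewrite expr0 mulr1.
  apply: (@le_trans _ _ (rho * N (sub (u j.+1) (u j)))).
    apply: step_contr => //; [exact: (proj2 (hF _ (gu j)))|exact: (proj2 (hF _ (gu j.+1)))].
  by rewrite exprS mulrCA; apply: (ler_wpM2l rho_ge0 ih).
have C0 : 0 <= C by apply: addr_ge0; [exact: nrm_ge0|exact: (mulr_ge0 w_ge0 (nrm_ge0 _ _))].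
have r01 : 0 <= rho < 1 by rewrite rho_ge0 rho_lt1.
have II : - 2^-1 <= 2^-1 :> R by rewrite ge0_cp// ltW.
have [A Ai hA] : exists2 v : R -> R[i], inL2 I v &
    forall j : nat, nrm I (fun x : R => v x - (u j).1 x) <= C * rho ^+ j / (1 - rho).
  apply: L2_complete => // j; first by case: (gu j).
  apply: le_trans (Nd j); rewrite /N lerDl; exact: (mulr_ge0 w_ge0 (nrm_ge0 _ _)).
have [B Bi hB] : exists2 v : R -> R[i], inL2 I v &
    forall j : nat, nrm I (fun x : R => v x - (u j).2 x) <= C * rho ^+ j / (1 - rho).
  apply: L2_complete => // j; first by case: (gu j).
  apply: le_trans (Nd j); rewrite /N.
  apply: ler_wpDl; first exact: nrm_ge0.
  exact: (ler_peMl (nrm_ge0 _ _) w_ge1).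
exists A, B; split=> // n.
have D0 : 0 <= C / (1 - rho) by exact: (divr_ge0 C0 rho_compl).
have hS j : C * rho ^+ j.+1 / (1 - rho) <= C / (1 - rho) * rho ^+ j.
  have q1 : 0 <= rho ^+ j by exact: (exprn_ge0 j rho_ge0).
  have -> : C * rho ^+ j.+1 / (1 - rho) = C / (1 - rho) * rho ^+ j * rho by rewrite exprSr; ring.
  exact: (ler_piMr (mulr_ge0 D0 q1) rho_le1).
have h0 j : C * rho ^+ j / (1 - rho) <= C / (1 - rho) * rho ^+ j by rewrite mulrAC.
split; apply/eqP; rewrite -subr_eq0; apply/eqP;
  apply: (@eq_of_small _ (3 * (C / (1 - rho)))) => j.
- have [g1 g2] := gu j; have [f1 f2] := gu j.+1; have /(_ n) [h1 h2] := proj2 (hF _ (gu j)).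
  have e : X A B n - a n = cf (fun s => A s - (u j.+1).1 s) n +
     (X (fun s => A s - (u j).1 s) (fun s => B s - (u j).2 s) n - cf (fun s => A s - (u j).1 s) n).
    rewrite (dataXB thl)// (coefB half_gt0 n Ai f1) (coefB half_gt0 n Ai g1).
    rewrite -[u j.+1]/(F (u j)) h1; ring.
  rewrite e (le_trans (cabs_triangle _ _))//.
  apply: (le_trans (lerD (cabs_coef_half n (inL2B mI Ai f1)) (errXn n (inL2B mI Ai g1) (inL2B mI Bi g2)))).
  apply: (le_trans (lerD (le_trans (hA j.+1) (hS j)) (lerD (le_trans (hA j) (h0 j)) (le_trans (hB j) (h0 j))))).
  by rewrite le_eqVlt; apply/orP; left; apply/eqP; ring.
- have [g1 g2] := gu j; have [f1 f2] := gu j.+1; have /(_ n) [h1 h2] := proj2 (hF _ (gu j)).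
  have e : Y A B n - b n = cf (fun s => B s - (u j.+1).2 s) n +
     (Y (fun s => A s - (u j).1 s) (fun s => B s - (u j).2 s) n - cf (fun s => B s - (u j).2 s) n).
    rewrite (dataYB thl)// (coefB half_gt0 n Bi f2) (coefB half_gt0 n Bi g2).
    rewrite -[u j.+1]/(F (u j)) h2; ring.
  rewrite e (le_trans (cabs_triangle _ _))//.
  apply: (le_trans (lerD (cabs_coef_half n (inL2B mI Bi f2)) (errYn n (inL2B mI Ai g1) (inL2B mI Bi g2)))).
  apply: (le_trans (lerD (le_trans (hB j.+1) (hS j)) (lerD (le_trans (hA j) (h0 j)) (le_trans (hB j) (h0 j))))).
  by rewrite le_eqVlt; apply/orP; left; apply/eqP; ring.
Qed.

End Interpolation.

(** * The two halves of the spectrum *)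

Section Pieces.
Context {R : realType}.
Local Notation mu := (@lebesgue_measure R).
Implicit Types (f g P M phi : R -> R[i]) (c x s : R).

Local Notation I := (`[- (2^-1 : R), 2^-1]%classic).
Local Notation K := (`[- (1 : R), 1]%classic).

Let mI : measurable I. Proof. exact: measurable_itv. Qed.
Let mK : measurable K. Proof. exact: measurable_itv. Qed.

Lemma cmeas_shift c (D : set R) f : measurable D -> cmeas D f ->
  cmeas ((fun x => x + c) @^-1` D) (fun x => f (x + c)).
Proof.
move=> mD [m1 m2].
have mc : measurable_fun setT ((fun x => x + c) : measurableTypeR R -> measurableTypeR R).
  exact: measurable_funD.
have ms : measurable_fun ((fun x => x + c) @^-1` D) ((fun x => x + c) : measurableTypeR R -> measurableTypeR R).
  exact: measurable_funS mc.
have sD : (fun x => x + c) @` ((fun x => x + c) @^-1` D) `<=` D by move=> _ [y Dy <-].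
by split; [exact: (measurable_comp mD sD m1 ms)|exact: (measurable_comp mD sD m2 ms)].
Qed.

Lemma inL2_shift c (D : set R) f : measurable D -> inL2 D f ->
  inL2 ((fun x => x + c) @^-1` D) (fun x => f (x + c)) /\
  nrm ((fun x => x + c) @^-1` D) (fun x => f (x + c)) = nrm D f.
Proof.
move=> mD [mf fi].
have e : sqi ((fun x => x + c) @^-1` D) (fun x => f (x + c)) = sqi D f.
  rewrite /sqi (ge0_integral_shift c mD)//; first exact: measurable_cabs2.
  by move=> x _; rewrite lee_fin sqr_ge0.
by split; [split; [exact: cmeas_shift|rewrite e]|rewrite /nrm e].
Qed.

(** A point is a null set. *)
Lemma nrm_off_point (D : set R) f (a : R) : measurable D -> D a ->
  (forall x, D x -> x != a -> f x = 0) -> nrm D f = 0.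
Proof.
move=> mD Da f0; rewrite -nrm_indic.
have -> : nrm setT (fun x => f x * (\1_D x)%:C) = nrm setT (fun x => f x * (\1_[set a] x)%:C).
  apply: eq_nrm => x _; rewrite !indicE; have [->|xa] := eqVneq x a.
    by rewrite !mem_set.
  rewrite (memNset (A := [set a])); last by apply/eqP.
  have [xD|xD] := pselect (D x); first by rewrite f0// !mul0r.
  by rewrite memNset.
by rewrite nrm_indic /nrm /sqi integral_set1 sqrtr0.
Qed.

(** The half-spectrum with centre c, as a function of frequency. The pieces with
    centres 1/2 and -1/2 overlap only at frequency 0. *)
Definition piece c P x : R[i] := P (x - c) * (\1_(`[c - 2^-1, c + 2^-1]) x)%:C.

Lemma piece_itv c : (fun x => x + - c) @^-1` I = `[c - 2^-1, c + 2^-1]%classic.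
Proof.
rewrite shift_itvcc opprK; congr [set` Interval (BLeft _) (BRight _)]; exact: addrC.
Qed.

Lemma piece_sub c : `|c| <= 2^-1 -> `[c - 2^-1, c + 2^-1]%classic `<=` K.
Proof.
rewrite ler_norml => /andP[c1 c2] x /=; rewrite !in_itv/= => /andP[x1 x2].
by apply/andP; split; lra.
Qed.

Lemma inL2_piece c P : `|c| <= 2^-1 -> inL2 I P ->
  inL2 K (piece c P) /\ nrm K (piece c P) <= nrm I P.
Proof.
move=> c1 Pi; have [h1 h2] := inL2_shift (- c) mI Pi; rewrite piece_itv in h1 h2.
have mE : measurable `[c - 2^-1, c + 2^-1]%classic by exact: measurable_itv.
have h3 := inL2_indic mE h1; split; first exact: inL2S h3.
rewrite -h2 -[leRHS]nrm_indic.
exact: (nrmS mK measurableT (@subsetT _ _) h3).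
Qed.

Lemma ift_piece c P x : `|c| <= 2^-1 -> inL2 I P ->
  ift K (piece c P) x = cintegral I (fun s => P s * cis (2 * pi * x * (s + c))).
Proof.
move=> c1 Pi; have [[h1 _] _] := inL2_shift (- c) mI Pi; rewrite piece_itv in h1.
have mE : measurable `[c - 2^-1, c + 2^-1]%classic by exact: measurable_itv.
rewrite /ift cint_indic.
transitivity (cintegral `[c - 2^-1, c + 2^-1]%classic (fun xi => P (xi - c) * cis (2 * pi * x * xi))).
  rewrite [RHS]cint_indic; apply: eq_cint => y _; rewrite /piece !indicE.
  have [Ey|Ey] := pselect (`[c - 2^-1, c + 2^-1]%classic y).
    by rewrite mem_set// mem_set ?mulr1//; exact: piece_sub Ey.
  by rewrite (memNset (A := `[c - 2^-1, c + 2^-1]%classic))// !mulr0 !mul0r.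
rewrite (cint_shift c mE); last by apply: cmeasM => //; exact: cmeas_cis2.
rewrite shift_itvcc.
have -> : c - 2^-1 - c = - 2^-1 by rewrite addrAC subrr add0r.
have -> : c + 2^-1 - c = 2^-1 by rewrite addrAC subrr add0r.
by apply: eq_cint => s _; rewrite addrK.
Qed.

Lemma freq_piece c P : freq (piece c P) =
  piece c (fun s => ((2 * pi * (s + c))%:C * 'i%C) * P s).
Proof. by apply/funext => x; rewrite /freq /piece subrK mulrA. Qed.

Definition glue P M x : R[i] := piece 2^-1 P x + piece (- 2^-1) M x.

Let half1 : `|2^-1 : R| <= 2^-1. Proof. by rewrite ger0_norm// invr_ge0. Qed.
Let half2 : `|- 2^-1 : R| <= 2^-1. Proof. by rewrite normrN half1. Qed.

Lemma inL2_glue P M : inL2 I P -> inL2 I M ->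
  inL2 K (glue P M) /\ nrm K (glue P M) <= nrm I P + nrm I M.
Proof.
move=> Pi Mi; have [p1 p2] := inL2_piece half1 Pi; have [m1 m2] := inL2_piece half2 Mi.
split; first exact: inL2D.
by apply: (le_trans (nrmD mK p1 m1)); exact: lerD.
Qed.

Lemma ift_glue P M x : inL2 I P -> inL2 I M -> ift K (glue P M) x =
  cintegral I (fun s => P s * cis (2 * pi * x * (s + 2^-1))) +
  cintegral I (fun s => M s * cis (2 * pi * x * (s - 2^-1))).
Proof.
move=> Pi Mi; have [p1 _] := inL2_piece half1 Pi; have [m1 _] := inL2_piece half2 Mi.
by rewrite (iftD x ltr01 p1 m1) (ift_piece x half1 Pi) (ift_piece x half2 Mi).
Qed.

Lemma freq_glue P M : freq (glue P M) =
  glue (fun s => ((2 * pi * (s + 2^-1))%:C * 'i%C) * P s)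
       (fun s => ((2 * pi * (s - 2^-1))%:C * 'i%C) * M s).
Proof.
apply/funext => x; rewrite /glue -!freq_piece /freq mulrDr//.
Qed.

(** P and M are the two halves of the spectrum, translated to be centred at 0.
    Gluing them back changes the spectrum only at frequency 0, which the
    transform does not see. *)
Lemma PW_glue f : PW2pi f -> exists P M, [/\ inL2 I P, inL2 I M,
  f = ift K (glue P M), nrm I P <= nrm setT f & nrm I M <= nrm setT f].
Proof.
move=> /PW_rep[phi phii ->]; have [_ ->] := inL2_ift phii.
have sub1 : `[0, 1]%classic `<=` K.
  by move=> x /=; rewrite !in_itv/= => /andP[x1 x2]; apply/andP; split; lra.
have sub2 : `[-1, 0]%classic `<=` K.
  by move=> x /=; rewrite !in_itv/= => /andP[x1 x2]; apply/andP; split; lra.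
have m1 : measurable (`[0, 1]%classic : set R) by exact: measurable_itv.
have m2 : measurable (`[-1, 0]%classic : set R) by exact: measurable_itv.
have phi1 := inL2S m1 mK sub1 phii; have phi2 := inL2S m2 mK sub2 phii.
have e1 : (fun x : R => x + 2^-1) @^-1` `[0, 1]%classic = I.
  by rewrite shift_itvcc sub0r (_ : 1 - 2^-1 = 2^-1 :> R)//; field.
have e2 : (fun x : R => x + - 2^-1) @^-1` `[-1, 0]%classic = I.
  by rewrite shift_itvcc opprK add0r (_ : -1 + 2^-1 = - 2^-1 :> R)//; field.
have [p1 p2] := inL2_shift 2^-1 m1 phi1; rewrite e1 in p1 p2.
have [q1 q2] := inL2_shift (- 2^-1) m2 phi2; rewrite e2 in q1 q2.
set P := (fun x => phi (x + 2^-1)) in p1 p2; set M := (fun x => phi (x + - 2^-1)) in q1 q2.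
exists P, M; split=> //; last 2 first.
- by rewrite p2; exact: (nrmS m1 mK sub1 phii).
- by rewrite q2; exact: (nrmS m2 mK sub2 phii).
have [g1 _] := inL2_glue p1 q1; have di := inL2B mK phii g1.
apply/funext => x; apply/eqP; rewrite -subr_eq0; apply/eqP.
rewrite -(iftB x ltr01 phii g1); apply: cabs_eq0; apply/eqP.
rewrite eq_le cabs_ge0 andbT (le_trans (cabs_ift ltr01 x di))//.
(* The two pieces both contribute at 0, where phi is counted twice. *)
rewrite (@nrm_off_point _ _ 0) ?mulr0//.
  by rewrite /= in_itv/=; apply/andP; split; lra.
move=> y /=; rewrite in_itv/= => /andP[y1 y2] y0.
rewrite /glue /piece !indicE /P /M opprK subrK addrK.
have E1 : 2^-1 - 2^-1 = 0 :> R by rewrite subrr.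
have E2 : 2^-1 + 2^-1 = 1 :> R by field.
have E3 : - 2^-1 - 2^-1 = -1 :> R by field.
have E4 : - 2^-1 + 2^-1 = 0 :> R by rewrite addNr.
rewrite E1 E2 E3 E4; have [y3|y3] := leP 0 y.
  have y4 : 0 < y by rewrite lt_neqAle eq_sym y0.
  rewrite mem_set; last by rewrite /= in_itv/= y3.
  rewrite memNset; last by rewrite /= in_itv/= (leNgt y) y4 andbF.
  by rewrite mulr0 mulr1 addr0 subrr.
rewrite memNset; last by rewrite /= in_itv/= leNgt y3.
rewrite mem_set; last by rewrite /= in_itv/= y1 ltW.
by rewrite mulr0 mulr1 add0r subrr.
Qed.

End Pieces.

(** * Samples as Fourier coefficients *)

Section SampledData.
Context {R : realType}.
Implicit Types (f P M A B : R -> R[i]) (n : int).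

Local Notation I := (`[- (2^-1 : R), 2^-1]%classic).
Local Notation K := (`[- (1 : R), 1]%classic).
Local Notation cf := (coef (2^-1 : R)).

Let half_gt0 : 0 < 2^-1 :> R. Proof. by rewrite invr_gt0. Qed.
Let mI : measurable I. Proof. exact: measurable_itv. Qed.

(** The sign (-1)^n. *)
Definition alt n : R[i] := cis (pi * n%:~R).

Lemma altE n : alt n = (cos (pi * n%:~R))%:C.
Proof. by rewrite /alt /cis sin_pi_int. Qed.

Lemma alt_sqr n : alt n * alt n = 1.
Proof.
rewrite altE -(rmorphM (real_complex R))/= -expr2 cos2sin2 sin_pi_int expr0n/= subr0//.
Qed.

Lemma cabs_alt n : cabs (alt n) = 1. Proof. exact: cabs_cis. Qed.

Lemma alt_sym n : cis (- (pi * n%:~R)) = alt n :> R[i].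
Proof. by rewrite cisN -/(alt n) altE cJR. Qed.

(** At the node n + e the exponential factors into the n-th harmonic of the
    unit interval, a sign, and a slowly varying factor. *)
Lemma cis_node_p n (e s : R) : cis (2 * pi * (n%:~R + e) * (s + 2^-1)) =
  alt n * cis (pi * e) * cis (pi * e * (2 * s)) * ek 2^-1 n s.
Proof.
rewrite /alt /ek -!cisD invrK; congr (cis _).
have h : 2 * 2^-1 = 1 :> R by rewrite mulfV.
have -> : 2 * pi * (n%:~R + e) * (s + 2^-1) =
  2 * pi * (n%:~R + e) * s + pi * (n%:~R + e) * (2 * 2^-1) by ring.
rewrite h; ring.
Qed.

Lemma cis_node_m n (e s : R) : cis (2 * pi * (n%:~R + e) * (s - 2^-1)) =
  alt n * cis (- (pi * e)) * cis (pi * e * (2 * s)) * ek 2^-1 n s.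
Proof.
rewrite -alt_sym /ek -!cisD invrK; congr (cis _).
have h : 2 * 2^-1 = 1 :> R by rewrite mulfV.
have -> : 2 * pi * (n%:~R + e) * (s - 2^-1) =
  2 * pi * (n%:~R + e) * s - pi * (n%:~R + e) * (2 * 2^-1) by ring.
rewrite h; ring.
Qed.

Local Notation mod e P := (fun s => cis (pi * e * (2 * s)) * P s).

Lemma ift_glue_node P M n (e : R) : inL2 I P -> inL2 I M ->
  ift K (glue P M) (n%:~R + e) =
  alt n * (cis (pi * e) * cf (mod e P) n + cis (- (pi * e)) * cf (mod e M) n).
Proof.
move=> Pi Mi; rewrite (ift_glue _ Pi Mi).
have p1 := inL2_cis_lin (pi * e) Pi; have m1 := inL2_cis_lin (pi * e) Mi.
rewrite (mulrDr (alt n)) !(mulrA (alt n)); congr (_ + _).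
  rewrite -(coefZ half_gt0 _ n p1); apply: eq_cint => s _; rewrite cis_node_p.
  move: (cis _) (cis _) (ek _ _ _) (alt n) (P s) => u v k z p; ring.
rewrite -(coefZ half_gt0 _ n m1); apply: eq_cint => s _; rewrite cis_node_m.
move: (cis _) (cis _) (ek _ _ _) (alt n) (M s) => u v k z p; ring.
Qed.

Definition sigma P s : R[i] := (2 * s)%:C * P s.

Lemma inL2_sigma P : inL2 I P -> inL2 I (sigma P) /\ nrm I (sigma P) <= nrm I P.
Proof. by move=> /(inL2_poly 1)[]. Qed.

Lemma cderive_glue_node P M n (e : R) : inL2 I P -> inL2 I M ->
  cderive (ift K (glue P M)) (n%:~R + e) =
  (pi%:C * 'i%C) * (alt n *
    (cis (pi * e) * (cf (mod e (sigma P)) n + cf (mod e P) n) +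
     cis (- (pi * e)) * (cf (mod e (sigma M)) n - cf (mod e M) n))).
Proof.
move=> Pi Mi; have [g1 _] := inL2_glue Pi Mi; rewrite (cderive_ift ltr01 _ g1) freq_glue.
have [Ps _] := inL2_sigma Pi; have [Ms _] := inL2_sigma Mi.
have P1 := inL2D mI Ps Pi; have M1 := inL2B mI Ms Mi.
have P2 := inL2Z (pi%:C * 'i%C) mI P1; have M2 := inL2Z (pi%:C * 'i%C) mI M1.
have h : 2 * 2^-1 = 1 :> R by rewrite mulfV.
have eP : (fun s => (2 * pi * (s + 2^-1))%:C * 'i%C * P s) =
    (fun s => pi%:C * 'i%C * (sigma P s + P s)).
  apply/funext => s; rewrite /sigma.
  have -> : 2 * pi * (s + 2^-1) = pi * (2 * s + (2 * 2^-1)) by ring.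
  rewrite h; move: (2 * s) (P s) => t p.
  by apply: complexE; rewrite !(cReD, cImD, cReM, cImM)/=; ring.
have eM : (fun s => (2 * pi * (s - 2^-1))%:C * 'i%C * M s) =
    (fun s => pi%:C * 'i%C * (sigma M s - M s)).
  apply/funext => s; rewrite /sigma.
  have -> : 2 * pi * (s - 2^-1) = pi * (2 * s - (2 * 2^-1)) by ring.
  rewrite h; move: (2 * s) (M s) => t p.
  by apply: complexE; rewrite !(cReD, cImD, cReN, cImN, cReM, cImM)/=; ring.
rewrite eP eM (ift_glue_node n e P2 M2).
have cP := inL2_cis_lin (pi * e) Pi; have cM := inL2_cis_lin (pi * e) Mi.
have cPs := inL2_cis_lin (pi * e) Ps; have cMs := inL2_cis_lin (pi * e) Ms.
have -> : cf (mod e (fun s => pi%:C * 'i%C * (sigma P s + P s))) n =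
    (pi%:C * 'i%C) * (cf (mod e (sigma P)) n + cf (mod e P) n).
  rewrite -(coefD half_gt0 n cPs cP) -(coefZ half_gt0 _ n (inL2D mI cPs cP)).
  by apply: eq_coef => s _; rewrite -mulrDr mulrCA.
have -> : cf (mod e (fun s => pi%:C * 'i%C * (sigma M s - M s))) n =
    (pi%:C * 'i%C) * (cf (mod e (sigma M)) n - cf (mod e M) n).
  rewrite -(coefB half_gt0 n cMs cM) -(coefZ half_gt0 _ n (inL2B mI cMs cM)).
  by apply: eq_coef => s _; rewrite -mulrBr mulrCA.
move: (alt n) (cis _) (cis _) (_ + _) (_ - _) (_ * 'i%C) => z u v a b k; ring.
Qed.

(** At the integers, f and f' / (pi i) have the coefficients of these two
    combinations, up to sign. *)
Definition mixA P M s : R[i] := P s + M s.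
Definition mixB P M s : R[i] := (sigma P s + P s) + (sigma M s - M s).

Let coef2 (k1 k2 : R[i]) F G n : inL2 I F -> inL2 I G ->
  cf (fun s => k1 * F s + k2 * G s) n = k1 * cf F n + k2 * cf G n.
Proof.
move=> Fi Gi; rewrite (coefD half_gt0 n (inL2Z k1 mI Fi) (inL2Z k2 mI Gi)).
by rewrite (coefZ half_gt0 _ n Fi) (coefZ half_gt0 _ n Gi).
Qed.

Let inL2_2 (k1 k2 : R[i]) F G : inL2 I F -> inL2 I G ->
  inL2 I (fun s => k1 * F s + k2 * G s).
Proof. by move=> Fi Gi; exact: (inL2D mI (inL2Z k1 mI Fi) (inL2Z k2 mI Gi)). Qed.

Let sin_cos1 (t : R) : cos t * cos t + sin t * sin t = 1.
Proof. by rewrite -!expr2 addrC cos2Dsin2 || rewrite -!expr2 cos2Dsin2. Qed.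

Let unit_p (t : R) : ((cos t)%:C - 'i%C * (sin t)%:C) * cis t = 1.
Proof.
apply: complexE; rewrite !(cReD, cImD, cReN, cImN, cReM, cImM)/=.
  by transitivity (cos t * cos t + sin t * sin t); [ring|exact: sin_cos1].
ring.
Qed.

Let unit_m (t : R) : ((cos t)%:C + 'i%C * (sin t)%:C) * cis (- t) = 1.
Proof. by have := unit_p (- t); rewrite sinN cosN rmorphN/= mulrN opprK. Qed.

Let rot_p (t : R) : 'i%C * (sin t)%:C * cis t = 'i%C * (sin t * cos t)%:C - (sin t ^+ 2)%:C.
Proof.
by apply: complexE; rewrite !(cReD, cImD, cReN, cImN, cReM, cImM)/=; ring.
Qed.

Let rot_m (t : R) : 'i%C * (sin t)%:C * cis (- t) = 'i%C * (sin t * cos t)%:C + (sin t ^+ 2)%:C.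
Proof.
rewrite cisN; apply: complexE; rewrite !(cReD, cImD, cReN, cImN, cReM, cImM, cReJ, cImJ)/=; ring.
Qed.

Let rot2_p (t : R) : (cos t)%:C * cis t = 1 + 'i%C * (sin t * cos t)%:C - (sin t ^+ 2)%:C.
Proof.
apply: complexE; rewrite !(cReD, cImD, cReN, cImN, cReM, cImM)/=; last by ring.
by transitivity ((cos t * cos t + sin t * sin t) - sin t * sin t); [ring|rewrite sin_cos1; ring].
Qed.

Let rot2_m (t : R) : (cos t)%:C * cis (- t) = 1 - 'i%C * (sin t * cos t)%:C - (sin t ^+ 2)%:C.
Proof.
rewrite cisN; apply: complexE; rewrite !(cReD, cImD, cReN, cImN, cReM, cImM, cReJ, cImJ)/=; last by ring.
by transitivity ((cos t * cos t + sin t * sin t) - sin t * sin t); [ring|rewrite sin_cos1; ring].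
Qed.

Variable th : int -> R.
Hypothesis thl : forall n, `|th n| <= th0.

Variables (P M : R -> R[i]) (n : int) (e : R).
Hypotheses (Pi : inL2 I P) (Mi : inL2 I M) (the : th n = pi * e).

Let Ps := proj1 (inL2_sigma Pi).
Let Ms := proj1 (inL2_sigma Mi).
Let cP := inL2_cis_lin (pi * e) Pi.
Let cM := inL2_cis_lin (pi * e) Mi.
Let cPs := inL2_cis_lin (pi * e) Ps.
Let cMs := inL2_cis_lin (pi * e) Ms.
Let Ai : inL2 I (mixA P M) := inL2D mI Pi Mi.
Let Bi : inL2 I (mixB P M) := inL2D mI (inL2D mI Ps Pi) (inL2B mI Ms Mi).

Local Notation F := (ift K (glue P M) (n%:~R + e)).
Local Notation G := (cderive (ift K (glue P M)) (n%:~R + e) / (pi%:C * 'i%C)).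

Let pii_neq0 : pi%:C * 'i%C != 0 :> R[i].
Proof.
by rewrite mulf_neq0 ?neq0Ci// -(rmorph0 (real_complex R)) (inj_eq (@complexI R)) gt_eqF// pi_gt0.
Qed.

Let cancel_pii (z : R[i]) : pi%:C * 'i%C * z / (pi%:C * 'i%C) = z.
Proof. by rewrite mulrAC mulfV// mul1r. Qed.

(** Rotating the pair of samples by the angle pi e undoes, at sigma = 0, the
    phases e^(i pi e) and e^(- i pi e) of the two halves of the spectrum: this
    leaves a matrix close to the identity. *)
Lemma dataX_glue : dataX th (mixA P M) (mixB P M) n =
  alt n * ((cos (pi * e))%:C * F - 'i%C * (sin (pi * e))%:C * G).
Proof.
rewrite (ift_glue_node n e Pi Mi) (cderive_glue_node n e Pi Mi) cancel_pii.
rewrite /dataX -(coefD half_gt0 n (inL2_m11 thl n Ai) (inL2_m12 thl n Bi)).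
transitivity (cf (fun s =>
   (1 * mod e P s + - ('i%C * (sin (pi * e) * cos (pi * e))%:C - (sin (pi * e) ^+ 2)%:C) * mod e (sigma P) s) +
   (1 * mod e M s + - ('i%C * (sin (pi * e) * cos (pi * e))%:C + (sin (pi * e) ^+ 2)%:C) * mod e (sigma M) s)) n).
  apply: eq_coef => s _; rewrite the /m11 /m12 /mixA /mixB /sigma.
  move: (cis (pi * e * (2 * s))) (sin (pi * e)) (cos (pi * e)) (2 * s) (P s) (M s) => u x y t p m.
  apply: complexE; rewrite !(cReD, cImD, cReN, cImN, cReM, cImM)/=; ring.
rewrite (coefD half_gt0 n (inL2_2 _ _ cP cPs) (inL2_2 _ _ cM cMs)) (coef2 _ _ n cP cPs) (coef2 _ _ n cM cMs).
rewrite -rot_p -rot_m -[X in X * _ + _ + _](unit_p (pi * e)) -[X in _ + (X * _ + _)](unit_m (pi * e)).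
have al := alt_sqr n; move: (alt n) al => z al.
move: (cf _ _) (cf _ _) (cf _ _) (cf _ _) (cis _) (cis _) ((cos _)%:C) ((sin _)%:C) => b1 b a1 a v u y x.
have -> : z * (y * (z * (u * a + v * b)) - 'i%C * x * (z * (u * (a1 + a) + v * (b1 - b)))) =
  z * z * (y * (u * a + v * b) - 'i%C * x * (u * (a1 + a) + v * (b1 - b))) by ring.
rewrite al; ring.
Qed.

Lemma dataY_glue : dataY th (mixA P M) (mixB P M) n =
  alt n * ((cos (pi * e))%:C * G - 'i%C * (sin (pi * e))%:C * F).
Proof.
rewrite (ift_glue_node n e Pi Mi) (cderive_glue_node n e Pi Mi) cancel_pii.
rewrite /dataY -(coefD half_gt0 n (inL2_m21 thl n Ai) (inL2_m22 thl n Bi)).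
transitivity (cf (fun s =>
   (1 * mod e P s + (1 + 'i%C * (sin (pi * e) * cos (pi * e))%:C - (sin (pi * e) ^+ 2)%:C) * mod e (sigma P) s) +
   ((-1) * mod e M s + (1 - 'i%C * (sin (pi * e) * cos (pi * e))%:C - (sin (pi * e) ^+ 2)%:C) * mod e (sigma M) s)) n).
  apply: eq_coef => s _; rewrite the /m21 /m22 /mixA /mixB /sigma.
  move: (cis (pi * e * (2 * s))) (sin (pi * e)) (cos (pi * e)) (2 * s) (P s) (M s) => u x y t p m.
  apply: complexE; rewrite !(cReD, cImD, cReN, cImN, cReM, cImM)/=; ring.
rewrite (coefD half_gt0 n (inL2_2 _ _ cP cPs) (inL2_2 _ _ cM cMs)) (coef2 _ _ n cP cPs) (coef2 _ _ n cM cMs).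
rewrite -rot2_p -rot2_m -[X in X * _ + _ + _](unit_p (pi * e)) -[X in _ + (-X * _ + _)](unit_m (pi * e)).
have al := alt_sqr n; move: (alt n) al => z al.
move: (cf _ _) (cf _ _) (cf _ _) (cf _ _) (cis _) (cis _) ((cos _)%:C) ((sin _)%:C) => b1 b a1 a v u y x.
have -> : z * (y * (z * (u * (a1 + a) + v * (b1 - b))) - 'i%C * x * (z * (u * a + v * b))) =
  z * z * (y * (u * (a1 + a) + v * (b1 - b)) - 'i%C * x * (u * a + v * b)) by ring.
rewrite al; ring.
Qed.

End SampledData.

(** * Linear operations in the Paley-Wiener space *)

Section PWLinear.
Context {R : realType}.
Local Notation K := (`[- (1 : R), 1]%classic).
Implicit Types (f g : R -> R[i]).

Let mK : measurable K. Proof. exact: measurable_itv. Qed.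

Lemma PW_sub f g (c : R[i]) : PW2pi f -> PW2pi g ->
  PW2pi (fun x => f x - c * g x) /\
  forall x, cderive (fun x => f x - c * g x) x = cderive f x - c * cderive g x.
Proof.
move=> /PW_rep[phi phii ->] /PW_rep[psi psii ->].
have ci := inL2Z c mK psii; have di := inL2B mK phii ci.
have e : (fun x => ift K phi x - c * ift K psi x) = ift K (fun xi => phi xi - c * psi xi).
  by apply/funext => x; rewrite (iftB x ltr01 phii ci) (iftZ x c ltr01 psii).
rewrite e; split => [|x]; first exact: PW_ift.
have [f1 _] := inL2_freq ltr01 phii; have [f2 _] := inL2_freq ltr01 psii.
rewrite (cderive_ift ltr01 x di) (cderive_ift ltr01 x phii) (cderive_ift ltr01 x psii).
rewrite -(iftZ x c ltr01 f2) -(iftB x ltr01 f1 (inL2Z c mK f2)).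
congr (ift _ _ x); apply/funext => y; rewrite /freq.
move: (phi y) (psi y) (_ * 'i%C) => a b d; ring.
Qed.

Lemma PW_inL2 f : PW2pi f -> inL2 setT f.
Proof. by move=> [/L2E]. Qed.

Lemma PW_point_le f x : PW2pi f -> cabs (f x) <= Num.sqrt 2 * nrm setT f.
Proof.
move=> /PW_rep[phi phii ->]; have [_ ->] := inL2_ift phii.
by rewrite -[X in Num.sqrt X](mulr1 2); exact: (cabs_ift ltr01 x phii).
Qed.

Lemma PW_sub_sum f (g h : int -> R -> R[i]) (a b : int -> R[i]) (J : seq int) :
  PW2pi f -> (forall n, PW2pi (g n) /\ PW2pi (h n)) ->
  PW2pi (fun x => f x - \sum_(n <- J) (a n * g n x + b n * h n x)) /\
  forall x, cderive (fun x => f x - \sum_(n <- J) (a n * g n x + b n * h n x)) x =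
    cderive f x - \sum_(n <- J) (a n * cderive (g n) x + b n * cderive (h n) x).
Proof.
move=> PWf PWgh; elim: J => [|n J [ih1 ih2]].
  have e : (fun x => f x - \sum_(n <- [::]) (a n * g n x + b n * h n x)) = f.
    by apply/funext => x; rewrite big_nil subr0.
  by rewrite e; split => // x; rewrite big_nil subr0.
have [s1 s2] := PW_sub (a n) ih1 (proj1 (PWgh n)).
have [t1 t2] := PW_sub (b n) s1 (proj2 (PWgh n)).
have e : (fun x => f x - \sum_(n <- n :: J) (a n * g n x + b n * h n x)) =
  (fun x => f x - \sum_(n <- J) (a n * g n x + b n * h n x) - a n * g n x - b n * h n x).
  by apply/funext => x; rewrite big_cons; ring.
rewrite e; split => // x; rewrite t2 s2 ih2 big_cons; ring.
Qed.

End PWLinear.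

(** * Frame inequalities and interpolation *)

Section Sampling.
Context {R : realType}.
Implicit Types (f g P M A B : R -> R[i]) (n : int) (J : seq int).

Local Notation I := (`[- (2^-1 : R), 2^-1]%classic).
Local Notation K := (`[- (1 : R), 1]%classic).

Let mI : measurable I. Proof. exact: measurable_itv. Qed.

Variable eps : int -> R.
Hypothesis epsl : forall n, `|eps n| <= 111 / 1000.

Let th n := pi * eps n.
Let thl n : `|th n| <= th0. Proof. exact: pi_eps_le. Qed.

(** The inverse of (P, M) |-> (A, B). *)
Definition half_p A B s : R[i] := (2^-1)%:C * ((B s + A s) - sigma A s).
Definition half_m A B s : R[i] := (2^-1)%:C * ((A s + sigma A s) - B s).

Let mix_ineq (a b u v p' m' p m f : R) : a <= p + m -> b <= u + v -> u <= p' + p ->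
  v <= m' + m -> p' <= p -> m' <= m -> p <= f -> m <= f -> a + b <= 6 * f.
Proof. by move=> *; lra. Qed.

Let up_ineq (x : R) :
  16 * ((2 * (6 * x)) ^+ 2 + (2 * (6 * x)) ^+ 2) <= (100 * 100) ^+ 2 * x ^+ 2.
Proof.
rewrite !exprMn; have := sqr_ge0 x; move: (x ^+ 2) => y y0.
have -> : 16 * (2 ^+ 2 * (6 ^+ 2 * y) + 2 ^+ 2 * (6 ^+ 2 * y)) = (16 * 2 * 4) * 36 * y by ring.
by rewrite ler_wpM2r// !expr2; lra.
Qed.

Let low_ineq (a b s x : R) : 0 <= a -> 0 <= b -> 0 <= s -> x <= b + a + a ->
  a + 53 / 40 * b <= 2000 * (s + 53 / 40 * s) -> x <= 100 * 100 * s.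
Proof. by move=> *; lra. Qed.

Let half_half (z : R[i]) : (2^-1)%:C * (z + z) = z.
Proof.
have e : 2^-1 * 2 = 1 :> R by rewrite mulVf.
have -> : z + z = 2%:C * z by rewrite (rmorph_nat (real_complex R) 2) mulr_natl mulr2n.
rewrite mulrA.
by rewrite -(rmorphM (real_complex R)) e rmorph1 mul1r.
Qed.

Lemma half_p_mix P M s : half_p (mixA P M) (mixB P M) s = P s.
Proof.
rewrite -[RHS]half_half /half_p /mixA /mixB /sigma; congr (_ * _).
move: (P s) (M s) ((2 * s)%:C) => p m t; ring.
Qed.

Lemma half_m_mix P M s : half_m (mixA P M) (mixB P M) s = M s.
Proof.
rewrite -[RHS]half_half /half_m /mixA /mixB /sigma; congr (_ * _).
move: (P s) (M s) ((2 * s)%:C) => p m t; ring.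
Qed.

Lemma mixA_half A B : mixA (half_p A B) (half_m A B) = A.
Proof.
apply/funext => s; rewrite /half_p /half_m /mixA /sigma -mulrDr -[RHS]half_half; congr (_ * _).
move: (A s) (B s) ((2 * s)%:C) => p m t; ring.
Qed.

Lemma mixB_half A B : mixB (half_p A B) (half_m A B) = B.
Proof.
apply/funext => s; rewrite /half_p /half_m /mixB /sigma -[RHS]half_half.
move: (A s) (B s) ((2 * s)%:C) ((2^-1)%:C) => p m t u; ring.
Qed.

Lemma inL2_half A B : inL2 I A -> inL2 I B ->
  [/\ inL2 I (half_p A B), inL2 I (half_m A B),
      nrm I (half_p A B) <= 2^-1 * (nrm I B + nrm I A + nrm I A) &
      nrm I (half_m A B) <= 2^-1 * (nrm I B + nrm I A + nrm I A)].
Proof.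
move=> Ai Bi; have [As sA] := inL2_sigma Ai.
have a1 := inL2D mI Bi Ai; have a2 := inL2B mI a1 As.
have b1 := inL2D mI Ai As; have b2 := inL2B mI b1 Bi.
have c1 : cabs (2^-1)%:C = 2^-1 :> R by rewrite cabsR ger0_norm// invr_ge0.
have [p1 p2] := inL2_nrmZ (2^-1)%:C mI a2; have [m1 m2] := inL2_nrmZ (2^-1)%:C mI b2.
rewrite c1 in p2 m2; have h0 : 0 <= 2^-1 :> R by rewrite invr_ge0.
split => //.
  apply: (le_trans p2); apply: (ler_wpM2l h0); apply: (le_trans (nrmB mI a1 As)).
  by apply: lerD => //; exact: (nrmD mI Bi Ai).
apply: (le_trans m2); apply: (ler_wpM2l h0); apply: (le_trans (nrmB mI b1 Bi)).
rewrite -addrA addrC; apply: lerD => //; apply: (le_trans (nrmD mI Ai As)); exact: lerD.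
Qed.

Local Notation F f n := (f (node eps n)).
Local Notation G f n := (cderive f (node eps n) / (pi%:C * 'i%C)).

(** A row of a unitary matrix of order two; the other row exchanges x and y. *)
Definition rotX (t : R) (x y : R[i]) : R[i] := (cos t)%:C * x - 'i%C * (sin t)%:C * y.

Lemma rot_isometry n t (x y : R[i]) :
  cabs (alt n * rotX t x y) ^+ 2 + cabs (alt n * rotX t y x) ^+ 2 = cabs x ^+ 2 + cabs y ^+ 2.
Proof.
have h : cos t * cos t + sin t * sin t = 1 by rewrite -!expr2 cos2Dsin2.
rewrite (@cabsM _ (alt n) (rotX t x y)) (@cabsM _ (alt n) (rotX t y x)) cabs_alt !mul1r !cabs2E.
transitivity ((cos t * cos t + sin t * sin t) *
   (complex.Re x ^+ 2 + complex.Im x ^+ 2 + (complex.Re y ^+ 2 + complex.Im y ^+ 2))).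
  by rewrite /rotX !(cReD, cImD, cReN, cImN, cReM, cImM)/=; ring.
by rewrite h mul1r.
Qed.

Lemma alt_neq0 n : alt n != 0 :> R[i].
Proof.
have h := alt_sqr (R := R) n; apply/negP => /eqP e.
by have /eqP := oner_neq0 (R[i]); rewrite -h e mulr0.
Qed.

Lemma rot_inj t (x y x' y' : R[i]) : rotX t x y = rotX t x' y' ->
  rotX t y x = rotX t y' x' -> x = x' /\ y = y'.
Proof.
move=> h1 h2; have := rot_isometry 0 t (x - x') (y - y').
have rB a b c d : rotX t (a - b) (c - d) = rotX t a c - rotX t b d by rewrite /rotX; ring.
rewrite !rB h1 h2 !subrr mulr0 cabs0 expr0n/= addr0 => /esym/eqP.
rewrite paddr_eq0 ?sqr_ge0// !sqrf_eq0 => /andP[/eqP/cabs_eq0 e1 /eqP/cabs_eq0 e2].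
by split; apply/eqP; rewrite -subr_eq0 ?e1 ?e2.
Qed.

Let dataE P M n : inL2 I P -> inL2 I M ->
  dataX th (mixA P M) (mixB P M) n =
    alt n * rotX (th n) (F (ift K (glue P M)) n) (G (ift K (glue P M)) n) /\
  dataY th (mixA P M) (mixB P M) n =
    alt n * rotX (th n) (G (ift K (glue P M)) n) (F (ift K (glue P M)) n).
Proof.
move=> Pi Mi; split.
  exact: (dataX_glue thl Pi Mi (erefl _)).
exact: (dataY_glue thl Pi Mi (erefl _)).
Qed.

(** The change of variables (P, M) |-> (A, B) and its inverse are bounded, so that
    the norm of f is comparable to those of A and B. *)
Lemma PW_data f : PW2pi f -> exists A B, [/\ inL2 I A, inL2 I B,
    forall n, dataX th A B n = alt n * rotX (th n) (F f n) (G f n) /\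
              dataY th A B n = alt n * rotX (th n) (G f n) (F f n) &
    [/\ nrm I A + nrm I B <= 6 * nrm setT f &
      nrm setT f <= nrm I B + nrm I A + nrm I A]].
Proof.
move=> /PW_glue[P [M [Pi Mi -> nP nM]]].
have [Ps sP] := inL2_sigma Pi; have [Ms sM] := inL2_sigma Mi.
have Ai : inL2 I (mixA P M) := inL2D mI Pi Mi.
have B1 := inL2D mI Ps Pi; have B2 := inL2B mI Ms Mi.
have Bi : inL2 I (mixB P M) := inL2D mI B1 B2.
exists (mixA P M), (mixB P M); split => //; first by move=> n; exact: dataE.
have nA := nrmD mI Pi Mi; have nB := nrmD mI B1 B2.
have nB1 := nrmD mI Ps Pi; have nB2 := nrmB mI Ms Mi.
split.
  exact: (mix_ineq nA nB nB1 nB2 sP sM nP nM).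
have [g1 g2] := inL2_glue Pi Mi; have [_ ->] := inL2_ift g1; apply: (le_trans g2).
have [_ _ h1 h2] := inL2_half Ai Bi.
rewrite (@eq_nrm _ _ (half_p (mixA P M) (mixB P M)) P) in h1; last by move=> s _; rewrite half_p_mix.
rewrite (@eq_nrm _ _ (half_m (mixA P M) (mixB P M)) M) in h2; last by move=> s _; rewrite half_m_mix.
apply: (le_trans (lerD h1 h2)); rewrite -mulrDl.
by have -> : 2^-1 + 2^-1 = 1 :> R; [field|rewrite mul1r].
Qed.

Let pi_ge1 : 1 <= pi :> R. Proof. have := @pihalf_ge1 R; lra. Qed.
Let pi_le4 : pi <= 4 :> R. Proof. have := @pi_le R; lra. Qed.

Let cabs_pii : cabs (pi%:C * 'i%C : R[i]) = pi.
Proof. by rewrite (@cabsM R) cabsR cabsi mulr1 ger0_norm// pi_ge0. Qed.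

Let pii_neq0 : pi%:C * 'i%C != 0 :> R[i].
Proof.
by rewrite mulf_neq0 ?neq0Ci// -(rmorph0 (real_complex R)) (inj_eq (@complexI R)) gt_eqF// pi_gt0.
Qed.

Let G_le (z : R[i]) : cabs (z / (pi%:C * 'i%C)) ^+ 2 <= cabs z ^+ 2.
Proof.
rewrite (@cabsM R) cabsV cabs_pii ler_pXn2r ?nnegrE ?mulr_ge0 ?cabs_ge0 ?invr_ge0 ?pi_ge0//.
by rewrite ler_piMr ?cabs_ge0// invf_le1 ?pi_gt0.
Qed.

Let G_ge (z : R[i]) : cabs z ^+ 2 <= 16 * cabs (z / (pi%:C * 'i%C)) ^+ 2.
Proof.
have e : cabs z = pi * cabs (z / (pi%:C * 'i%C)).
  by rewrite (@cabsM R) cabsV cabs_pii mulrCA mulfV ?mulr1// gt_eqF// pi_gt0.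
rewrite e exprMn ler_wpM2r ?sqr_ge0// (_ : 16 = 4 ^+ 2); last by rewrite expr2; ring.
by rewrite le_pow ?pi_ge0.
Qed.

Definition energy f n : R := cabs (f (node eps n)) ^+ 2 + cabs (cderive f (node eps n)) ^+ 2.

Lemma energy_ge0 f n : 0 <= energy f n.
Proof. by rewrite addr_ge0// sqr_ge0. Qed.

Let energy_sum f A B J : (forall n, dataX th A B n = alt n * rotX (th n) (F f n) (G f n) /\
      dataY th A B n = alt n * rotX (th n) (G f n) (F f n)) ->
  l2 J (dataX th A B) ^+ 2 + l2 J (dataY th A B) ^+ 2 =
  \sum_(n <- J) (cabs (F f n) ^+ 2 + cabs (G f n) ^+ 2).
Proof.
move=> h; rewrite (l2_sqr J (dataX th A B)) (l2_sqr J (dataY th A B)) -big_split/=.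
by apply: eq_bigr => n _; have [-> ->] := h n; rewrite rot_isometry.
Qed.

Lemma energy_upper f J : PW2pi f -> uniq J ->
  \sum_(n <- J) energy f n <= (100 * 100) ^+ 2 * nrm setT f ^+ 2.
Proof.
move=> /PW_data[A [B [Ai Bi hD [hN _]]]] uJ.
have [hX hY] := data_upper thl uJ Ai Bi.
(* The factor 16 bounds pi^2, the square of the ratio of f' to its normalization. *)
have h1 : \sum_(n <- J) energy f n <= 16 * \sum_(n <- J) (cabs (F f n) ^+ 2 + cabs (G f n) ^+ 2).
  rewrite mulr_sumr; apply: ler_sum => n _; rewrite mulrDr; apply: lerD; last exact: G_ge.
  by rewrite ler_peMl ?sqr_ge0// ler1n.
apply: (le_trans h1); rewrite -(energy_sum J hD).
have X0 := l2_ge0 J (dataX th A B); have Y0 := l2_ge0 J (dataY th A B).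
have f0 := nrm_ge0 setT f; have h12 : 2 * (nrm I A + nrm I B) <= 2 * (6 * nrm setT f) by rewrite ler_wpM2l.
have X1 := le_pow 2 X0 (le_trans hX h12); have Y1 := le_pow 2 Y0 (le_trans hY h12).
have k0 : 0 <= 16 :> R := ler0n _ 16.
exact: (le_trans (ler_wpM2l k0 (lerD X1 Y1)) (up_ineq _)).
Qed.

Lemma energy_lower f E : PW2pi f -> 0 <= E ->
  (forall J, uniq J -> \sum_(n <- J) energy f n <= E) ->
  nrm setT f ^+ 2 <= (100 * 100) ^+ 2 * E.
Proof.
move=> /PW_data[A [B [Ai Bi hD [_ hN]]]] E0 hE.
have hs J : uniq J -> l2 J (dataX th A B) ^+ 2 + l2 J (dataY th A B) ^+ 2 <= E.
  move=> uJ; rewrite (energy_sum J hD); apply: le_trans (hE J uJ).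
  by apply: ler_sum => n _; apply: lerD => //; exact: G_le.
have s0 := sqrtr_ge0 E; have sE := sqr_sqrtr E0.
have hX J : uniq J -> l2 J (dataX th A B) <= Num.sqrt E.
  move=> uJ; rewrite -(@ler_pXn2r _ 2)// ?nnegrE ?l2_ge0// sE.
  by apply: le_trans (hs J uJ); rewrite lerDl sqr_ge0.
have hY J : uniq J -> l2 J (dataY th A B) <= Num.sqrt E.
  move=> uJ; rewrite -(@ler_pXn2r _ 2)// ?nnegrE ?l2_ge0// sE.
  by apply: le_trans (hs J uJ); rewrite lerDr sqr_ge0.
have := data_lower thl s0 s0 Ai Bi hX hY.
have a0 := nrm_ge0 I A; have b0 := nrm_ge0 I B; have f0 := nrm_ge0 setT f.
move=> h; have := le_pow 2 f0 (low_ineq a0 b0 s0 hN h).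
by rewrite exprMn sE.
Qed.

(** The data prescribed for (A, B) are the rotations of those prescribed for f,
    and rotations are injective. *)
Lemma PW_interpolation (a b : int -> R[i]) (E : R) :
  (forall J, uniq J -> \sum_(n <- J) (cabs (a n) ^+ 2 + cabs (b n) ^+ 2) <= E) ->
  exists2 f, PW2pi f & forall n, F f n = a n /\ cderive f (node eps n) = b n.
Proof.
move=> hE; pose b' n := b n / (pi%:C * 'i%C).
have E0 : 0 <= E by have := hE [::] isT; rewrite big_nil.
have s0 := sqrtr_ge0 E; have sE := sqr_sqrtr E0.
pose X n := alt n * rotX (th n) (a n) (b' n); pose Y n := alt n * rotX (th n) (b' n) (a n).
have hs J : uniq J -> l2 J X ^+ 2 + l2 J Y ^+ 2 <= E.
  move=> uJ; apply: le_trans (hE J uJ); rewrite !l2_sqr -big_split/=.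
  by apply: ler_sum => n _; rewrite rot_isometry; apply: lerD => //; exact: G_le.
have hX J : uniq J -> l2 J X <= Num.sqrt E.
  move=> uJ; rewrite -(@ler_pXn2r _ 2)// ?nnegrE ?l2_ge0// sE.
  by apply: le_trans (hs J uJ); rewrite lerDl sqr_ge0.
have hY J : uniq J -> l2 J Y <= Num.sqrt E.
  move=> uJ; rewrite -(@ler_pXn2r _ 2)// ?nnegrE ?l2_ge0// sE.
  by apply: le_trans (hs J uJ); rewrite lerDr sqr_ge0.
have [A [B [Ai Bi hAB]]] := interpolation thl s0 s0 hX hY.
have [Pi Mi _ _] := inL2_half Ai Bi; have [gi _] := inL2_glue Pi Mi.
exists (ift K (glue (half_p A B) (half_m A B))); first exact: PW_ift.
move=> n; have := dataE n Pi Mi; rewrite mixA_half mixB_half.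
have [-> ->] := hAB n => -[e1 e2].
have [h1 h2] := rot_inj (mulfI (alt_neq0 n) e1) (mulfI (alt_neq0 n) e2); split => //.
by rewrite -[LHS](divfK pii_neq0) -h2 divfK.
Qed.

End Sampling.

(** * Summation over the integers *)

Section Summation.
Context {R : realType}.
Implicit Types (u : int -> R[i]) (t : int -> R) (J : seq int).

Let sum_abs_le t (B : R) J : uniq J -> (forall J, uniq J -> `|\sum_(n <- J) t n| <= B) ->
  \sum_(n <- J) `|t n| <= B + B.
Proof.
move=> uJ h; rewrite (bigID (fun n => 0 <= t n))/=; apply: lerD.
  rewrite (eq_bigr t) => [|n t0]; last by rewrite ger0_norm.
  rewrite -big_filter; apply: (le_trans (ler_norm _)); apply: h; exact: filter_uniq.
rewrite (eq_bigr (fun n => - t n)) => [|n]; last by rewrite -ltNge => t0; rewrite ltr0_norm.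
rewrite sumrN -big_filter; apply: (le_trans (ler_norm _)); rewrite normrN; apply: h.
exact: filter_uniq.
Qed.

(** Bounded finite partial sums force absolute convergence: split the real and
    the imaginary parts according to their sign. *)
Lemma abs_summable_bounded u (B : R) :
  (forall J, uniq J -> cabs (\sum_(n <- J) u n) <= B) -> abs_summable u.
Proof.
move=> h; apply: (@le_lt_trans _ _ (B + B + (B + B))%:E); last exact: ltry.
apply: esum_le_of => J uJ.
have hRe : \sum_(n <- J) `|complex.Re (u n)| <= B + B.
  apply: sum_abs_le => // J' uJ'; rewrite -cRe_sum; apply: le_trans (h J' uJ').
  exact: ler_Re_cabs.
have hIm : \sum_(n <- J) `|complex.Im (u n)| <= B + B.
  apply: sum_abs_le => // J' uJ'; rewrite -cIm_sum; apply: le_trans (h J' uJ').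
  exact: ler_Im_cabs.
apply: le_trans (lerD hRe hIm); rewrite -big_split/=.
by apply: ler_sum => n _; exact: cabs_le_ReIm.
Qed.

(** Finite lists without repetition stand for the finite sets that index the net
    of partial sums. *)
Lemma sums_toP u (l : R[i]) :
  (forall e : R, 0 < e -> exists2 J0, uniq J0 & forall J, uniq J -> {subset J0 <= J} ->
    cabs (l - \sum_(n <- J) u n) <= e) -> sums_to u l.
Proof.
have PF := @summability.totally_filter int.
move=> h; apply/cvgrPdist_le => /= e e0.
have [r r0 er] : exists2 r : R, 0 < r & e = r%:C.
  move: e0; case: e => a b; rewrite ltcE/= => /andP[/eqP b0 a0].
  by exists a => //; rewrite b0.
have [J0 uJ0 hJ] := h r r0.
exists [fset n in J0]%fset => //= A /= /fsubsetP sA.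
have -> : summability.partial_sum (u : int -> Cplx) A = \sum_(n <- A) u n.
  by rewrite /summability.partial_sum big_seq_fsetE.
rewrite er normc_cabs lecR; apply: hJ; first exact: fset_uniq.
by move=> n nJ; apply: sA; rewrite in_fset.
Qed.

End Summation.

(** * The sampling expansion *)

Section Expansion.
Context {R : realType}.
Implicit Types (f : R -> R[i]) (n : int) (J : seq int).

Variable eps : int -> R.
Hypothesis epsl : forall n, `|eps n| <= 111 / 1000.

Local Notation C := ((100 * 100) ^+ 2 : R).
Local Notation energy := (energy eps).

Let C_gt0 : 0 < C. Proof. by rewrite exprn_gt0// mulr_gt0. Qed.

Lemma PW_eq f1 f2 : PW2pi f1 -> PW2pi f2 ->
  (forall n, f1 (node eps n) = f2 (node eps n)) ->
  (forall n, cderive f1 (node eps n) = cderive f2 (node eps n)) -> f1 = f2.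
Proof.
move=> h1 h2 v d; have [h3 dh] := PW_sub 1 h1 h2.
have := energy_lower epsl h3 (lexx 0).
rewrite mulr0 => h; have n0 : nrm setT (fun x => f1 x - 1 * f2 x) = 0.
  apply/eqP; rewrite -sqrf_eq0 eq_le sqr_ge0 andbT; apply: h => J _.
  rewrite big1// => n _; rewrite /energy dh v d !mul1r !subrr cabs0 expr0n/= addr0//.
apply/funext => x; have := PW_point_le x h3; rewrite n0 mulr0 mul1r => h0.
by apply/eqP; rewrite -subr_eq0; apply/eqP/cabs_eq0/eqP; rewrite eq_le h0 cabs_ge0.
Qed.

Lemma PW_frame f : PW2pi f ->
  ((C^-1)%:E * sample_energy eps f <= L2norm f ^+ 2)%E /\
  (L2norm f ^+ 2 <= C%:E * sample_energy eps f)%E.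
Proof.
move=> PWf; have fi := PW_inL2 PWf; rewrite (L2norm_nrm fi) -EFin_expe.
have up : (sample_energy eps f <= (C * nrm setT f ^+ 2)%:E)%E.
  by apply: esum_le_of => J uJ; exact: (energy_upper epsl PWf uJ).
split; first by rewrite lee_pdivrMl// -EFinM.
have s0 : (0 <= sample_energy eps f)%E.
  by apply: esum_ge0 => n _; rewrite lee_fin; exact: energy_ge0.
have lo : forall J, uniq J -> ((\sum_(n <- J) energy f n)%:E <= sample_energy eps f)%E.
  by move=> J uJ; exact: sum_le_esum.
move: (sample_energy eps f) up s0 lo => [E| |]//= _ E0 lo.
rewrite -EFinM lee_fin; apply: (energy_lower epsl PWf); first by rewrite -lee_fin.
by move=> J uJ; rewrite -lee_fin; exact: lo.
Qed.

Let delta_sum (k : int) J : uniq J -> \sum_(n <- J) cabs ((n == k)%:R : R[i]) ^+ 2 <= 1.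
Proof.
move=> uJ; rewrite (bigID (fun n => n == k))/= [X in _ + X]big1 ?addr0; last first.
  by move=> n /negbTE ->; rewrite cabs0 expr0n.
rewrite (eq_bigr (fun=> 1)) => [|n /eqP ->]; last by rewrite eqxx cabs1 expr1n.
rewrite -big_filter big_const_seq iter_addr_0.
have -> : count predT [seq n <- J | n == k] = (k \in J).
  by rewrite count_predT size_filter -(count_uniq_mem k uJ).
by case: (k \in J).
Qed.

(** These are the interpolants of the unit data. *)
Lemma dual_functions : exists g h : int -> R -> R[i],
  (forall n, PW2pi (g n) /\ PW2pi (h n)) /\
  forall n k, [/\ g n (node eps k) = (k == n)%:R, cderive (g n) (node eps k) = 0,
    h n (node eps k) = 0 & cderive (h n) (node eps k) = (k == n)%:R].
Proof.
have hg n : exists g, PW2pi g /\ forall k, g (node eps k) = (k == n)%:R /\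
    cderive g (node eps k) = 0.
  have [J uJ|g g1 g2] := @PW_interpolation R eps epsl (fun k => (k == n)%:R) (fun=> 0) 1.
    rewrite big_split/= [X in _ + X]big1 ?addr0 ?delta_sum// => k _.
    by rewrite cabs0 expr0n.
  by exists g.
have hh n : exists g, PW2pi g /\ forall k, g (node eps k) = 0 /\
    cderive g (node eps k) = (k == n)%:R.
  have [J uJ|g g1 g2] := @PW_interpolation R eps epsl (fun=> 0) (fun k => (k == n)%:R) 1.
    rewrite big_split/= [X in X + _]big1 ?add0r ?delta_sum// => k _.
    by rewrite cabs0 expr0n.
  by exists g.
have [g Hg] := choice hg; have [h Hh] := choice hh.
exists g, h; split=> [n|n k]; first by split; [case: (Hg n)|case: (Hh n)].
have [_ /(_ k)[-> ->]] := Hg n; have [_ /(_ k)[-> ->]] := Hh n; by [].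
Qed.

Variables (g h : int -> R -> R[i]).
Hypothesis PWgh : forall n, PW2pi (g n) /\ PW2pi (h n).
Hypothesis dual : forall n k, [/\ g n (node eps k) = (k == n)%:R,
  cderive (g n) (node eps k) = 0, h n (node eps k) = 0 &
  cderive (h n) (node eps k) = (k == n)%:R].
Variable f : R -> R[i].
Hypothesis PWf : PW2pi f.

Let u x n := f (node eps n) * g n x + cderive f (node eps n) * h n x.
Let res J x := f x - \sum_(n <- J) u x n.

Let res_PW J : PW2pi (res J).
Proof.
exact: (proj1 (PW_sub_sum (fun n => f (node eps n)) (fun n => cderive f (node eps n)) J PWf PWgh)).
Qed.

Let sum_delta (a : int -> R[i]) k J : uniq J ->
  \sum_(n <- J) a n * (k == n)%:R = if k \in J then a k else 0.
Proof.
move=> uJ; case: ifPn => kJ; last first.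
  rewrite big_seq big1// => n nJ; case: eqP => [e|_]; last by rewrite mulr0.
  by rewrite e nJ in kJ.
rewrite (bigD1_seq k)//= eqxx mulr1 big1 ?addr0// => n nk.
by rewrite eq_sym (negbTE nk) mulr0.
Qed.

Let res_energy J k : uniq J -> energy (res J) k = if k \in J then 0 else energy f k.
Proof.
move=> uJ; have [_ d] := PW_sub_sum (fun n => f (node eps n)) (fun n => cderive f (node eps n)) J PWf PWgh.
have e1 : res J (node eps k) = if k \in J then 0 else f (node eps k).
  rewrite /res /u (eq_bigr (fun n => f (node eps n) * (k == n)%:R)) => [|n _].
    by rewrite sum_delta//; case: ifP => _; rewrite ?subrr ?subr0.
  by have [-> _ -> _] := dual n k; rewrite mulr0 addr0.
have e2 : cderive (res J) (node eps k) = if k \in J then 0 else cderive f (node eps k).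
  rewrite d (eq_bigr (fun n => cderive f (node eps n) * (k == n)%:R)) => [|n _].
    by rewrite sum_delta//; case: ifP => _; rewrite ?subrr ?subr0.
  by have [_ -> _ ->] := dual n k; rewrite mulr0 add0r.
rewrite /energy e1 e2; case: ifP => // _.
by rewrite cabs0 expr0n/= addr0.
Qed.

Let res_bound J E x : uniq J -> 0 <= E ->
  (forall J', uniq J' -> (forall n, n \in J' -> n \notin J) -> \sum_(n <- J') energy f n <= E) ->
  cabs (res J x) <= Num.sqrt 2 * Num.sqrt (C * E).
Proof.
move=> uJ E0 hE; apply: (le_trans (PW_point_le x (res_PW J))).
apply: ler_wpM2l; first exact: sqrtr_ge0.
have CE : 0 <= C * E by exact: (mulr_ge0 (ltW C_gt0) E0).
rewrite -(@ler_pXn2r _ 2)// ?nnegrE ?nrm_ge0 ?sqrtr_ge0// (sqr_sqrtr CE).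
apply: (energy_lower epsl (res_PW J) E0) => J' uJ'.
rewrite (eq_bigr (fun n => if n \notin J then energy f n else 0)) => [|n _]; last first.
  by rewrite res_energy// if_neg.
rewrite -big_mkcond -big_filter; apply: hE; first exact: filter_uniq.
by move=> n; rewrite mem_filter => /andP[].
Qed.

(** The residual f - sum over J of the expansion has the data of f outside J and
    zero on J, so the frame inequality bounds it by the energy outside J. That
    energy is bounded, whence absolute convergence, and tends to 0, whence
    convergence to f. *)
Lemma expansion x : abs_summable (u x) /\ sums_to (u x) (f x).
Proof.
have f0 := nrm_ge0 setT f; have M0 : 0 <= C * nrm setT f ^+ 2.
  by exact: (mulr_ge0 (ltW C_gt0) (sqr_ge0 _)).
split.
  apply: (@abs_summable_bounded _ _ (cabs (f x) + Num.sqrt 2 * Num.sqrt (C * (C * nrm setT f ^+ 2)))).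
  move=> J uJ; have -> : \sum_(n <- J) u x n = f x - res J x.
    by rewrite /res opprB addrC subrK.
  rewrite (le_trans (cabs_triangle _ _))// lerD2l cabsN; apply: res_bound => // J' uJ' _.
  exact: (energy_upper epsl PWf uJ').
apply: sums_toP => e e0.
have e1 : 0 < e ^+ 2 / (2 * C) by exact: (divr_gt0 (exprn_gt0 2 e0) (mulr_gt0 (ltr0n _ 2) C_gt0)).
pose a n : R[i] := (Num.sqrt (energy f n))%:C.
have a2 n : cabs (a n) ^+ 2 = energy f n.
  by rewrite cabsR ger0_norm ?sqrtr_ge0// sqr_sqrtr// energy_ge0.
have aM J : uniq J -> \sum_(n <- J) cabs (a n) ^+ 2 <= C * nrm setT f ^+ 2.
  by move=> uJ; rewrite (eq_bigr _ (fun n _ => a2 n)); exact: (energy_upper epsl PWf uJ).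
have [J0 [uJ0 hJ0]] := tail_small e1 aM.
exists J0 => // J uJ sJ.
have := @res_bound J (e ^+ 2 / (2 * C)) x uJ (ltW e1).
have -> : Num.sqrt 2 * Num.sqrt (C * (e ^+ 2 / (2 * C))) = e.
  rewrite -sqrtrM//; have -> : 2 * (C * (e ^+ 2 / (2 * C))) = e ^+ 2.
    have : C != 0 by rewrite gt_eqF.
    move: C => c c0; field; exact: c0.
  by rewrite sqrtr_sqr ger0_norm// ltW.
apply => J' uJ' dJ; rewrite -(eq_bigr _ (fun n _ => a2 n)); apply: hJ0 => // n nJ'.
by apply/negP => /sJ; apply/negP; exact: dJ.
Qed.

End Expansion.

Theorem theorem1p3 (R : realType) (L : R) (hL : L < 111 / 1000) :
  exists C : R, 0 < C /\
    forall eps : int -> R,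
      ereal_sup (range (fun k : int => (`|eps k|)%:E)) = L%:E ->
      [/\ forall f1 f2 : R -> R[i], PW2pi f1 -> PW2pi f2 ->
            (forall n : int, f1 (node eps n) = f2 (node eps n)) ->
            (forall n : int,
               cderive f1 (node eps n) = cderive f2 (node eps n)) ->
            f1 = f2,
          forall f : R -> R[i], PW2pi f ->
            ((C^-1)%:E * sample_energy eps f <= L2norm f ^+ 2)%E /\
            (L2norm f ^+ 2 <= C%:E * sample_energy eps f)%E
        & exists g h : int -> R -> R[i],
            (forall n : int, PW2pi (g n) /\ PW2pi (h n)) /\
            forall f : R -> R[i], PW2pi f -> forall x : R,
              let u := fun n : int =>
                f (node eps n) * g n x + cderive f (node eps n) * h n x in
              abs_summable u /\ sums_to u (f x)].
Proof.
exists ((100 * 100) ^+ 2); split; first by rewrite exprn_gt0// mulr_gt0.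
move=> eps hs.
have epsl n : `|eps n| <= 111 / 1000.
  apply: le_trans (ltW hL); rewrite -lee_fin -hs; apply: ereal_sup_ubound.
  by exists n.
split; [exact: PW_eq|exact: PW_frame|].
have [g [h [PWgh dual]]] := dual_functions epsl.
exists g, h; split=> // f PWf x; exact: (expansion epsl PWgh dual PWf x).
Qed.
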